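(* Let $\mathfrak g$ be of type $\widehat{\mathfrak{sl}}_2$ or $A_2^{(2)}$. There is a unique map $b\mapsto P_b$ from $B(-\infty)$ to type $\mathfrak g$ decorated pseudo-Weyl polytopes satisfying conditions (W), (C1)–(C4), (S1)–(S4) and (I) below, for all $b\in B(-\infty)$. Moreover, this map is $b\mapsto MV_b$. - **(W)** $\mathrm{wt}(b)=\mathrm{wt}(P_b)$. - **(C1)** $\mathbf c^r_{\alpha_0}(P_{\tilde e_0b})=\mathbf c^r_{\alpha_0}(P_b)+1$, and $\mathbf c^r_\alpha(P_{\tilde e_0b})=\mathbf c^r_\alpha(P_b)$ for all $\alpha\ne\alpha_0$ (including $\alpha=\delta$). - **(C2)** $\mathbf c^\ell_{\alpha_1}(P_{\tilde e_1b})=\mathbf c^\ell_{\alpha_1}(P_b)+1$, and $\mathbf c^\ell_\alpha(P_{\tilde e_1b})=\mathbf c^\ell_\alpha(P_b)$ for all $\alpha\ne\alpha_1$. - **(C3)** $\mathbf c^\ell_{\alpha_0}(P_{\tilde e_0^*b})=\mathbf c^\ell_{\alpha_0}(P_b)+1$, and $\mathbf c^\ell_\alpha(P_{\tilde e^*_0b})=\mathbf c^\ell_\alpha(P_b)$ for all $\alpha\ne\alpha_0$. - **(C4)** $\mathbf c^r_{\alpha_1}(P_{\tilde e_1^*b})=\mathbf c^r_{\alpha_1}(P_b)+1$, and $\mathbf c^r_\alpha(P_{\tilde e^*_1b})=\mathbf c^r_\alpha(P_b)$ for all $\alpha\ne\alpha_1$. - **(S1)** If $\varphi_0(b)=0$,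 then $\mathbf c^\ell(P_{\sigma_0(b)})=\mathbf c^r(P_b)\circ s_0$. - **(S2)** If $\varphi_1(b)=0$, then $\mathbf c^r(P_{\sigma_1(b)})=\mathbf c^\ell(P_b)\circ s_1$. - **(S3)** If $\varphi_0^*(b)=0$, then $\mathbf c^r(P_{\sigma^*_0(b)})=\mathbf c^\ell(P_b)\circ s_0$. - **(S4)** If $\varphi_1^*(b)=0$, then $\mathbf c^\ell(P_{\sigma^*_1(b)})=\mathbf c^r(P_b)\circ s_1$. - **(I)** Suppose $\mathbf c^\ell_\beta(P_b)=0$ for all positive real roots $\beta$, and $\mathbf c^\ell_\delta(P_b)=\lambda$ is a nonempty partition with largest part $\lambda_1$. Then: - $\mathbf c^r_{\alpha_1}(P_b)=\frac{|\alpha_0|}{|\alpha_1|}\lambda_1$; - $\mathbf c^r_{\alpha_0}(P_b)=\lambda_1$; - $\mathbf c^r_\delta(P_b)=\lambda\setminus\lambda_1$, the partition obtained by removing one largest part; - $\mathbf c^r_\beta(P_b)=0$ for all other positive real roots $\beta$.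
   Context: **Setup.** Let $\mathfrak g$ be $\widehat{\mathfrak{sl}}_2$ or $A_2^{(2)}$, with Dynkin nodes $0,1$. For $A_2^{(2)}$, node $0$ is the long root. The simple roots $\alpha_0,\alpha_1$ lie in a 3-dimensional real space. This space carries a nondegenerate symmetric form $(\cdot,\cdot)$ with $(\alpha_i,\alpha_j)=N_{ij}$, where - $N=\begin{pmatrix}2&-2\\-2&2\end{pmatrix}$ for $\widehat{\mathfrak{sl}}_2$, - $N=\begin{pmatrix}8&-4\\-4&2\end{pmatrix}$ for $A_2^{(2)}$. Write $|\alpha|=\sqrt{(\alpha,\alpha)}$. Put $\delta=\alpha_0+\alpha_1$ for $\widehat{\mathfrak{sl}}_2$ and $\delta=\alpha_0+2\alpha_1$ for $A_2^{(2)}$. Fix $\omega_0,\omega_1$ with $(\alpha_i,\omega_j)=\delta_{ij}$. Let $s_0,s_1$ be the simple reflections. The positive real roots are: - for $\widehat{\mathfrak{sl}}_2$: $\alpha_0+k\delta$ and $\alpha_1+k\delta$ ($k\ge0$); - for $A_2^{(2)}$: $\alpha_1+k\delta$, $\alpha_0+2k\delta$, $\alpha_0+\alpha_1+k\delta$, $2\alpha_1+(2k+1)\delta$ ($k\ge0$). The positive imaginary roots are $k\delta$, $k\ge1$. Label the positive real roots $\beta_k,\beta^k$ ($k\ge1$): - for $\widehat{\mathfrak{sl}}_2$: $\beta_k=\alpha_1+(k-1)\delta$ and $\beta^k=\alpha_0+(k-1)\delta$; - for $A_2^{(2)}$: $\beta_k=\alpha_1+\frac{k-1}{2}\delta$ ($k$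 odd), $\beta_k=2\alpha_1+(k-1)\delta$ ($k$ even); $\beta^k=\alpha_0+(k-1)\delta$ ($k$ odd), $\beta^k=\alpha_0+\alpha_1+\frac{k-2}{2}\delta$ ($k$ even). **Lusztig data and pseudo-Weyl polytopes.** A Lusztig datum $\mathbf c$ consists of a nonnegative integer $\mathbf c_\beta$ for each positive real root $\beta$ (all but finitely many zero), together with a partition $\mathbf c_\delta$. Its weight is $|\mathbf c_\delta|\delta+\sum_\beta \mathbf c_\beta\beta$. A decorated pseudo-Weyl polytope $P$ is a pair $(\mathbf c^\ell(P),\mathbf c^r(P))$ of Lusztig data of equal weight $\mathrm{wt}(P)$. Its vertices are defined as follows: - $\mu^r_0=\mu^\ell_0=0$; - $\mu^r_k=\mu^r_{k-1}+\mathbf c^r_{\beta_k}\beta_k$ and $\mu^\ell_k=\mu^\ell_{k-1}+\mathbf c^\ell_{\beta^k}\beta^k$; - $\mu^{r,0}=\mu^{\ell,0}=\mathrm{wt}(P)$; - $\mu^{r,k}=\mu^{r,k-1}-\mathbf c^r_{\beta^k}\beta^k$ and $\mu^{\ell,k}=\mu^{\ell,k-1}-\mathbf c^\ell_{\beta_k}\beta_k$. Let $\mu^r_\infty,\mu^{r,\infty},\mu^\ell_\infty,\mu^{\ell,\infty}$ denote the eventually constant values of these sequences. **MV polytopes.** $P$ is an MV polytope if the following four conditions hold. 1. For all $k\ge2$: $\max\{(\mu^\ell_k-\mu^r_{k-1},\omega_1),(\mu^r_k-\mu^\ell_{k-1},\omega_0)\}=0$. 2. For all $k\ge2$: $\min\{(\mu^{\ell,k}-\mu^{r,k-1},\omega_0),(\mu^{r,k}-\mu^{\ell,k-1},\omega_1)\}=0$.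 3. If $\mu^r_\infty-\mu^\ell_\infty$ and $\mu^{r,\infty}-\mu^{\ell,\infty}$ are parallel, then $\mathbf c^r_\delta=\mathbf c^\ell_\delta$. Otherwise one of $\mathbf c^r_\delta,\mathbf c^\ell_\delta$ is obtained from the other by removing a part of size $\frac{|\alpha_1|}{2|\alpha_0|}(\mu^r_\infty-\mu^\ell_\infty,\alpha_1)$. 4. The largest parts of $\mathbf c^r_\delta$ and $\mathbf c^\ell_\delta$ are both $\le\frac{|\alpha_1|}{2|\alpha_0|}(\mu^r_\infty-\mu^\ell_\infty,\alpha_1)$. By Baumann–Dunlap–Kamnitzer–Tingley (BDKT), for each Lusztig datum $\mathbf c$ there is exactly one MV polytope with right datum $\mathbf c$, and exactly one with left datum $\mathbf c$. Define operators on MV polytopes: - $\tilde e_0P$ is the MV polytope whose right datum is $\mathbf c^r(P)$ with $\mathbf c^r_{\alpha_0}$ increased by $1$; - $\tilde e_1P$ is the MV polytope whose left datum is $\mathbf c^\ell(P)$ with $\mathbf c^\ell_{\alpha_1}$ increased by $1$; - $\tilde f_0,\tilde f_1$ decrease these entries instead, giving $\emptyset$ if the entry is $0$. By BDKT, the set of MV polytopes with these operators is a crystal isomorphic to $B(-\infty)$. For $b\in B(-\infty)$, $MV_b$ denotes the MV polytope corresponding to $b$. **Reflected Lusztig data.** For a Lusztig datum $\mathbf c$ with $\mathbf c_{\alpha_i}=0$, define $\mathbf c\circ s_i$ by - $(\mathbf c\circ s_i)_{\alpha_i}=0$; - $(\mathbf c\circ s_i)_\beta=\mathbf c_{s_i(\beta)}$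 for positive real $\beta\ne\alpha_i$; - $(\mathbf c\circ s_i)_\delta=\mathbf c_\delta$. **Crystal notation.** $B(-\infty)$ is Kashiwara's crystal of $U_q^+(\mathfrak g)$ (lowest weight $b_0$, operators $\tilde e_i,\tilde f_i$, weight map $\mathrm{wt}$). Define $\varphi_i(b)=\max\{n:\tilde f_i^nb\ne\emptyset\}$ and $\varepsilon_i(b)=\varphi_i(b)-\langle\alpha_i^\vee,\mathrm{wt} b\rangle$. Let $*$ be Kashiwara's involution. Set $\tilde e_i^*=*\tilde e_i*$, $\tilde f_i^*=*\tilde f_i*$, $\varphi_i^*=\varphi_i\circ*$ and $\varepsilon_i^*=\varepsilon_i\circ*$. For $g\in\{\tilde f_i,\tilde f_i^*\}$, $g^{\max}x$ means $g^mx$ with $m$ maximal such that $g^mx\ne\emptyset$. **Saito reflections (convention used here).** For $b$ with $\varphi_i(b)=0$, set $\sigma_i(b):=(\tilde f_i^* )^{\max}\tilde e_i^{\,N}b$ for any $N\ge\varepsilon_i^*(b)$; this is independent of $N$. For $b$ with $\varphi_i^*(b)=0$, set $\sigma_i^*(b):=*\sigma_i( *b)=\tilde f_i^{\max}(\tilde e_i^* )^Nb$ for $N\ge\varepsilon_i(b)$. *)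

(* Defs.v *)
From HB Require Import structures.
From mathcomp Require Import all_boot all_order all_algebra.
Set Implicit Arguments.
Unset Strict Implicit.
Unset Printing Implicit Defensive.
Import Order.TTheory GRing.Theory Num.Theory.
Local Open Scope ring_scope.

Inductive gtype := Sl2hat | A22.
Inductive node := Node0 | Node1.

(* Vectors of the root lattice, in coordinates w.r.t. (alpha_0, alpha_1).
   All vectors occurring (roots, delta, vertices, weights) lie in the span
   of alpha_0, alpha_1 inside the 3-dimensional space. *)
Definition vec := (int * int)%type.
Definition vzero : vec := (0, 0).
Definition vadd (u v : vec) : vec := (u.1 + v.1, u.2 + v.2).
Definition vsub (u v : vec) : vec := (u.1 - v.1, u.2 - v.2).
Definition vscale (n : int) (v : vec) : vec := (n * v.1, n * v.2).
Definition vsum (n : nat) (F : nat -> vec) : vec :=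
  foldr vadd vzero [seq F j | j <- iota 0 n].

Definition alpha (i : node) : vec :=
  match i with Node0 => (1, 0) | Node1 => (0, 1) end.

Definition delta (t : gtype) : vec :=
  match t with Sl2hat => vadd (alpha Node0) (alpha Node1)
             | A22 => vadd (alpha Node0) (vscale 2 (alpha Node1)) end.

Definition Nform (t : gtype) (i j : node) : int :=
  match t, i, j with
  | Sl2hat, Node0, Node0 => 2  | Sl2hat, Node0, Node1 => -2
  | Sl2hat, Node1, Node0 => -2 | Sl2hat, Node1, Node1 => 2
  | A22, Node0, Node0 => 8     | A22, Node0, Node1 => -4
  | A22, Node1, Node0 => -4    | A22, Node1, Node1 => 2
  end.

Definition form (t : gtype) (u v : vec) : int :=
  u.1 * v.1 * Nform t Node0 Node0 + u.1 * v.2 * Nform t Node0 Node1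
  + u.2 * v.1 * Nform t Node1 Node0 + u.2 * v.2 * Nform t Node1 Node1.

Definition pair_omega (u : vec) (j : node) : int :=
  match j with Node0 => u.1 | Node1 => u.2 end.

Definition cartan (t : gtype) (i j : node) : int :=
  ((2 * Nform t i j) %/ Nform t i i)%Z.
Definition coroot_pair (t : gtype) (i : node) (w : vec) : int :=
  cartan t i Node0 * w.1 + cartan t i Node1 * w.2.

Definition norm_ratio (t : gtype) : nat :=
  match t with Sl2hat => 1%N | A22 => 2%N end.
Lemma norm_ratio_spec t :
  ((norm_ratio t)%:Z ^+ 2 * Nform t Node1 Node1 = Nform t Node0 Node0)%R.
Proof. by case: t. Qed.

Definition sref (t : gtype) (i : node) (v : vec) : vec :=
  vsub v (vscale (coroot_pair t i v) (alpha i)).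

(* Positive real roots, labelled 0-based:
     Blo k  stands for  beta_{k+1},   Bup k  stands for  beta^{k+1}.   *)
Inductive preal := Blo of nat | Bup of nat.

Definition root_vec (t : gtype) (r : preal) : vec :=
  match t, r with
  | Sl2hat, Blo k => vadd (alpha Node1) (vscale k%:Z (delta Sl2hat))
  | Sl2hat, Bup k => vadd (alpha Node0) (vscale k%:Z (delta Sl2hat))
  | A22, Blo k =>
      if ~~ odd k
      then vadd (alpha Node1) (vscale (k./2)%:Z (delta A22))
      else vadd (vscale 2 (alpha Node1)) (vscale k%:Z (delta A22))
  | A22, Bup k =>
      if ~~ odd k
      then vadd (alpha Node0) (vscale k%:Z (delta A22))
      else vadd (vadd (alpha Node0) (alpha Node1)) (vscale (k./2)%:Z (delta A22))
  end.

Definition alpha_label (i : node) : preal :=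
  match i with Node0 => Bup 0 | Node1 => Blo 0 end.

(* Lusztig data.  Real part: entry k of [clo] is c_{beta_{k+1}}, entry k of
   [cup] is c_{beta^{k+1}} (entries beyond the lists are 0, so the support is
   finite).  Imaginary part: a partition, stored as a nonincreasing list of
   positive integers. *)
Record ldatum := LD { clo : seq nat; cup : seq nat; cdel : seq nat }.

Definition coef (c : ldatum) (r : preal) : nat :=
  match r with Blo k => nth 0%N (clo c) k | Bup k => nth 0%N (cup c) k end.

Definition is_partition (l : seq nat) : bool :=
  sorted geq l && all (fun x => 0 < x)%N l.

Definition is_ldatum (c : ldatum) : Prop := is_partition (cdel c).

Definition largest_part (l : seq nat) : nat := foldr maxn 0%N l.

Definition ld_wt (t : gtype) (c : ldatum) : vec :=
  vadd (vscale (sumn (cdel c))%:Z (delta t))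
    (vadd (vsum (size (clo c)) (fun j => vscale (coef c (Blo j))%:Z (root_vec t (Blo j))))
          (vsum (size (cup c)) (fun j => vscale (coef c (Bup j))%:Z (root_vec t (Bup j))))).

Definition ld_eq (c c' : ldatum) : Prop :=
  (forall r, coef c r = coef c' r) /\ cdel c = cdel c'.

Definition ld_incr (c c' : ldatum) (r : preal) : Prop :=
  coef c' r = (coef c r).+1 /\ (forall r', r' <> r -> coef c' r' = coef c r')
  /\ cdel c' = cdel c.

(* c' = c o s_i  (defined when c_{alpha_i} = 0) *)
Definition reflected (t : gtype) (i : node) (c c' : ldatum) : Prop :=
  coef c (alpha_label i) = 0%N /\ coef c' (alpha_label i) = 0%N /\
  (forall r r', r <> alpha_label i -> root_vec t r' = sref t i (root_vec t r) ->
     coef c' r = coef c r') /\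
  cdel c' = cdel c.

Record dpwp := DP { cl : ldatum; cr : ldatum }.

Definition is_dpwp (t : gtype) (P : dpwp) : Prop :=
  is_ldatum (cl P) /\ is_ldatum (cr P) /\ ld_wt t (cl P) = ld_wt t (cr P).

Definition pw_wt (t : gtype) (P : dpwp) : vec := ld_wt t (cr P).

Definition pw_eq (P Q : dpwp) : Prop := ld_eq (cl P) (cl Q) /\ ld_eq (cr P) (cr Q).

Definition mu_r (t : gtype) (P : dpwp) (k : nat) : vec :=
  vsum k (fun j => vscale (coef (cr P) (Blo j))%:Z (root_vec t (Blo j))).
Definition mu_l (t : gtype) (P : dpwp) (k : nat) : vec :=
  vsum k (fun j => vscale (coef (cl P) (Bup j))%:Z (root_vec t (Bup j))).
Definition mu_r' (t : gtype) (P : dpwp) (k : nat) : vec :=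
  vsub (pw_wt t P) (vsum k (fun j => vscale (coef (cr P) (Bup j))%:Z (root_vec t (Bup j)))).
Definition mu_l' (t : gtype) (P : dpwp) (k : nat) : vec :=
  vsub (pw_wt t P) (vsum k (fun j => vscale (coef (cl P) (Blo j))%:Z (root_vec t (Blo j)))).

Definition mu_r_inf t P := mu_r t P (size (clo (cr P))).
Definition mu_l_inf t P := mu_l t P (size (cup (cl P))).
Definition mu_r'_inf t P := mu_r' t P (size (cup (cr P))).
Definition mu_l'_inf t P := mu_l' t P (size (clo (cl P))).

Definition remove_part (s : nat) (L L' : seq nat) : Prop :=
  s \in L /\ L' = rem s L.

Definition parallel (u v : vec) : Prop := u.1 * v.2 - u.2 * v.1 = 0.

Definition is_MV (t : gtype) (P : dpwp) : Prop :=
  (forall k, (2 <= k)%N ->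
     Num.max (pair_omega (vsub (mu_l t P k) (mu_r t P k.-1)) Node1)
             (pair_omega (vsub (mu_r t P k) (mu_l t P k.-1)) Node0) = 0) /\
  (forall k, (2 <= k)%N ->
     Num.min (pair_omega (vsub (mu_l' t P k) (mu_r' t P k.-1)) Node0)
             (pair_omega (vsub (mu_r' t P k) (mu_l' t P k.-1)) Node1) = 0) /\
  (* X := (mu^r_inf - mu^l_inf, alpha_1); a part of size
     |alpha_1|/(2|alpha_0|) X  means a part s with 2 (|alpha_0|/|alpha_1|) s = X *)
  (let u := vsub (mu_r_inf t P) (mu_l_inf t P) in
   let v := vsub (mu_r'_inf t P) (mu_l'_inf t P) in
   let X := form t u (alpha Node1) in
   (parallel u v -> cdel (cr P) = cdel (cl P)) /\
   (~ parallel u v ->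
      exists s : nat, ((2 * norm_ratio t * s)%N)%:Z = X /\
        (remove_part s (cdel (cr P)) (cdel (cl P)) \/
         remove_part s (cdel (cl P)) (cdel (cr P)))) /\
   (cdel (cr P) != [::] ->
      ((2 * norm_ratio t * largest_part (cdel (cr P)))%N)%:Z <= X) /\
   (cdel (cl P) != [::] ->
      ((2 * norm_ratio t * largest_part (cdel (cl P)))%N)%:Z <= X)).

(* Crystals.  B(-infty): lowest weight element b0, e_i total (raising),
   f_i partial (None = emptyset), weights in root-lattice coordinates. *)

Fixpoint iter_opt (B : Type) (g : B -> option B) (n : nat) (b : B) : option B :=
  match n with 0%N => Some b | n'.+1 => obind g (iter_opt g n' b) end.

Definition phi_is (B : Type) (g : B -> option B) (b : B) (n : nat) : Prop :=
  iter_opt g n b <> None /\ iter_opt g n.+1 b = None.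

Definition gmax_is (B : Type) (g : B -> option B) (b b' : B) : Prop :=
  exists n, iter_opt g n b = Some b' /\ g b' = None.

Definition generated (B : Type) (e : node -> B -> B) (b0 b : B) : Prop :=
  exists s : seq node, b = foldr (fun i x => e i x) b0 s.

Definition lowest_crystal (B : Type) (b0 : B) (wt : B -> vec)
  (e : node -> B -> B) (f : node -> B -> option B) : Prop :=
  (forall i b b', f i b = Some b' <-> e i b' = b) /\
  (forall i b, wt (e i b) = vadd (wt b) (alpha i)) /\
  (forall b, generated e b0 b).

(* Characterization of (B(-infty), e_i, f_i, e_i^star, f_i^star ) as a bicrystal
   (Kashiwara-Saito; Tingley-Webster Prop. 1.4), translated to the
   lowest-weight convention: e = raising (total), f = lowering (partial),
   phi_i(b) = max{n : f_i^n b <> empty}. *)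
Definition is_Binf (t : gtype) (B : Type) (b0 : B) (wt : B -> vec)
  (e : node -> B -> B) (f : node -> B -> option B)
  (es : node -> B -> B) (fs : node -> B -> option B) : Prop :=
  lowest_crystal b0 wt e f /\ lowest_crystal b0 wt es fs /\
  wt b0 = vzero /\ (forall b, wt b = vzero -> b = b0) /\
  (forall i j b, i <> j -> es i (e j b) = e j (es i b)) /\
  (forall i b n ns, phi_is (f i) b n -> phi_is (fs i) b ns ->
     let d := n%:Z + ns%:Z - coroot_pair t i (wt b) in
     0 <= d /\
     (d = 0 -> e i b = es i b) /\
     (1 <= d -> (forall m, phi_is (fs i) (e i b) m -> m = ns) /\
                (forall m, phi_is (f i) (es i b) m -> m = n)) /\
     (2 <= d -> e i (es i b) = es i (e i b))).

(* Phi is a crystal isomorphism from B onto the crystal of MV polytopes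
   (BDKT), i.e. Phi b = MV_b. *)
Definition mv_crystal_iso (t : gtype) (B : Type) (wt : B -> vec)
  (e : node -> B -> B) (Phi : B -> dpwp) : Prop :=
  (forall b, is_dpwp t (Phi b) /\ is_MV t (Phi b)) /\
  (forall Q, is_dpwp t Q -> is_MV t Q -> exists b, pw_eq (Phi b) Q) /\
  (forall b b', pw_eq (Phi b) (Phi b') -> b = b') /\
  (forall b, pw_wt t (Phi b) = wt b) /\
  (forall b, ld_incr (cr (Phi b)) (cr (Phi (e Node0 b))) (alpha_label Node0)) /\
  (forall b, ld_incr (cl (Phi b)) (cl (Phi (e Node1 b))) (alpha_label Node1)).

Section Conditions.
Variables (t : gtype) (B : Type) (wt : B -> vec) (e es : node -> B -> B)
  (f fs : node -> B -> option B) (P : B -> dpwp).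

Definition cond_W := forall b, wt b = pw_wt t (P b).
Definition cond_C1 := forall b,
  ld_incr (cr (P b)) (cr (P (e Node0 b))) (alpha_label Node0).
Definition cond_C2 := forall b,
  ld_incr (cl (P b)) (cl (P (e Node1 b))) (alpha_label Node1).
Definition cond_C3 := forall b,
  ld_incr (cl (P b)) (cl (P (es Node0 b))) (alpha_label Node0).
Definition cond_C4 := forall b,
  ld_incr (cr (P b)) (cr (P (es Node1 b))) (alpha_label Node1).

(* sigma_i(b) = (f_i^star)^max e_i^N b,  N >= eps_i^star(b) = phi_i^star(b) - <alpha_i^vee, wt b> *)
Definition is_sigma (i : node) (b s : B) : Prop :=
  exists ns N, phi_is (fs i) b ns /\ ns%:Z - coroot_pair t i (wt b) <= N%:Z /\
    gmax_is (fs i) (iter N (e i) b) s.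
(* sigma^star_i(b) = f_i^max (e_i^star)^N b,  N >= eps_i(b) = phi_i(b) - <alpha_i^vee, wt b> *)
Definition is_sigma_star (i : node) (b s : B) : Prop :=
  exists n N, phi_is (f i) b n /\ n%:Z - coroot_pair t i (wt b) <= N%:Z /\
    gmax_is (f i) (iter N (es i) b) s.

Definition cond_S1 := forall b s, f Node0 b = None -> is_sigma Node0 b s ->
  reflected t Node0 (cr (P b)) (cl (P s)).
Definition cond_S2 := forall b s, f Node1 b = None -> is_sigma Node1 b s ->
  reflected t Node1 (cl (P b)) (cr (P s)).
Definition cond_S3 := forall b s, fs Node0 b = None -> is_sigma_star Node0 b s ->
  reflected t Node0 (cl (P b)) (cr (P s)).
Definition cond_S4 := forall b s, fs Node1 b = None -> is_sigma_star Node1 b s ->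
  reflected t Node1 (cr (P b)) (cl (P s)).

Definition cond_I := forall b,
  (forall r, coef (cl (P b)) r = 0%N) -> cdel (cl (P b)) != [::] ->
  let lam := cdel (cl (P b)) in
  let l1 := largest_part lam in
  coef (cr (P b)) (alpha_label Node1) = (norm_ratio t * l1)%N /\
  coef (cr (P b)) (alpha_label Node0) = l1 /\
  cdel (cr (P b)) = rem l1 lam /\
  (forall r, r <> alpha_label Node0 -> r <> alpha_label Node1 ->
     coef (cr (P b)) r = 0%N).

Definition conditions : Prop :=
  (forall b, is_dpwp t (P b)) /\
  cond_W /\ cond_C1 /\ cond_C2 /\ cond_C3 /\ cond_C4 /\
  cond_S1 /\ cond_S2 /\ cond_S3 /\ cond_S4 /\ cond_I.
End Conditions.

(* Main.v *)
(* Dividing the second coordinate by |alpha_0|/|alpha_1| turns the real roots of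
   both types into multiples of (k, k+1) and (k+1, k), so both types live in one
   geometry, which is symmetric under exchanging the coordinates (nodes) and
   under the half-turn that swaps left and right data.

   Fix a node, say 0.  Remove the alpha_0-edges and apply s_0 to the left path.
   The MV conditions become a complementarity problem for two paths M (right) and
   V (reflected left) with the same increasing slopes: at every vertex the height
   difference and a certain slack are nonnegative and one of them is 0.  The
   horizontal distance d between the ends of M and V, a positive combination of
   the height differences, is phi_0 + phi_0^star - <alpha_0^vee, wt>.  Scanning
   along the paths shows: d >= 0, with equality only if M = V; the length of the
   lower alpha_0-edge depends on M alone unless d = 0; and of two solutions with
   the same M and the same lower alpha_0-edge, one coincides with M beyond the
   vertex where they separate.  The last point makes raising the two alpha_0-edges
   commute as long as d >= 2.

   Hence e_i^N b is s_i-symmetric for large N, one Lusztig datum determines the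
   polytope, and raising the opposite alpha_i-edge obeys the recursion along the
   e_j that characterizes e_i^star.  This gives (C3), (C4), and (S1)-(S4) are read
   off the symmetric polytopes; (I) is an explicit MV polytope.

   Uniqueness is by induction on the height of the weight.  If no operator lowers
   b, then a Saito reflection lowers the height, unless wt b is a multiple of
   delta.  In that case Saito reflections move a nonzero real coefficient towards
   a simple root, where some operator applies, and (I) settles the data that are
   purely imaginary. *)
Require Import Defs.
From HB Require Import structures.
From mathcomp Require Import all_boot all_order all_algebra.
From mathcomp Require Import zify ring lra.
Set Implicit Arguments.
Unset Strict Implicit.
Unset Printing Implicit Defensive.
Import Order.TTheory GRing.Theory Num.Theory.
Local Open Scope ring_scope.

(** * Complementarity profiles *)

(** MV conditions 3 and 4 on the two partitions, with [s] the common bound. Parallelism is traded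
    for equality of sizes, which can be seen on the paths; [MV_quad] and [quad_MV_is_MV] justify the
    trade. *)
Definition delta_cond (R : realFieldType) (l l' : seq nat) (s : R) : Prop :=
  [/\ forall k, k \in l -> k%:R <= s, forall k, k \in l' -> k%:R <= s,
      sumn l = sumn l' -> l = l'
    & sumn l != sumn l' ->
      exists2 k : nat, k%:R = s & remove_part k l l' \/ remove_part k l' l].

Lemma sumn_rem k (l : seq nat) : k \in l -> sumn l = (k + sumn (rem k l))%N.
Proof. by move=> /perm_to_rem /perm_sumn ->. Qed.

Lemma delta_cond_sym (R : realFieldType) l l' (s : R) :
  delta_cond l l' s -> delta_cond l' l s.
Proof.
case=> a b c d; split=> //; first by move=> /esym /c.
by rewrite eq_sym => /d [k hk [h|h]]; exists k => //; [right|left].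
Qed.

(** * Profiles over a fixed path *)

Section Profile.
Variables (R : realFieldType) (A : nat) (sg : nat -> R).

(** A slope is dx/dy. The edges are numbered from 0 to [A.*2.+4], and the middle one, [A.+2], has
    the direction of delta. *)
Definition slopes : Prop :=
  [/\ forall i, (i < A.*2.+4)%N -> sg i < sg i.+1, 0 <= sg 0%N,
      sg A.*2.+4 <= 2 & sg A.+2 = 1].

(* A profile [t] lists the vertical distances between corresponding vertices of
   two paths with slopes [sg], whose edge from vertex [A.+2] to [A.+3] is the
   imaginary one; [gap t i] is the horizontal distance accumulated up to [i]. *)
Definition gap (t : nat -> R) (i : nat) : R :=
  \sum_(j < i) (sg j.+1 - sg j) * t j.+1.

(** The slack of a pair of paths in terms of [t] (see [lcp_slackE]): [f] is the contribution of the
    fixed path and [n] that of the lower edge along the simple root. *)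
Definition slack n (f t : nat -> R) (i : nat) : R :=
  n - f i - gap t i.-1 - (2 - sg i.-1) * t i.-1.

(** The ends of the imaginary edge are left out: the zero-length edges beside it give them the
    values of the regular vertices [A.+1] and [A.+4]. *)
Definition regular i := [&& 0 < i, i <= A.*2.+4, i != A.+2 & i != A.+3]%N.

Record profile (n : R) (f : nat -> R) (l : seq nat) (t : nat -> R) (l' : seq nat)
  : Prop := Profile {
  prof0 : t 0%N = 0;
  prof_flat1 : t A.+1 = t A;
  prof_flat2 : t A.+2 = t A;
  prof_jump : t A.+3 = t A + (sumn l)%:R - (sumn l')%:R;
  prof_flat3 : t A.+4 = t A.+3;
  prof_ge0 : forall i, regular i -> 0 <= t i;
  prof_slack : forall i, regular i -> 0 <= slack n f t i;
  prof_compl : forall i, regular i -> t i = 0 \/ slack n f t i = 0;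
  prof_delta : delta_cond l l' (slack n f t A.+1 + t A.+1) }.

Hypothesis sgP : slopes.

Lemma slope_lt i j : (i < j <= A.*2.+4)%N -> sg i < sg j.
Proof.
case: sgP => h _ _ _; elim: j => [|j IH] // hj.
have hS : sg j < sg j.+1 by apply: h; lia.
case: (ltngtP i j) => [ij|ji|-> //]; last by lia.
by apply: lt_trans hS; apply: IH; lia.
Qed.

Lemma slope_lt2 i : (i < A.*2.+4)%N -> sg i < 2.
Proof. by case: sgP => h _ h2 _ hi; apply: lt_le_trans (slope_lt _) h2; lia. Qed.

Lemma regular_or i : (0 < i <= A.*2.+4)%N -> [\/ regular i, i = A.+2 | i = A.+3].
Proof.
move=> hi; case: (eqVneq i A.+2) => [|h1]; first by constructor 2.
case: (eqVneq i A.+3) => [|h2]; first by constructor 3.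
by constructor 1; rewrite /regular h1 h2; lia.
Qed.

Lemma prof_pos n f l t l' i : profile n f l t l' -> (i <= A.*2.+4)%N -> 0 <= t i.
Proof.
move=> P; case: i => [|i] hi; first by rewrite (prof0 P).
case: (@regular_or i.+1) => // [h|[->]|[->]]; first exact: prof_ge0 P _ h.
  by rewrite (prof_flat2 P) -(prof_flat1 P); apply: (prof_ge0 P); rewrite /regular; lia.
by rewrite -(prof_flat3 P); apply: (prof_ge0 P); rewrite /regular; lia.
Qed.

Lemma gapS t i : gap t i.+1 = gap t i + (sg i.+1 - sg i) * t i.+1.
Proof. by rewrite /gap big_ord_recr. Qed.

Lemma gap0 t i : (forall j, (0 < j <= i)%N -> t j = 0) -> gap t i = 0.
Proof. by move=> h; rewrite /gap big1 // => j _; rewrite h ?mulr0 //=; lia. Qed.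

Lemma le_gap t t' i : (i <= A.*2.+4)%N ->
  (forall j, (0 < j <= i)%N -> t j <= t' j) -> gap t i <= gap t' i.
Proof.
move=> hi h; rewrite /gap; apply: ler_sum => -[j hj] _ /=.
apply: ler_wpM2l; last by apply: h => /=; lia.
by rewrite subr_ge0 ltW // slope_lt //; lia.
Qed.

Lemma lt_gap t t' i k : (0 < k <= i)%N -> (i <= A.*2.+4)%N -> t k < t' k ->
  (forall j, (0 < j <= i)%N -> t j <= t' j) -> gap t i < gap t' i.
Proof.
move=> /andP[k0]; elim: i => [|i IH]; first by lia.
rewrite !gapS leq_eqVlt => /orP[/eqP->|ki] hi hk h.
  have h1 : gap t i <= gap t' i.
    by apply: le_gap => [|j hj]; [lia|apply: h; lia].
  have h2 : sg i < sg i.+1 by apply: slope_lt; lia.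
  by nra.
have h1 : gap t i < gap t' i.
  by apply: IH => //; [lia|move=> j hj; apply: h; lia].
have h2 : sg i < sg i.+1 by apply: slope_lt; lia.
have h3 : t i.+1 <= t' i.+1 by apply: h; lia.
by nra.
Qed.

Lemma profile_vanish n f l t l' i : profile n f l t l' -> regular i ->
  0 < slack n f t i -> t i = 0.
Proof. by move=> P h s; case: (prof_compl P h) => // s0; rewrite s0 ltxx in s. Qed.

Lemma profile_gap_ge0 n f l t l' i : profile n f l t l' -> (i <= A.*2.+4)%N ->
  0 <= gap t i.
Proof.
move=> P hi; rewrite -[X in X <= _](@gap0 (fun=> 0) i) //.
by apply: le_gap => // j hj; apply: prof_pos P _; lia.
Qed.

Lemma profile_gap_eq0 n f l t l' : profile n f l t l' -> gap t A.*2.+4 = 0 ->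
  forall i, (i <= A.*2.+4)%N -> t i = 0.
Proof.
move=> P h0 i hi; apply/eqP; case: eqP => // /eqP hti.
have ti : 0 < t i by rewrite lt_def hti (prof_pos P).
case: i hi hti ti => [|i] hi hti ti; first by rewrite (prof0 P) eqxx in hti.
have := @lt_gap (fun=> 0) t A.*2.+4 i.+1; rewrite h0 gap0 // ltxx => H.
by apply/H => // j hj; apply: prof_pos P _; lia.
Qed.

(** Scan from the bottom, assuming [n' < n]. As long as [t] vanishes, its slack exceeds that of [t']
    by at least [n - n'], because [t'] contributes only nonpositive terms; complementarity then
    forces the next value of [t] to be 0. *)
Lemma profile_n_le n f l t l' n' t' l'' :
  profile n f l t l' -> profile n' f l t' l'' ->
  n <= n' \/ forall i, (i <= A.*2.+4)%N -> t i = 0.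
Proof.
move=> P P'; case: (leP n n') => [|nn]; [by left|right].
elim/ltn_ind => i IH hi.
case: (posnP i) => [->|i0]; first exact: prof0 P.
case: (@regular_or i ltac:(lia)).
- move=> hr; apply: (profile_vanish P hr).
  have := prof_slack P' hr; rewrite /slack.
  rewrite (@gap0 t); last by move=> j hj; apply: IH; lia.
  rewrite (IH i.-1); try lia.
  have := @profile_gap_ge0 _ _ _ _ _ i.-1 P' => /(_ ltac:(lia)) h1.
  have h2 := @slope_lt2 i.-1 ltac:(lia).
  have h3 := @prof_pos _ _ _ _ _ i.-1 P' ltac:(lia).
  by nra.
- by move=> e; rewrite e (prof_flat2 P); apply: IH; lia.
(* The imaginary edge could create height only through a part of [l] equal to the bound of [t]; but
   [t'] bounds all parts of [l] by something smaller. *)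
- move=> e; have tA : t A = 0 by apply: IH; lia.
  have j1 := prof_jump P; rewrite e j1 tA.
  case: (eqVneq (sumn l) (sumn l')) => [->|ne]; first by lra.
  have [_ _ _ /(_ ne) [k ks rk]] := prof_delta P.
  have [p1 _ _ _] := prof_delta P'.
  have t3 := @prof_pos _ _ _ _ _ A.+3 P ltac:(lia).
  have kl : k \in l.
    case: rk => [[]//|[kin le]].
    have := sumn_rem kin; rewrite -le => es; rewrite j1 tA es natrD in t3.
    have k0 : k = 0%N by apply/eqP; rewrite -(eqr_nat R); apply/eqP; have : 0 <= k%:R :> R by []; lra.
    by rewrite es k0 eqxx in ne.
  have := p1 _ kl; rewrite ks /slack /= (prof_flat1 P) (prof_flat1 P') tA.
  rewrite (@gap0 t); last by move=> j hj; apply: IH; lia.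
  have h1 := @profile_gap_ge0 _ _ _ _ _ A P' ltac:(lia).
  have h2 : sg A < 1 by case: sgP => _ _ _ <-; apply: slope_lt; lia.
  have h3 := @prof_pos _ _ _ _ _ A P' ltac:(lia).
  by nra.
Qed.

End Profile.

Lemma geq_sorted_eq (l l' : seq nat) :
  sorted geq l -> sorted geq l' -> perm_eq l l' -> l = l'.
Proof.
apply: sorted_eq => [x y z|x y] /=; first by move=> h1 h2; apply: leq_trans h2 h1.
by rewrite /geq /= => ?; apply/eqP; rewrite eqn_leq andbC.
Qed.

(** If the sizes differ from that of [l], then [l1] and [l2] arise from [l] by adding or removing
    one and the same part; their equal sizes exclude that one adds and the other removes. *)
Lemma delta_cond_inj (R : realFieldType) (l l1 l2 : seq nat) (s : R) :
  sorted geq l1 -> sorted geq l2 -> delta_cond l l1 s -> delta_cond l l2 s ->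
  sumn l1 = sumn l2 -> l1 = l2.
Proof.
move=> o1 o2 [_ _ e1 d1] [_ _ e2 d2] e12.
have [e|ne] := eqVneq (sumn l) (sumn l1); first by rewrite -e1 // -e2 // e.
have [k ks r1] := d1 ne; have [k' ks' r2] := d2 (introN eqP (fun h => elimN eqP ne (etrans h (esym e12)))).
have ekk : k' = k by apply/eqP; rewrite -(eqr_nat R) ks ks'.
rewrite {}ekk in r2.
case: r1 r2 => [] [i1 h1] [] [i2 h2].
- by rewrite h1 h2.
- by case/eqP: ne; rewrite (sumn_rem i1) -h1 e12 (sumn_rem i2) -h2; have := sumn_rem i1;
   rewrite -h1 e12 (sumn_rem i2) -h2; lia.
- by case/eqP: ne; have := sumn_rem i1; rewrite -h1 e12; have := sumn_rem i2; rewrite -h2; lia.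
- apply: geq_sorted_eq => //; rewrite (perm_trans (perm_to_rem i1)) //.
  by rewrite -h1 perm_sym (perm_trans (perm_to_rem i2)) // -h2.
Qed.

(** * Where two profiles over the same path separate *)

Section Split.
Variables (R : realFieldType) (A : nat) (sg : nat -> R).
Hypothesis sgP : slopes A sg.

(** The scan of [profile_n_le] again: once [w] has fallen behind [z], its accumulated gap stays
    strictly smaller, so its slack stays above that of [z] and is positive. *)
Lemma profile_after n f l w z lw lz i0 :
  profile A sg n f l w lw -> profile A sg n f l z lz ->
  (0 < i0 <= A.*2.+4)%N -> (forall j, (j < i0)%N -> w j = z j) -> w i0 < z i0 ->
  forall i, (i0 < i <= A.*2.+4)%N -> w i = 0.
Proof.
move=> W Z hi0 wz0 wz.
(* Along the zero-length edges both profiles repeat the previous value, so they cannot separate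
   there. *)
have i0A : i0 != A.+1 by apply/eqP => e; move: wz; rewrite e (prof_flat1 W) (prof_flat1 Z) wz0 ?ltxx // e.
have i0A' : i0 != A.+2 by apply/eqP => e; move: wz; rewrite e (prof_flat2 W) (prof_flat2 Z) wz0 ?ltxx // e; lia.
elim/ltn_ind => i IH hi.
have le_wz j : (j < i)%N -> w j <= z j.
  move=> hj; case: (ltngtP j i0) => [h|h|->]; first by rewrite wz0.
    by rewrite IH; [apply: (prof_pos Z) => //|..]; lia.
  exact: ltW.
have lt_gap_wz k : (i0 <= k < i)%N -> gap sg w k < gap sg z k.
  by move=> hk; apply: (@lt_gap _ A _ sgP _ _ _ i0) => //; [lia|lia|move=> j hj; apply: le_wz; lia].
case: (@regular_or A i ltac:(lia)) => [hr|e|e].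
- apply: (profile_vanish W hr); have := prof_slack Z hr; rewrite /slack.
  have h1 := @lt_gap_wz i.-1 ltac:(lia).
  have h2 := @slope_lt2 _ _ _ sgP i.-1 ltac:(lia).
  have h3 := @le_wz i.-1 ltac:(lia).
  by nra.
- by rewrite e (prof_flat2 W) -(prof_flat1 W); apply: IH; lia.
- have wA : w A.+1 = 0 by apply: IH; lia.
  have wA0 : w A = 0 by rewrite -(prof_flat1 W).
  have j1 := prof_jump W; rewrite e j1 wA0.
  case: (eqVneq (sumn l) (sumn lw)) => [->|ne]; first by lra.
  have [_ _ _ /(_ ne) [k ks rk]] := prof_delta W.
  have [p1 _ _ _] := prof_delta Z.
  have t3 := @prof_pos _ _ _ _ _ _ _ _ A.+3 W ltac:(lia).
  have kl : k \in l.
    case: rk => [[]//|[kin le]].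
    have := sumn_rem kin; rewrite -le => es; rewrite j1 wA0 es natrD in t3.
    have k0 : k = 0%N by apply/eqP; rewrite -(eqr_nat R); apply/eqP; have : 0 <= k%:R :> R by []; lra.
    by rewrite es k0 eqxx in ne.
  have := p1 _ kl; rewrite ks /slack /= (prof_flat1 W) (prof_flat1 Z) wA0.
  have h1 := @lt_gap_wz A ltac:(lia).
  have h2 : sg A < 1 by case: sgP => _ _ _ <-; apply: (slope_lt sgP); lia.
  have h3 := @prof_pos _ _ _ _ _ _ _ _ A Z ltac:(lia).
  by nra.
Qed.

(** [k] is the first vertex where the profiles differ, and the inequality of the gaps tells which of
    them is cut off there. Cut before the imaginary edge, [t1] vanishes across it, so its partition
    is [l]; cut after it, both partitions come from the same data. *)
Lemma profile_split n f l t lV t1 lV1 :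
  profile A sg n f l t lV -> profile A sg n f l t1 lV1 ->
  sorted geq lV -> sorted geq lV1 ->
  gap sg t1 A.*2.+4 < gap sg t A.*2.+4 ->
  exists k, [/\ (0 < k <= A.*2.+4)%N, [&& k != A.+1, k != A.+2 & k != A.+4],
    (forall i, (i < k)%N -> t1 i = t i) /\ (forall i, (k < i <= A.*2.+4)%N -> t1 i = 0),
    t1 k < t k & ((k <= A)%N -> lV1 = l) /\ ((A.+3 < k)%N -> lV1 = lV)].
Proof.
move=> P P1 o o1 lt_g.
have [k [hk ne eq]] : exists k, [/\ (0 < k <= A.*2.+4)%N, t1 k <> t k & forall i, (i < k)%N -> t1 i = t i].
  have ex : exists k, (k <= A.*2.+4)%N && (t1 k != t k).
    case: (hasP (a := fun k => t1 k != t k) (s := iota 0 A.*2.+4.+1)) => [[k hk hk']|h].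
      by exists k; rewrite hk' andbT; move: hk; rewrite mem_iota; lia.
    suff e : gap sg t1 A.*2.+4 = gap sg t A.*2.+4 by rewrite e ltxx in lt_g.
    apply: eq_bigr => -[j hj] _ /=; congr (_ * _); apply/eqP/negPn/negP => hn.
    by apply: h; exists j.+1 => //; rewrite mem_iota; lia.
  case: (ex_minnP ex) => k /andP[k1 /eqP k2] k3; exists k; split => //.
    rewrite k1 andbT; case: k k2 {k1 k3} => // k2; case: k2; by rewrite (prof0 P) (prof0 P1).
  move=> i ik; apply/eqP/negPn/negP => h; have := k3 i; rewrite h; lia.
have lt1 : t1 k < t k.
  case: (ltgtP (t1 k) (t k)) => // h.
  have := profile_after P P1 hk (fun i hi => esym (eq i hi)) h => z.
  suff : gap sg t A.*2.+4 <= gap sg t1 A.*2.+4 by rewrite leNgt lt_g.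
  apply: (le_gap sgP) => // j hj; case: (ltngtP j k) => [h1|h1|->]; last exact: ltW.
    by rewrite eq.
  by rewrite z; [apply: (prof_pos P1)|]; lia.
have z := profile_after P1 P hk eq lt1.
have k1 : k != A.+1 by apply/eqP => e; apply: ne; rewrite e (prof_flat1 P) (prof_flat1 P1) eq // e.
have k2 : k != A.+2 by apply/eqP => e; apply: ne; rewrite e (prof_flat2 P) (prof_flat2 P1) eq // e.
have k4 : k != A.+4 by apply/eqP => e; apply: ne; rewrite e (prof_flat3 P) (prof_flat3 P1) eq // e.
exists k; split => //; first by rewrite k1 k2.
split=> hkA.
  have := prof_jump P1; rewrite -(prof_flat1 P1) !z; try lia.
  move=> h; have e : sumn l = sumn lV1 by apply/eqP; rewrite -(eqr_nat R); apply/eqP; lra.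
  by case: (prof_delta P1) => _ _ /(_ e).
apply: (delta_cond_inj o1 o (prof_delta P1)).
  have := prof_delta P; rewrite /slack /= !eq; try lia.
  suff -> : gap sg t A = gap sg t1 A by [].
  by apply: eq_bigr => -[j hj] _ /=; rewrite eq //; lia.
have := prof_jump P1; have := prof_jump P; rewrite !eq; try lia.
move=> -> h; apply/eqP; rewrite -(eqr_nat R); apply/eqP; lra.
Qed.
End Split.

(** * Pairs of paths *)

Record lpath (R : Type) := LPath { lx : nat -> R; ly : nat -> R; lpart : seq nat }.

Section Lcp.
Variables (R : realFieldType) (A : nat).
Notation T := A.*2.+4.
Notation L := A.*2.+4.+1.
Notation path := (lpath R).

(** The zero-length edges are padding: the slack at [A.+1] then involves only vertices up to the
    start of the imaginary edge, and the slack at [A.+4] only vertices from its end on. *)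
Record path_along (sg : nat -> R) (M : path) : Prop := PathAlong {
  path_x0 : lx M 0%N = 0;
  path_y0 : ly M 0%N = 0;
  path_step : forall i, (i < L)%N ->
    lx M i.+1 - lx M i = sg i * (ly M i.+1 - ly M i);
  path_flat1 : ly M A.+1 = ly M A;
  path_flat2 : ly M A.+2 = ly M A;
  path_jump : ly M A.+3 = ly M A + (sumn (lpart M))%:R;
  path_flat3 : ly M A.+4 = ly M A.+3;
  path_flat4 : ly M A.+4.+1 = ly M A.+3;
  path_sorted : sorted geq (lpart M) }.

(** [2 * ly V - lx V] undoes the reflection and [n] restores the removed edge, so this is the
    horizontal distance from vertex [i.+1] of the right path to vertex [i] of the original left
    path. *)
Definition lcp_slack (n : R) (M V : path) (i : nat) : R :=
  n - lx M i.+1 + 2 * ly V i.-1 - lx V i.-1.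

Record lcp (n : R) (M V : path) : Prop := Lcp {
  lcp_end : ly M L = ly V L;
  lcp_ge0 : forall i, regular A i -> 0 <= ly M i - ly V i;
  lcp_slack_ge0 : forall i, regular A i -> 0 <= lcp_slack n M V i;
  lcp_compl : forall i, regular A i -> ly M i - ly V i = 0 \/ lcp_slack n M V i = 0;
  lcp_delta : delta_cond (lpart M) (lpart V)
    (lcp_slack n M V A.+1 + (ly M A.+1 - ly V A.+1)) }.

Definition same_path (M M' : path) : Prop :=
  (forall i, (i <= L)%N -> lx M i = lx M' i /\ ly M i = ly M' i) /\ lpart M = lpart M'.

Lemma same_path_sym M M' : same_path M M' -> same_path M' M.
Proof. by case=> h e; split => // i /h []. Qed.

Lemma lcp_ext n M V M' V' : same_path M M' -> same_path V V' ->
  lcp n M V -> lcp n M' V'.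
Proof.
move=> [hM eM] [hV eV] H.
have e i : (i <= T)%N -> lcp_slack n M' V' i = lcp_slack n M V i.
  move=> hi; rewrite /lcp_slack; have [-> _] := hM i.+1 ltac:(lia).
  by have [-> ->] := hV i.-1 ltac:(lia).
have e2 i : (i <= L)%N -> ly M' i - ly V' i = ly M i - ly V i.
  by move=> hi; have [_ ->] := hM i hi; have [_ ->] := hV i hi.
split.
- by have [_ <-] := hM L (leqnn _); have [_ <-] := hV L (leqnn _); exact: lcp_end H.
- by move=> i hi; rewrite e2; [exact: lcp_ge0 H i hi|move: hi; rewrite /regular; lia].
- by move=> i hi; rewrite e; [exact: lcp_slack_ge0 H i hi|move: hi; rewrite /regular; lia].
- by move=> i hi; rewrite e ?e2; [exact: lcp_compl H i hi| |]; move: hi; rewrite /regular; lia.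
- by rewrite e ?e2; [rewrite -eM -eV; exact: lcp_delta H|lia|lia].
Qed.

(** Up to scale this becomes phi_i + phi_i^star - <alpha_i^vee, wt>; see [node_defect]. *)
Definition defect (M V : path) : R := lx V L - lx M L.

Definition dy (M V : path) (i : nat) : R := ly M i - ly V i.

(** [n - level M i] is the slack of [M] paired with itself. *)
Definition level (M : path) (i : nat) : R := lx M i.+1 + lx M i.-1 - 2 * ly M i.-1.

(** * From pairs of paths to profiles *)

Section Slopes.
Variable (sg : nat -> R).
Hypothesis sgP : slopes A sg.

(** Abel summation of the edge equations of the two paths. *)
Lemma path_xE M V i : path_along sg M -> path_along sg V -> (i <= T)%N ->
  lx V i - lx M i = gap sg (dy M V) i - sg i * dy M V i.
Proof.
move=> PM PV; elim: i => [|i IH] hi.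
  by rewrite /dy (path_x0 PM) (path_x0 PV) (path_y0 PM) (path_y0 PV) /gap big_ord0; ring.
have := IH ltac:(lia); have := path_step PM (i := i) ltac:(lia).
have := path_step PV (i := i) ltac:(lia).
by rewrite gapS /dy; lra.
Qed.

Lemma defectE M V : path_along sg M -> path_along sg V -> ly M L = ly V L ->
  defect M V = gap sg (dy M V) T.
Proof.
move=> PM PV e; have := path_xE PM PV (leqnn T); rewrite /defect.
have := path_step PM (i := T) ltac:(lia); have := path_step PV (i := T) ltac:(lia).
by rewrite e /dy; lra.
Qed.

(** By [path_xE], [V] enters only through its height differences to [M]. This makes the two-path
    problem a profile over the fixed path [M]. *)
Lemma lcp_slackE n M V i : path_along sg M -> path_along sg V -> regular A i ->
  lcp_slack n M V i = slack sg n (level M) (dy M V) i.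
Proof.
move=> PM PV hi; rewrite /lcp_slack /slack /level /=.
have := path_xE PM PV (i := i.-1); rewrite /regular in hi.
by move=> /(_ ltac:(lia)); rewrite /dy; lra.
Qed.

Lemma lcp_profile n M V : path_along sg M -> path_along sg V -> lcp n M V ->
  profile A sg n (level M) (lpart M) (dy M V) (lpart V).
Proof.
move=> PM PV H.
have rA : regular A A.+1 by rewrite /regular; lia.
split.
- by rewrite /dy (path_y0 PM) (path_y0 PV) subr0.
- by rewrite /dy (path_flat1 PM) (path_flat1 PV).
- by rewrite /dy (path_flat2 PM) (path_flat2 PV).
- by rewrite /dy (path_jump PM) (path_jump PV); ring.
- by rewrite /dy (path_flat3 PM) (path_flat3 PV).
- exact: lcp_ge0 H.
- by move=> i hi; rewrite -lcp_slackE //; apply: (lcp_slack_ge0 H).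
- by move=> i hi; rewrite -lcp_slackE //; apply: (lcp_compl H).
- by rewrite -lcp_slackE //; exact: lcp_delta H.
Qed.

Lemma defect_ge0 n M V : path_along sg M -> path_along sg V -> lcp n M V ->
  0 <= defect M V.
Proof.
move=> PM PV H; rewrite (defectE PM PV (lcp_end H)).
exact: (profile_gap_ge0 sgP (lcp_profile PM PV H)).
Qed.

Lemma dy0_part n M V : path_along sg M -> path_along sg V -> lcp n M V ->
  (forall i, (i <= T)%N -> dy M V i = 0) -> lpart M = lpart V.
Proof.
move=> PM PV H h; case: (lcp_delta H) => _ _ + _; apply.
have := prof_jump (lcp_profile PM PV H); rewrite !h; try lia.
by move=> h1; apply/eqP; rewrite -(eqr_nat R); apply/eqP; lra.
Qed.

Lemma defect_eq0 n M V : path_along sg M -> path_along sg V -> lcp n M V ->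
  defect M V = 0 -> (forall i, (i <= L)%N -> ly M i = ly V i) /\ lpart M = lpart V.
Proof.
move=> PM PV H; rewrite (defectE PM PV (lcp_end H)) => h0.
have h := profile_gap_eq0 sgP (lcp_profile PM PV H) h0.
split; last exact: dy0_part H h.
move=> i; rewrite leq_eqVlt => /orP[/eqP->|hi]; first exact: lcp_end H.
by apply/eqP; rewrite -subr_eq0; apply/eqP/h; lia.
Qed.

Lemma lcp_n_le n n' M V V' :
  path_along sg M -> path_along sg V -> path_along sg V' ->
  lcp n M V -> lcp n' M V' -> n <= n' \/ defect M V = 0.
Proof.
move=> PM PV PV' H H'.
have P := lcp_profile PM PV H; have P' := lcp_profile PM PV' H'.
case: (profile_n_le sgP P P') => h; first by left.
by right; rewrite (defectE PM PV (lcp_end H)) gap0 // => j hj; apply: h; lia.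
Qed.

(** A crude bound: it dominates every level and, on top of the level at [A.+1], every part of the
    partition. *)
Definition sym_bound (M : path) : R :=
  \sum_(i < L) `|level M i| + `|level M A.+1| + (sumn (lpart M))%:R.

Lemma lcp_diag n M : path_along sg M -> sym_bound M <= n -> lcp n M M.
Proof.
move=> PM hn.
have lev i : regular A i -> lcp_slack n M M i = n - level M i.
  by move=> _; rewrite /lcp_slack /level; ring.
have le1 i : (i < L)%N -> level M i <= \sum_(i < L) `|level M i|.
  move=> hi; rewrite (bigD1 (Ordinal hi)) //=.
  have := ler_norm (level M i); have : 0 <= \sum_(j < L | j != Ordinal hi) `|level M j|.
    by apply: sumr_ge0.
  by lra.
have h1 := normr_ge0 (level M A.+1); have h2 : 0 <= (sumn (lpart M))%:R :> R by [].
have h3 : 0 <= \sum_(i < L) `|level M i| by apply: sumr_ge0.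
rewrite /sym_bound in hn.
split => //.
- by move=> i _; rewrite subrr.
- move=> i hi; rewrite lev //; have := le1 i; rewrite /regular in hi.
  by move=> /(_ ltac:(lia)); lra.
- by move=> i _; left; rewrite subrr.
have part_le k : k \in lpart M -> k%:R <= lcp_slack n M M A.+1 + (ly M A.+1 - ly M A.+1).
  move=> hk; rewrite lev; last by rewrite /regular; lia.
  have h4 := ler_norm (level M A.+1).
  have : k%:R <= (sumn (lpart M))%:R :> R by rewrite ler_nat (sumn_rem hk) leq_addr.
  by lra.
by split => //; rewrite eqxx.
Qed.

Lemma lcp_diag_mono n n' M : lcp n M M -> n <= n' -> lcp n' M M.
Proof.
move=> H hn.
have mono i : lcp_slack n M M i <= lcp_slack n' M M i by rewrite /lcp_slack; lra.
split => //.
- by move=> i _; rewrite subrr.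
- by move=> i hi; exact: (le_trans (lcp_slack_ge0 H hi) (mono i)).
- by move=> i _; left; rewrite subrr.
case: (lcp_delta H) => h1 _ _ _.
have h k : k \in lpart M -> k%:R <= lcp_slack n' M M A.+1 + (ly M A.+1 - ly M A.+1).
  by move=> /h1; have := mono A.+1; lra.
by split => //; rewrite eqxx.
Qed.

End Slopes.

(** * Reversal of a pair of paths *)

Definition rev_slope (sg : nat -> R) (i : nat) : R := 2 - sg (T - i)%N.

(* Turning the picture upside down and applying the reflection x -> 2y - x. *)
Definition rev_path (M : path) : path :=
  LPath (fun i => 2 * (ly M L - ly M (L - i)%N) - (lx M L - lx M (L - i)%N))
        (fun i => ly M L - ly M (L - i)%N) (lpart M).

Lemma rev_slopes sg : slopes A sg -> slopes A (rev_slope sg).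
Proof.
move=> [h h0 h2 h1]; rewrite /rev_slope; split.
- move=> i hi; have := h (T - i.+1)%N ltac:(lia).
  have -> : (T - i.+1).+1 = (T - i)%N by lia.
  by lra.
- by rewrite subn0; lra.
- by rewrite subnn; lra.
- have -> : (T - A.+2)%N = A.+2 by lia.
  by lra.
Qed.

Lemma rev_path_along sg M : path_along sg M -> path_along (rev_slope sg) (rev_path M).
Proof.
move=> P; have f1 := path_flat1 P; have f2 := path_flat2 P; have j := path_jump P.
have f3 := path_flat3 P; have f4 := path_flat4 P.
split => /=.
- by rewrite subn0; ring.
- by rewrite subn0; ring.
- move=> i hi; have := path_step P (i := (T - i)%N) ltac:(lia).
  rewrite /rev_slope; have -> : (L - i)%N = (T - i).+1 by lia.
  by rewrite subSS; lra.
- have -> : (L - A.+1)%N = A.+4 by lia.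
  have -> : (L - A)%N = A.+4.+1 by lia.
  by rewrite f3 f4.
- have -> : (L - A.+2)%N = A.+3 by lia.
  have -> : (L - A)%N = A.+4.+1 by lia.
  by rewrite f4.
- have -> : (L - A.+3)%N = A.+2 by lia.
  have -> : (L - A)%N = A.+4.+1 by lia.
  by rewrite f4 f2 j; ring.
- have -> : (L - A.+3)%N = A.+2 by lia.
  have -> : (L - A.+4)%N = A.+1 by lia.
  by rewrite f1 f2.
- have -> : (L - A.+3)%N = A.+2 by lia.
  have -> : (L - A.+4.+1)%N = A by lia.
  by rewrite f2.
- exact: path_sorted P.
Qed.

(** When [n] is the lower edge of a polytope along the simple root, this is the upper one. *)
Definition rev_n n (M V : path) : R := n + 2 * ly M L - lx V L - lx M L.

Lemma rev_slack n M V i : ly M L = ly V L -> (0 < i <= T)%N ->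
  lcp_slack (rev_n n M V) (rev_path V) (rev_path M) i = lcp_slack n M V (L - i).
Proof.
move=> e hi; rewrite /lcp_slack /rev_n /=.
have -> : (L - i).+1 = (L - i.-1)%N by lia.
have -> : (L - i).-1 = (L - i.+1)%N by lia.
by rewrite e; ring.
Qed.

Lemma rev_dy M V i : ly M L = ly V L ->
  dy (rev_path V) (rev_path M) i = dy M V (L - i).
Proof. by move=> e; rewrite /dy /= e; ring. Qed.

Lemma regular_rev i : regular A i -> regular A (L - i)%N.
Proof. by rewrite /regular; lia. Qed.

(** The bound on the parts can be read off on either side of the imaginary edge; this is how the
    condition on the partitions survives reversal. *)
Lemma slack_delta sg n M V : (0 < A)%N -> sg A.+2 = 1 ->
  path_along sg M -> path_along sg V ->
  lcp_slack n M V A.+4 + (ly M A.+4 - ly V A.+4)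
   = lcp_slack n M V A.+1 + (ly M A.+1 - ly V A.+1).
Proof.
move=> A0 sg1 PM PV.
have dx (P : path) (PP : path_along sg P) (i : nat) : (i < L)%N ->
    ly P i.+1 = ly P i -> lx P i.+1 = lx P i.
  move=> hi ey; have := path_step PP hi; rewrite ey subrr mulr0; lra.
have fl (P : path) (PP : path_along sg P) : [/\ lx P A.+1 = lx P A, lx P A.+2 = lx P A,
    lx P A.+3 = lx P A + (sumn (lpart P))%:R, lx P A.+4 = lx P A.+3 & lx P A.+4.+1 = lx P A.+3].
  have d1 := dx P PP A ltac:(lia) (path_flat1 PP).
  have d2 := dx P PP A.+1 ltac:(lia) (etrans (path_flat2 PP) (esym (path_flat1 PP))).
  have d3 := dx P PP A.+3 ltac:(lia) (path_flat3 PP).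
  have st := path_step PP (i := A.+2) ltac:(lia).
  rewrite (path_jump PP) (path_flat2 PP) sg1 in st.
  split; rewrite ?d2 ?d1 ?d3 //; first by rewrite d2 d1 in st; lra.
  by rewrite (dx P PP A.+4 ltac:(lia) (etrans (path_flat4 PP) (esym (path_flat3 PP)))) d3.
have [m1 m2 m3 m4 m5] := fl M PM; have [v1 v2 v3 v4 v5] := fl V PV.
rewrite /lcp_slack /= m5 v3 m2 (path_flat3 PM) (path_flat3 PV) (path_jump PM) (path_jump PV).
by rewrite (path_flat1 PM) (path_flat1 PV) m3; ring.
Qed.

Lemma lcp_rev sg n M V : (0 < A)%N -> sg A.+2 = 1 -> path_along sg M -> path_along sg V -> lcp n M V ->
  lcp (rev_n n M V) (rev_path V) (rev_path M).
Proof.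
move=> A0 sg1 PM PV H; have e := lcp_end H.
have rA : regular A A.+1 by rewrite /regular; lia.
have sl i : regular A i -> lcp_slack (rev_n n M V) (rev_path V) (rev_path M) i = lcp_slack n M V (L - i).
  by move=> hi; apply: rev_slack => //; rewrite /regular in hi; lia.
have dyE i := rev_dy i e; rewrite /dy in dyE.
split.
- by rewrite /= subnn (path_y0 PM) (path_y0 PV) e.
- by move=> i hi; rewrite dyE; apply: (lcp_ge0 H); apply: regular_rev.
- by move=> i hi; rewrite sl //; apply: (lcp_slack_ge0 H); apply: regular_rev.
- by move=> i hi; rewrite dyE sl //; apply: (lcp_compl H); apply: regular_rev.
rewrite sl // dyE /=; apply: delta_cond_sym.
have -> : (L - A.+1)%N = A.+4 by lia.
by rewrite (slack_delta n A0 sg1 PM PV); exact: lcp_delta H.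
Qed.
End Lcp.

(** * Commutation of the two edge raisings *)

Section Commute.
Variables (R : realFieldType) (A : nat) (sg : nat -> R).
Hypotheses (sgP : slopes A sg) (A0 : (0 < A)%N).
Ltac nat_lia := repeat match goal with H : context [R] |- _ => clear H end; lia.
Notation T := A.*2.+4.
Notation L := A.*2.+4.+1.

(** [profile_split] for the reversed pairs. Now [V] is the fixed path, and the hypothesis on the
    ends of [M] and [M'] makes the two values of [rev_n] equal. Seen from below, the vanishing part
    is the initial one. *)
Lemma rev_split n n' M M' V :
  path_along A sg M -> path_along A sg V -> path_along A sg M' ->
  lcp A n M V -> lcp A n' M' V -> lx M' L - lx M L = n' - n ->
  defect A M' V < defect A M V ->
  exists k, [/\ (0 < k <= T)%N, [&& k != A.+1, k != A.+3 & k != A.+4],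
    (forall i, (k < i <= L)%N -> dy M' V i = dy M V i) /\
    (forall i, (i < k)%N -> dy M' V i = 0),
    dy M' V k < dy M V k &
    ((A.+4 < k)%N -> lpart M' = lpart V) /\ ((k < A.+2)%N -> lpart M' = lpart M)].
Proof.
move=> PM PV PM' H H' ex lt_d.
have sg1 : sg A.+2 = 1 by case: sgP.
have e := lcp_end H; have e' := lcp_end H'.
have RP := rev_slopes sgP.
have RM := rev_path_along PM; have RM' := rev_path_along PM'; have RV := rev_path_along PV.
have en : rev_n A n M V = rev_n A n' M' V by rewrite /rev_n e e'; lra.
have Q := lcp_profile RV RM (lcp_rev A0 sg1 PM PV H).
have Q' := lcp_profile RV RM' (lcp_rev A0 sg1 PM' PV H').
rewrite -en in Q'.
have defE P : path_along A sg P -> ly P L = ly V L ->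
    defect A (rev_path A V) (rev_path A P) = defect A P V.
  move=> PP eP; rewrite /defect /= subnn (path_x0 PP) (path_x0 PV) (path_y0 PP) (path_y0 PV) eP.
  by ring.
have lt_g : gap (rev_slope A sg) (dy (rev_path A V) (rev_path A M')) T
    < gap (rev_slope A sg) (dy (rev_path A V) (rev_path A M)) T.
  rewrite -(defectE RV RM) ?(lcp_end (lcp_rev A0 sg1 PM PV H)) //.
  by rewrite -(defectE RV RM') ?(lcp_end (lcp_rev A0 sg1 PM' PV H')) // !defE.
have [k [hk kn [k1 k2] k3 [k4 k5]]] :=
  profile_split RP Q Q' (path_sorted PM) (path_sorted PM') lt_g.
have dE i := rev_dy (A := A) i e; have dE' i := rev_dy (A := A) i e'.
exists (L - k)%N; split.
- by lia.
- by lia.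
- split=> i hi.
    have := k1 (L - i)%N ltac:(lia); rewrite dE dE'.
    by have -> : (L - (L - i))%N = i by lia.
  case: (posnP i) => [->|i0]; first by rewrite /dy (path_y0 PM') (path_y0 PV) subrr.
  have := k2 (L - i)%N ltac:(lia); rewrite dE'.
  by have -> : (L - (L - i))%N = i by lia.
- by rewrite -dE -dE'.
- by split=> hi; [apply: k4|apply: k5]; lia.
Qed.

(* Along the path the gap of M to V1 is the initial part, of size d - h, of the
   gap of M to V, and the gap of M to M' its initial part of size h. *)
Lemma lcp_commute n h M V V1 M' :
  path_along A sg M -> path_along A sg V -> path_along A sg V1 -> path_along A sg M' ->
  lcp A n M V -> lcp A n M V1 -> lcp A (n + h) M' V -> 0 < h ->
  defect A M V1 = defect A M V - h -> defect A M' V = defect A M V - h ->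
  2 * h <= defect A M V -> lcp A (n + h) M' V1.
Proof.
move=> PM PV PV1 PM' H H1 H' h0 d1 d' d2.
have e := lcp_end H; have e1 := lcp_end H1; have e' := lcp_end H'.
have P := lcp_profile PM PV H; have P1 := lcp_profile PM PV1 H1; have P' := lcp_profile PM' PV H'.
have exM : lx M' L - lx M L = h by move: d'; rewrite /defect; lra.
have dg := defectE PM PV e; have dg1 := defectE PM PV1 e1; have dg' := defectE PM' PV e'.
have lt1 : gap sg (dy M V1) T < gap sg (dy M V) T by rewrite -dg -dg1; lra.
have [k [hk kn [kb ka] klt [kl1 kl2]]] := profile_split sgP P P1 (path_sorted PV) (path_sorted PV1) lt1.
have [m [hm mn [ma mb] mlt [ml1 ml2]]] : exists k, [/\ (0 < k <= T)%N, [&& k != A.+1, k != A.+3 & k != A.+4],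
    (forall i, (k < i <= L)%N -> dy M' V i = dy M V i) /\
    (forall i, (i < k)%N -> dy M' V i = 0),
    dy M' V k < dy M V k &
    ((A.+4 < k)%N -> lpart M' = lpart V) /\ ((k < A.+2)%N -> lpart M' = lpart M)].
  by apply: (rev_split PM PV PM' H H'); [rewrite exM; ring|lra].
have pos i : (i <= T)%N -> 0 <= dy M V i by apply: (prof_pos P).
have pos1 i : (i <= T)%N -> 0 <= dy M V1 i by apply: (prof_pos P1).
have pos' i : (i <= T)%N -> 0 <= dy M' V i by apply: (prof_pos P').
have le1 i : (i <= T)%N -> dy M V1 i <= dy M V i.
  move=> hi; case: (ltngtP i k) => [ik|ik|->]; [by rewrite kb| |exact: ltW].
  by rewrite ka; [apply: pos|nat_lia].
have le' i : (i <= T)%N -> dy M' V i <= dy M V i.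
  move=> hi; case: (ltngtP i m) => [im|im|->]; [|by rewrite ma //; nat_lia|exact: ltW].
  by rewrite mb //; apply: pos.
have gapD (t t' : nat -> R) : gap sg (fun i => t i + t' i) T = gap sg t T + gap sg t' T.
  by rewrite /gap -big_split; apply: eq_bigr => i _; rewrite mulrDr.
(* If the cut [k] of [V1] came before the cut [m] of [M'], both gaps would fit side by side under
   [dy M V]. With [d] the defect of [M] and [V] this gives [2 * (d - h) < d], against
   [2 * h <= d]. *)
have mk : (m <= k)%N.
  rewrite leqNgt; apply/negP => km.
  have : gap sg (fun i => dy M' V i + dy M V1 i) T < gap sg (dy M V) T.
    apply: (@lt_gap _ A _ sgP _ _ _ k) => //; first by rewrite mb // add0r.
    move=> j hj; case: (ltnP j m) => jm; first by rewrite mb // add0r le1 //; nat_lia.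
    by rewrite ka ?addr0 ?le' //; nat_lia.
  by rewrite gapD -dg -dg1 -dg'; lra.
(* So [dy M' V1] equals [dy M V] strictly between [m] and [k], is truncated at these two vertices,
   and vanishes elsewhere. *)
have t2E i : dy M' V1 i = dy M' V i + dy M V1 i - dy M V i by rewrite /dy; ring.
have t2b i : (i < m)%N -> dy M' V1 i = 0.
  by move=> hi; rewrite t2E mb // kb; [ring|nat_lia].
have t2a i : (k < i <= T)%N -> dy M' V1 i = 0.
  by move=> hi; rewrite t2E ka // ma; [ring|nat_lia].
have t2i i : (m < i < k)%N -> dy M' V1 i = dy M V i.
  by move=> hi; rewrite t2E kb ?ma; [ring|nat_lia|nat_lia].
have t2m : (m < k)%N -> dy M' V1 m = dy M' V m by move=> mk1; rewrite t2E kb //; ring.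
have t2k : (m < k)%N -> dy M' V1 k = dy M V1 k by move=> mk1; rewrite t2E ma ?h; [ring|nat_lia].
have eyM i : (m < i <= L)%N -> ly M' i = ly M i.
  by move=> hi; have := ma i hi; rewrite /dy; lra.
have exM' i : (m < i <= L)%N -> lx M' i = lx M i + h.
  have aux j : (m + j < L)%N -> lx M' (L - j)%N = lx M (L - j)%N + h.
    elim: j => [|j IH] hj; first by rewrite subn0 -exM addrC subrK.
    have := IH ltac:(nat_lia); have := path_step PM (i := (L - j.+1)%N) ltac:(nat_lia).
    have := path_step PM' (i := (L - j.+1)%N) ltac:(nat_lia).
    have -> : (L - j.+1).+1 = (L - j)%N by nat_lia.
    by rewrite !eyM; try nat_lia; lra.
  move=> hi; have -> : i = (L - (L - i))%N by nat_lia.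
  by apply: aux; nat_lia.
have eyV i : (i < k)%N -> ly V1 i = ly V i.
  by move=> hi; have := kb i hi; rewrite /dy; lra.
have exV i : (i < k)%N -> lx V1 i = lx V i.
  elim: i => [|i IH] hi; first by rewrite (path_x0 PV) (path_x0 PV1).
  have := IH ltac:(nat_lia); have := path_step PV (i := i) ltac:(nat_lia).
  have := path_step PV1 (i := i) ltac:(nat_lia).
  by rewrite !eyV; try nat_lia; lra.
(* Since [m <= k], every vertex inherits its slack from a known solution: beyond [m] the path [M']
   is [M] translated by [h], and before [k] the path [V1] is [V]. *)
have sl1 i : regular A i -> (m <= i)%N ->
    lcp_slack (n + h) M' V1 i = lcp_slack n M V1 i.
  rewrite /regular => hi mi; rewrite /lcp_slack exM'; [ring|nat_lia].
have sl' i : regular A i -> (i <= k)%N ->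
    lcp_slack (n + h) M' V1 i = lcp_slack (n + h) M' V i.
  by rewrite /regular => hi ik; rewrite /lcp_slack eyV ?exV //; nat_lia.
have t2ge i : (i <= T)%N -> 0 <= dy M' V1 i.
  move=> hi; case: (ltnP i m) => him; first by rewrite t2b.
  case: (ltnP k i) => hik; first by rewrite t2a //; nat_lia.
  case: (ltngtP m k) mk => // [mk _|mk _].
    case: (ltngtP i m) him => // [mi _|-> _]; last by rewrite t2m // pos' //; nat_lia.
    case: (ltngtP i k) hik => // [ki _|-> _]; last by rewrite t2k // pos1 //; nat_lia.
    by rewrite t2i ?pos //; nat_lia.
  (* With a single cut vertex [m = k], a negative value there would again give [2 * (d - h) < d]. *)
  have ik : i = k by nat_lia.
  rewrite leNgt; apply/negP => neg.
  have : gap sg (fun i => dy M' V i + dy M V1 i) T < gap sg (dy M V) T.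
    apply: (@lt_gap _ A _ sgP _ _ _ k) => //.
      by have := t2E k; rewrite -ik; lra.
    move=> j hj; have := t2E j; case: (ltngtP j k) => jk.
    - by rewrite t2b; [lra|nat_lia].
    - by rewrite t2a; [lra|nat_lia].
    - by rewrite jk -ik; lra.
  by rewrite gapD -dg -dg1 -dg'; lra.
split.
- by rewrite e' -e e1.
- by rewrite /regular => i hi; apply: t2ge; nat_lia.
- move=> i hi; case: (leqP m i) => mi; first by rewrite sl1 //; apply: (lcp_slack_ge0 H1).
  by rewrite sl' //; [apply: (lcp_slack_ge0 H')|nat_lia].
- move=> i hi; have hi' := hi; rewrite /regular in hi'; case: (ltnP i m) => mi.
    by left; apply: t2b.
  case: (ltnP k i) => ki; first by left; apply: t2a; nat_lia.
  (* Where [V1] meets [M], [t2E] and [le'] leave no room for a positive height of [M'] over [V1]. *)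
  rewrite sl1 //; case: (lcp_compl H1 hi) => h1; last by right.
  left; have := t2ge i ltac:(nat_lia); have := le' i ltac:(nat_lia); have := t2E i.
  by rewrite -/(dy M V1 i) in h1; rewrite h1 -/(dy M' V1 i); lra.
have rA : regular A A.+1 by rewrite /regular; nat_lia.
rewrite -/(dy M' V1 A.+1).
have D := lcp_delta H; have D1 := lcp_delta H1; have D' := lcp_delta H'.
rewrite -/(dy M V A.+1) in D; rewrite -/(dy M V1 A.+1) in D1; rewrite -/(dy M' V A.+1) in D'.
have slk : (A.+1 < k)%N -> lcp_slack n M V1 A.+1 = lcp_slack n M V A.+1.
  by move=> hk1; rewrite /lcp_slack eyV ?exV //; nat_lia.
(* The position of the cuts relative to the imaginary edge decides which partitions [M'] and [V1]
   carry. Only cuts at both ends of that edge need a new argument. *)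
case: (ltnP k A.+1) => kA.
  rewrite kl1 ?ml2; try nat_lia.
  rewrite t2a ?sl1 //; try nat_lia.
  by case: D1; rewrite ka ?kl1; try nat_lia; move=> h1 _ _ _; split => //; rewrite eqxx.
case: (ltnP A.+4 m) => mA.
  rewrite ml1 ?kl2; try nat_lia.
  rewrite t2b ?sl' //; try nat_lia.
  by case: D'; rewrite mb; try nat_lia; move=> _ h1 _ _; split => //; rewrite eqxx.
case: (ltnP m A.+1) => mA1.
  have e2 : dy M' V1 A.+1 = dy M V A.+1 by apply: t2i; nat_lia.
  rewrite ml2 ?sl1 ?e2; try nat_lia.
  case: (ltnP A.+3 k) => kA3; first by rewrite kl2 // slk //; nat_lia.
  by have := D1; rewrite kb //; nat_lia.
have em : m = A.+2 by nat_lia.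
rewrite t2b ?sl'; try nat_lia; rewrite mb in D'; try nat_lia.
case: (ltnP A.+3 k) => kA3; first by rewrite kl2.
have ek : k = A.+3 by nat_lia.
(* The slacks of [M] and [V] on both sides of the imaginary edge vanish, so [M] and [V] have the
   same partition; [V1] and [M'] both arise from it by adding a part of size [dy M V A]. *)
suff -> : lpart V1 = lpart M' by case: D' => h1 _ _ _; split => //; rewrite eqxx.
have z1 : dy M V1 A.+3 = 0 by rewrite -(prof_flat3 P1); apply: ka; nat_lia.
have z' : dy M' V A = 0 by apply: mb; nat_lia.
have z2 : dy M' V A.+3 = dy M V A.+3 by apply: ma; nat_lia.
have z3 : dy M V1 A = dy M V A by apply: kb; nat_lia.
have t1 : 0 < dy M V A.
  by rewrite -(prof_flat2 P); move: mlt; rewrite em (prof_flat2 P') z'.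
have t3 : 0 < dy M V A.+3 by move: klt; rewrite ek z1.
have s1 : lcp_slack n M V A.+1 = 0.
  by case: (lcp_compl H rA) => //; rewrite -/(dy M V A.+1) (prof_flat1 P); lra.
have s4 : lcp_slack n M V A.+4 = 0.
  case: (lcp_compl H (i := A.+4)) => //; first by rewrite /regular; nat_lia.
  by rewrite -/(dy M V A.+4) (prof_flat3 P); lra.
have sg1 : sg A.+2 = 1 by case: sgP.
have := slack_delta n A0 sg1 PM PV; rewrite s1 s4 !add0r.
rewrite -/(dy M V A.+1) -/(dy M V A.+4) (prof_flat3 P) (prof_flat1 P) => t31.
have j := prof_jump P; have j1 := prof_jump P1; have j' := prof_jump P'.
have eMV : lpart M = lpart V.
  by case: D => _ _ + _; apply; apply/eqP; rewrite -(eqr_nat R); apply/eqP; lra.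
have natE (a b : nat) : a%:R = b%:R :> R -> a = b by move=> hab; apply/eqP; rewrite -(eqr_nat R) hab.
have rm (l l' : seq nat) (s : R) : delta_cond l l' s -> (sumn l)%:R = (sumn l')%:R + dy M V A ->
    exists2 q : nat, q%:R = dy M V A & q \in l /\ l' = rem q l.
  move=> [_ _ _ hd] hs; have [|q _ [[q1 q2]|[q1 q2]]] := hd.
  - by apply/eqP => eq; rewrite eq in hs; lra.
  - by exists q => //; move: hs; rewrite (sumn_rem q1) -q2 natrD; lra.
  - have : 0 <= q%:R :> R by [].
    by move: hs; rewrite (sumn_rem q1) -q2 natrD; lra.
have [q q1 [q2 q3]] := rm _ _ _ D' ltac:(lra).
have [r r1 [r2 r3]] := rm _ _ _ (delta_cond_sym D1) ltac:(lra).
have qr : q = r by apply: natE; rewrite q1 r1.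
apply: geq_sorted_eq; [exact: path_sorted PV1|exact: path_sorted PM'|].
rewrite (perm_trans (perm_to_rem r2)) // -r3 eMV q3 qr perm_sym perm_to_rem // -qr //.
Qed.
End Commute.

(** * Polytopes in rescaled coordinates *)

Section Quad.
Variable R : realFieldType.

(** [wlo] and [whi] are the x- and y-coordinates of a chain of edges with multiplicities [a j] along
    (j, j+1); for edges along (j+1, j) they exchange roles. *)
Definition wlo (a : nat -> R) (k : nat) : R := \sum_(j < k) a j * j%:R.
Definition whi (a : nat -> R) (k : nat) : R := \sum_(j < k) a j * j.+1%:R.

Lemma wloS a k : wlo a k.+1 = wlo a k + a k * k%:R.
Proof. by rewrite /wlo big_ord_recr. Qed.

Lemma whiS a k : whi a k.+1 = whi a k + a k * k.+1%:R.
Proof. by rewrite /whi big_ord_recr. Qed.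

Lemma wlo0 a : wlo a 0 = 0. Proof. by rewrite /wlo big_ord0. Qed.
Lemma whi0 a : whi a 0 = 0. Proof. by rewrite /whi big_ord0. Qed.
Lemma wlo1 a : wlo a 1 = 0. Proof. by rewrite wloS wlo0 mulr0 addr0. Qed.

Lemma whi_wlo a k : whi a k - wlo a k = \sum_(j < k) a j.
Proof.
rewrite /whi /wlo -sumrB; apply: eq_bigr => j _.
by rewrite -mulrBr -[j.+1]addn1 natrD; ring.
Qed.

Definition sup (K : nat) (a : nat -> R) := forall k, (K <= k)%N -> a k = 0.

Lemma sum_stable (a c : nat -> R) (K k : nat) : sup K a -> (K <= k)%N ->
  \sum_(j < k) a j * c j = \sum_(j < K) a j * c j.
Proof.
move=> s; elim: k => [|k IH]; first by rewrite leqn0 => /eqP->.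
rewrite leq_eqVlt => /orP[/eqP<- //|hk].
by rewrite big_ord_recr /= s ?mul0r ?addr0 ?IH //; lia.
Qed.

Lemma wlo_stable a K k : sup K a -> (K <= k)%N -> wlo a k = wlo a K.
Proof. by move=> s; apply: (sum_stable (fun j => j%:R)). Qed.

Lemma whi_stable a K k : sup K a -> (K <= k)%N -> whi a k = whi a K.
Proof. by move=> s; apply: (sum_stable (fun j => j.+1%:R)). Qed.

(** A quantity from MV condition 1 or 2, with the sign that makes the condition ask for
    nonnegativity. *)
Definition cslack (a b : nat -> R) (k : nat) : R := whi b k - wlo a k.+1.

Definition comp (a b : nat -> R) : Prop := forall k, (0 < k)%N ->
  [/\ 0 <= cslack a b k, 0 <= cslack b a k & cslack a b k = 0 \/ cslack b a k = 0].

Lemma comp_sym a b : comp a b -> comp b a.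
Proof. by move=> h k /h [? ? [|]]; split => //; [right|left]. Qed.

(* A decorated polytope in coordinates where [rb k] and [lt k] multiply
   (k, k+1), while [rt k] and [lb k] multiply (k+1, k); dividing the second
   coordinate of the root lattice by [norm_ratio] brings both types here. *)
Record quad := Quad {
  rb : nat -> R; rt : nat -> R; lb : nat -> R; lt : nat -> R;
  pr : seq nat; pl : seq nat }.

Record quad_sup (K : nat) (Q : quad) : Prop := QuadSup {
  sup_rb : sup K (rb Q); sup_rt : sup K (rt Q);
  sup_lb : sup K (lb Q); sup_lt : sup K (lt Q) }.

Record quad_MV (K : nat) (Q : quad) : Prop := QuadMV {
  qmv_bot : comp (lb Q) (rb Q);
  qmv_top : comp (lt Q) (rt Q);
  qmv_x : wlo (rb Q) K + (sumn (pr Q))%:R + whi (rt Q) K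
        = whi (lb Q) K + (sumn (pl Q))%:R + wlo (lt Q) K;
  qmv_y : whi (rb Q) K + (sumn (pr Q))%:R + wlo (rt Q) K
        = wlo (lb Q) K + (sumn (pl Q))%:R + whi (lt Q) K;
  qmv_delta : delta_cond (pr Q) (pl Q) (\sum_(j < K) (rb Q j + lb Q j)) }.

(** [mirror] exchanges the coordinates, [flip] is the half-turn; both exchange the left and right
    data. *)
Definition mirror (Q : quad) := Quad (lb Q) (lt Q) (rb Q) (rt Q) (pl Q) (pr Q).
Definition flip (Q : quad) := Quad (lt Q) (lb Q) (rt Q) (rb Q) (pl Q) (pr Q).

Lemma mirror_MV K Q : quad_MV K Q -> quad_MV K (mirror Q).
Proof.
case=> b t x y d; split => //=; try exact: comp_sym.
apply: delta_cond_sym; rewrite (eq_bigr (fun j : 'I_K => rb Q j + lb Q j)) // => j _.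
by rewrite addrC.
Qed.

Lemma flip_MV K Q : quad_MV K Q -> quad_MV K (flip Q).
Proof.
case=> b t x y d; split => //=; try exact: comp_sym; try by [rewrite addrAC -x addrAC|].
- by move: x; lra.
- by move: y; lra.
apply: delta_cond_sym.
(* Subtracting the two closing equations shows that the top edges give the same bound as the bottom
   ones. *)
suff -> : \sum_(j < K) (lt Q j + rt Q j) = \sum_(j < K) (rb Q j + lb Q j) by [].
rewrite !big_split /= -!whi_wlo; lra.
Qed.

(** Vertex [i] of a path made of the bottom edges, the imaginary edge of length [s] in position
    [A.+2], and the top edges in decreasing order from index [c.-1]. *)
Definition glue (A : nat) (bot : nat -> R) (s : R) (top : nat -> R) (c i : nat) : R :=
  if (i <= A.+2)%N then bot i else bot A.+2 + s + (top c - top (c - (i - A.+3))%N).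

(** i/(i+1) is the slope of (i, i+1), which is also the image of (i+2, i+1) under x -> 2y - x. This
    shift by one aligns the right path with the reflected left path. *)
Definition quad_slope (A i : nat) : R :=
  if (i <= A.+1)%N then i%:R / i.+1%:R else
  if i == A.+2 then 1 else (A.*2.+4.+2 - i)%:R / (A.*2.+4.+1 - i)%:R.

Definition rpath A (Q : quad) : lpath R := LPath
  (glue A (wlo (rb Q)) (sumn (pr Q))%:R (whi (rt Q)) A.+3)
  (glue A (whi (rb Q)) (sumn (pr Q))%:R (wlo (rt Q)) A.+3)
  (pr Q).

(* The left path without its edge of direction (1, 0), reflected by x -> 2y - x. *)
Definition lpath_refl A (Q : quad) : lpath R := LPath
  (fun i => 2 * glue A (fun k => wlo (lb Q) k.+1) (sumn (pl Q))%:R (whi (lt Q)) A.+2 i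
     - glue A (fun k => whi (lb Q) k.+1 - lb Q 0%N) (sumn (pl Q))%:R (wlo (lt Q)) A.+2 i)
  (glue A (fun k => wlo (lb Q) k.+1) (sumn (pl Q))%:R (whi (lt Q)) A.+2)
  (pl Q).

Lemma natS_neq0 (k : nat) : k.+1%:R != 0 :> R.
Proof. by rewrite pnatr_eq0. Qed.

Lemma quad_slopes A : slopes A (quad_slope A).
Proof.
have lt_frac (a b c d : nat) : (0 < b)%N -> (0 < d)%N -> (a * d < c * b)%N ->
    a%:R / b%:R < c%:R / d%:R :> R.
  move=> b0 d0 h; rewrite ltr_pdivrMr ?ltr0n // mulrAC ltr_pdivlMr ?ltr0n //.
  by rewrite -!natrM ltr_nat.
rewrite /quad_slope; split.
- move=> i hi; case: (leqP i.+1 A.+1) => h1.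
    by rewrite (_ : i <= A.+1)%N; [apply: lt_frac; nia|lia].
  case: (eqVneq i.+1 A.+2) => h2.
    rewrite (_ : i <= A.+1)%N; last by lia.
    by rewrite ltr_pdivrMr ?ltr0n // mul1r ltr_nat.
  rewrite (_ : i <= A.+1 = false)%N; last by lia.
  case: (eqVneq i A.+2) => h3.
    by rewrite ltr_pdivlMr ?ltr0n ?mul1r ?ltr_nat; lia.
  by apply: lt_frac; nia.
- by rewrite /= mul0r.
- rewrite (_ : A.*2.+4 <= A.+1 = false)%N; last by lia.
  rewrite (_ : A.*2.+4 == A.+2 = false); last by lia.
  have -> : (A.*2.+4.+2 - A.*2.+4)%N = 2 by lia.
  have -> : (A.*2.+4.+1 - A.*2.+4)%N = 1 by lia.
  by rewrite divr1.
- by rewrite ltnn eqxx.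
Qed.

Lemma rpath_along A Q : quad_sup A Q -> sorted geq (pr Q) ->
  path_along A (quad_slope A) (rpath A Q).
Proof.
move=> S o; have e1 (j : nat) : (A <= j)%N -> rb Q j = 0 by apply: (sup_rb S).
have e2 (j : nat) : (A <= j)%N -> rt Q j = 0 by apply: (sup_rt S).
split => //=; rewrite /glue.
- by rewrite leq0n wlo0.
- by rewrite leq0n whi0.
- move=> i hi; rewrite /quad_slope; case: (ltngtP i A.+2) => h.
  + rewrite (_ : i <= A.+1)%N; last by lia.
    by rewrite wloS whiS; have := natS_neq0 i; rewrite -natr1 => h0; field.
  + rewrite (_ : i <= A.+1 = false)%N; last by lia.
    have [j [ei ej]] : exists j, i = (A.+3 + j)%N /\ (j < A.+2)%N by exists (i - A.+3)%N; lia.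
    have -> : (i.+1 - A.+3)%N = j.+1 by lia.
    have -> : (i - A.+3)%N = j by lia.
    have -> : (A.+3 - j)%N = (A.+3 - j.+1).+1 by lia.
    have -> : (A.*2.+4.+1 - i)%N = (A.+3 - j.+1)%N by lia.
    have -> : (A.*2.+4.+2 - i)%N = (A.+3 - j.+1).+1 by lia.
    have h0 : (A.+3 - j.+1)%:R != 0 :> R by rewrite pnatr_eq0; lia.
    by rewrite (whiS _ (A.+3 - j.+1)) (wloS _ (A.+3 - j.+1)); field.
  + rewrite h ltnn subnn subn0 /=; lra.
- by rewrite !ifT ?whiS ?e1; try lia; ring.
- by rewrite !ifT ?whiS ?e1; try lia; ring.
- rewrite ifF ?ifT ?subnn ?subn0 ?whiS ?e1; try lia; by lra.
- rewrite !ifF; try lia; have -> : (A.+4 - A.+3 = 1)%N by lia.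
  by rewrite subnn subn0 subn1 /= wloS e2; try lia; ring.
- rewrite !ifF; try lia; have -> : (A.+4.+1 - A.+3 = 2)%N by lia.
  by rewrite subnn subn0 subn2 /= !wloS !e2; try lia; ring.
Qed.

Lemma lpath_refl_along A Q : quad_sup A Q -> sorted geq (pl Q) ->
  path_along A (quad_slope A) (lpath_refl A Q).
Proof.
move=> S o; have e1 (j : nat) : (A <= j)%N -> lb Q j = 0 by apply: (sup_lb S).
have e2 (j : nat) : (A <= j)%N -> lt Q j = 0 by apply: (sup_lt S).
split => //=; rewrite /glue.
- by rewrite leq0n wlo1 whiS whi0; ring.
- by rewrite leq0n wlo1.
- move=> i hi; rewrite /quad_slope; case: (ltngtP i A.+2) => h.
  + rewrite (_ : i <= A.+1)%N; last by lia.
    by have := natS_neq0 i; rewrite !(wloS _ i.+1) !(whiS _ i.+1) -(natr1 i.+1) -(natr1 i) => h0; field.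
  + rewrite (_ : i <= A.+1 = false)%N; last by lia.
    have [j [ei ej]] : exists j, i = (A.+3 + j)%N /\ (j < A.+2)%N by exists (i - A.+3)%N; lia.
    have -> : (i.+1 - A.+3)%N = j.+1 by lia.
    have -> : (i - A.+3)%N = j by lia.
    have -> : (A.+2 - j)%N = (A.+2 - j.+1).+1 by lia.
    have -> : (A.*2.+4.+1 - i)%N = (A.+2 - j.+1).+1 by lia.
    have -> : (A.*2.+4.+2 - i)%N = (A.+2 - j.+1).+2 by lia.
    have h0 := natS_neq0 (A.+2 - j.+1).
    by move: h0; rewrite (whiS _ (A.+2 - j.+1)) (wloS _ (A.+2 - j.+1)) -(natr1 (A.+2 - j.+1).+1) -(natr1 (A.+2 - j.+1)) => h0; field.
  + rewrite h ltnn subnn subn0 /=; lra.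
- by rewrite !ifT ?(wloS _ A.+1) ?e1; try lia; ring.
- by rewrite !ifT ?(wloS _ A.+2) ?(wloS _ A.+1) ?e1; try lia; ring.
- rewrite ifF ?ifT ?subnn ?subn0 ?(wloS _ A.+2) ?(wloS _ A.+1) ?e1; try lia; by lra.
- rewrite !ifF; try lia; have -> : (A.+4 - A.+3 = 1)%N by lia.
  by rewrite subnn subn0 subn1 /= whiS e2; try lia; ring.
- rewrite !ifF; try lia; have -> : (A.+4.+1 - A.+3 = 2)%N by lia.
  by rewrite subnn subn0 subn2 /= !whiS !e2; try lia; ring.
Qed.

End Quad.

(** * MV conditions as a complementarity problem *)

Section QuadLcp.
Variable R : realFieldType.
Variables (A : nat) (Q : quad R).
Hypothesis S : quad_sup A Q.
Notation L := A.*2.+4.+1.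

Definition tot_x : R := wlo (rb Q) A + (sumn (pr Q))%:R + whi (rt Q) A.
Definition tot_y : R := whi (rb Q) A + (sumn (pr Q))%:R + wlo (rt Q) A.
Definition tot_x' : R := whi (lb Q) A + (sumn (pl Q))%:R + wlo (lt Q) A.
Definition tot_y' : R := wlo (lb Q) A + (sumn (pl Q))%:R + whi (lt Q) A.

Lemma glue_bot bot s top c i : (i <= A.+2)%N -> glue A bot s top c i = bot i :> R.
Proof. by rewrite /glue => ->. Qed.

Lemma glue_top bot s top c k : (k <= A.+2)%N ->
  glue A bot s top c (L - k)%N = bot A.+2 + s + (top c - top (c - (A.+2 - k))%N) :> R.
Proof.
move=> hk; rewrite /glue ifF; last by lia.
by have -> : (L - k - A.+3)%N = (A.+2 - k)%N by lia.
Qed.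

Let st1 k : (A <= k)%N -> wlo (rb Q) k = wlo (rb Q) A. Proof. exact: wlo_stable (sup_rb S). Qed.
Let st2 k : (A <= k)%N -> whi (rb Q) k = whi (rb Q) A. Proof. exact: whi_stable (sup_rb S). Qed.
Let st3 k : (A <= k)%N -> wlo (rt Q) k = wlo (rt Q) A. Proof. exact: wlo_stable (sup_rt S). Qed.
Let st4 k : (A <= k)%N -> whi (rt Q) k = whi (rt Q) A. Proof. exact: whi_stable (sup_rt S). Qed.
Let st5 k : (A <= k)%N -> wlo (lb Q) k = wlo (lb Q) A. Proof. exact: wlo_stable (sup_lb S). Qed.
Let st6 k : (A <= k)%N -> whi (lb Q) k = whi (lb Q) A. Proof. exact: whi_stable (sup_lb S). Qed.
Let st7 k : (A <= k)%N -> wlo (lt Q) k = wlo (lt Q) A. Proof. exact: wlo_stable (sup_lt S). Qed.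
Let st8 k : (A <= k)%N -> whi (lt Q) k = whi (lt Q) A. Proof. exact: whi_stable (sup_lt S). Qed.

Lemma rpath_bot i : (i <= A.+2)%N ->
  lx (rpath A Q) i = wlo (rb Q) i /\ ly (rpath A Q) i = whi (rb Q) i.
Proof. by move=> hi; rewrite /= !glue_bot. Qed.

Lemma lpath_bot i : (i <= A.+2)%N ->
  2 * ly (lpath_refl A Q) i - lx (lpath_refl A Q) i = whi (lb Q) i.+1 - lb Q 0%N /\
  ly (lpath_refl A Q) i = wlo (lb Q) i.+1.
Proof. by move=> hi; rewrite /= !glue_bot //; split; ring. Qed.

Lemma rpath_top k : (k <= A.+2)%N ->
  lx (rpath A Q) (L - k)%N = tot_x - whi (rt Q) k.+1 /\
  ly (rpath A Q) (L - k)%N = tot_y - wlo (rt Q) k.+1.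
Proof.
move=> hk; rewrite /= !glue_top // /tot_x /tot_y.
have -> : (A.+3 - (A.+2 - k))%N = k.+1 by lia.
rewrite (@st1 A.+2) ?(@st2 A.+2) ?(@st3 A.+3) ?(@st4 A.+3); try lia.
by split; ring.
Qed.

Lemma lpath_top k : (k <= A.+2)%N ->
  2 * ly (lpath_refl A Q) (L - k)%N - lx (lpath_refl A Q) (L - k)%N
    = tot_x' - lb Q 0%N - wlo (lt Q) k /\
  ly (lpath_refl A Q) (L - k)%N = tot_y' - whi (lt Q) k.
Proof.
move=> hk; rewrite /= !glue_top // /tot_x' /tot_y'.
have -> : (A.+2 - (A.+2 - k))%N = k by lia.
rewrite (@st5 A.+3) ?(@st6 A.+3) ?(@st7 A.+2) ?(@st8 A.+2); try lia.
by split; ring.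
Qed.

Lemma quad_defect : tot_x = tot_x' -> tot_y = tot_y' ->
  defect A (rpath A Q) (lpath_refl A Q) = rt Q 0%N + lb Q 0%N - 2 * (tot_x - tot_y).
Proof.
move=> ex ey; rewrite /defect; have [e1 e2] := rpath_top (leq0n _).
have [e3 e4] := lpath_top (leq0n _); rewrite subn0 in e1 e2 e3 e4.
by move: e1 e2 e3 e4; rewrite whiS wlo1 !whi0 wlo0; lra.
Qed.

Lemma bot_slackE i : (0 < i <= A.+1)%N ->
  ly (rpath A Q) i - ly (lpath_refl A Q) i = cslack (lb Q) (rb Q) i /\
  lcp_slack (lb Q 0%N) (rpath A Q) (lpath_refl A Q) i = cslack (rb Q) (lb Q) i.
Proof.
move=> hi; rewrite /lcp_slack /cslack.
have [_ ->] := @rpath_bot i ltac:(lia); have [-> _] := @rpath_bot i.+1 ltac:(lia).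
have [_ ->] := @lpath_bot i ltac:(lia); have [] := @lpath_bot i.-1 ltac:(lia).
by rewrite (@prednK i); [split; lra|lia].
Qed.

Lemma top_slackE k : tot_x = tot_x' -> tot_y = tot_y' -> (0 < k <= A.+1)%N ->
  ly (rpath A Q) (L - k)%N - ly (lpath_refl A Q) (L - k)%N = cslack (rt Q) (lt Q) k /\
  lcp_slack (lb Q 0%N) (rpath A Q) (lpath_refl A Q) (L - k)%N = cslack (lt Q) (rt Q) k.
Proof.
move=> ex ey hk; rewrite /lcp_slack /cslack.
have -> : (L - k).+1 = (L - k.-1)%N by lia.
have -> : (L - k).-1 = (L - k.+1)%N by lia.
have [_ ->] := @rpath_top k ltac:(lia); have [-> _] := @rpath_top k.-1 ltac:(lia).
have [_ ->] := @lpath_top k ltac:(lia); have [] := @lpath_top k.+1 ltac:(lia).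
by rewrite (@prednK k); [split; lra|lia].
Qed.

Lemma delta_slackE :
  lcp_slack (lb Q 0%N) (rpath A Q) (lpath_refl A Q) A.+1
    + (ly (rpath A Q) A.+1 - ly (lpath_refl A Q) A.+1)
  = \sum_(j < A) (rb Q j + lb Q j).
Proof.
have [-> ->] := @bot_slackE A.+1 ltac:(lia).
rewrite big_split /= -!whi_wlo /cslack.
rewrite (@st1 A.+2) ?(@st2 A.+1) ?(@st5 A.+2) ?(@st6 A.+1); try lia.
by ring.
Qed.

Lemma cslack_stable a b k : sup A a -> sup A b -> (A.+1 <= k)%N ->
  cslack a b k = cslack a b A.+1 :> R.
Proof.
move=> sa sb hk; rewrite /cslack (@whi_stable _ _ _ k sb) 1?(@whi_stable _ _ _ A.+1 sb); try lia.
by rewrite (@wlo_stable _ _ _ k.+1 sa) 1?(@wlo_stable _ _ _ A.+2 sa) //; lia.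
Qed.

(** From [A.+1] on all partial sums are constant, so the remaining conditions repeat the one at
    [A.+1]. *)
Lemma comp_bounded a b : sup A a -> sup A b ->
  (forall k, (0 < k <= A.+1)%N ->
    [/\ 0 <= cslack a b k, 0 <= cslack b a k & cslack a b k = 0 \/ cslack b a k = 0 :> R]) ->
  comp a b.
Proof.
move=> sa sb h k k0; case: (leqP k A.+1) => hk; first by apply: h; rewrite k0.
rewrite (@cslack_stable a b k) ?(@cslack_stable b a k) //; try lia.
by apply: h; lia.
Qed.

Lemma quad_lcp : quad_MV A Q -> lcp A (lb Q 0%N) (rpath A Q) (lpath_refl A Q).
Proof.
case=> cb ct ex ey d.
have reg i : regular A i -> (0 < i <= A.+1)%N \/ exists2 k, i = (L - k)%N & (0 < k <= A.+1)%N.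
  rewrite /regular => hi; case: (leqP i A.+1) => h; first by left; lia.
  by right; exists (L - i)%N; lia.
split.
- have [_ e2] := rpath_top (leq0n _); have [_ e4] := lpath_top (leq0n _).
  by rewrite subn0 in e2 e4; rewrite e2 e4 wlo1 whi0 [tot_y]ey.
- move=> i /reg [hi|[k -> hk]].
    by have [-> _] := bot_slackE hi; case: (cb i ltac:(lia)).
  by have [-> _] := top_slackE ex ey hk; case: (ct k ltac:(lia)).
- move=> i /reg [hi|[k -> hk]].
    by have [_ ->] := bot_slackE hi; case: (cb i ltac:(lia)).
  by have [_ ->] := top_slackE ex ey hk; case: (ct k ltac:(lia)).
- move=> i /reg [hi|[k -> hk]].
    by have [-> ->] := bot_slackE hi; case: (cb i ltac:(lia)).
  by have [-> ->] := top_slackE ex ey hk; case: (ct k ltac:(lia)) => _ _ [|]; [right|left].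
- by rewrite delta_slackE.
Qed.

(** Only the closing equation in x is assumed; the one in y is the common final height in
    [lcp_end]. *)
Lemma lcp_quad : tot_x = tot_x' ->
  lcp A (lb Q 0%N) (rpath A Q) (lpath_refl A Q) -> quad_MV A Q.
Proof.
move=> ex H.
have ey : tot_y = tot_y'.
  have := lcp_end H.
  have [_ e2] := rpath_top (leq0n _); have [_ e4] := lpath_top (leq0n _).
  by rewrite subn0 in e2 e4; rewrite e2 e4 wlo1 whi0; lra.
split => //; last by rewrite -delta_slackE; exact: lcp_delta H.
- apply: comp_bounded; [exact: sup_lb S|exact: sup_rb S|] => k hk.
  have hr : regular A k by rewrite /regular; lia.
  have := lcp_ge0 H hr; have := lcp_slack_ge0 H hr; have := lcp_compl H hr.
  by have [-> ->] := bot_slackE hk.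
- apply: comp_bounded; [exact: sup_lt S|exact: sup_rt S|] => k hk.
  have hr : regular A (L - k) by rewrite /regular; lia.
  have := lcp_ge0 H hr; have := lcp_slack_ge0 H hr; have := lcp_compl H hr.
  by have [-> ->] := top_slackE ex ey hk; case=> h h1 h2; split => //; [right|left].
Qed.

End QuadLcp.

(** * Decorated polytopes seen from a node *)

Definition other (i : node) : node := match i with Node0 => Node1 | Node1 => Node0 end.
Definition Lo (i : node) (k : nat) : preal :=
  match i with Node0 => Blo k | Node1 => Bup k end.
Definition Up (i : node) (k : nat) : preal :=
  match i with Node0 => Bup k | Node1 => Blo k end.
Definition side (i : node) (P : dpwp) : ldatum :=
  match i with Node0 => cr P | Node1 => cl P end.
Definition swap (P : dpwp) : dpwp := DP (cr P) (cl P).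

(* The roots [Blo k] and [Bup k] are [root_scale] times (k, k+1) and (k+1, k),
   once the second coordinate is divided by [norm_ratio]. *)
Definition root_scale (t : gtype) (r : preal) : rat :=
  match t, r with
  | Sl2hat, _ => 1
  | A22, Blo k => if odd k then 1 else 2^-1
  | A22, Bup k => if odd k then 2^-1 else 1
  end.

Definition scoef (t : gtype) (c : ldatum) (r : preal) : rat :=
  root_scale t r * (coef c r)%:R.

Definition quad_of (t : gtype) (P : dpwp) : quad rat := Quad
  (fun k => scoef t (cr P) (Blo k)) (fun k => scoef t (cr P) (Bup k))
  (fun k => scoef t (cl P) (Bup k)) (fun k => scoef t (cl P) (Blo k))
  (cdel (cr P)) (cdel (cl P)).

(** [quad_of] for node 0 and its mirror image for node 1, so that the edges removed and reflected
    are always those along alpha_i. *)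
Definition nquad (t : gtype) (i : node) (P : dpwp) : quad rat := Quad
  (fun k => scoef t (side i P) (Lo i k)) (fun k => scoef t (side i P) (Up i k))
  (fun k => scoef t (side (other i) P) (Up i k))
  (fun k => scoef t (side (other i) P) (Lo i k))
  (cdel (side i P)) (cdel (side (other i) P)).

Definition cx (v : vec) : rat := v.1%:~R.
Definition cy (t : gtype) (v : vec) : rat := v.2%:~R / (norm_ratio t)%:R.

Lemma ratio_neq0 t : (norm_ratio t)%:R != 0 :> rat.
Proof. by case: t. Qed.

Lemma odd_halfE k : (k = odd k + k./2 * 2)%N.
Proof. by rewrite -[LHS](odd_double_half k) muln2. Qed.

Lemma root_vecE t k :
  [/\ cx (root_vec t (Blo k)) = root_scale t (Blo k) * k%:R,
      cy t (root_vec t (Blo k)) = root_scale t (Blo k) * k.+1%:R,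
      cx (root_vec t (Bup k)) = root_scale t (Bup k) * k.+1%:R &
      cy t (root_vec t (Bup k)) = root_scale t (Bup k) * k%:R].
Proof.
have iE (n : nat) : (n%:Z)%:~R = n%:R :> rat by rewrite -pmulrn.
rewrite /cx /cy; case: t.
  rewrite /= !(mulr0, mulr1, addr0, add0r, mul1r) !intrD !iE -natr1.
  by split; ring.
have eS : k.+1%:R = k%:R + 1 :> rat by rewrite natr1.
have ek : k%:R = (odd k)%:R + (k./2)%:R * 2 :> rat by rewrite {1}(odd_halfE k) natrD natrM.
rewrite /=; case: (odd k) ek => /= ek;
rewrite !(mulr0, mulr1, addr0, add0r, mul1r) ?intrD ?intrM ?iE ?eS ?ek.
  by split; field.
by split; field.
Qed.

Lemma vsumE n F : vsum n F = (\sum_(j < n) (F j).1, \sum_(j < n) (F j).2).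
Proof.
rewrite /vsum -(big_mkord xpredT (fun j => (F j).1)) -(big_mkord xpredT (fun j => (F j).2)).
rewrite /index_iota subn0; elim: (iota 0 n) => [|j s IH] /=; first by rewrite !big_nil.
by rewrite IH !big_cons.
Qed.

Lemma cxD u v : cx (vadd u v) = cx u + cx v. Proof. by rewrite /cx intrD. Qed.
Lemma cyD t u v : cy t (vadd u v) = cy t u + cy t v.
Proof. by rewrite /cy intrD mulrDl. Qed.
Lemma cxB u v : cx (vsub u v) = cx u - cx v. Proof. by rewrite /cx intrB. Qed.
Lemma cyB t u v : cy t (vsub u v) = cy t u - cy t v.
Proof. by rewrite /cy intrB mulrBl. Qed.
Lemma cxZ n u : cx (vscale n u) = n%:~R * cx u. Proof. by rewrite /cx intrM. Qed.
Lemma cyZ t n u : cy t (vscale n u) = n%:~R * cy t u.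
Proof. by rewrite /cy intrM mulrA. Qed.

Lemma vec_eqP t u v : cx u = cx v -> cy t u = cy t v -> u = v.
Proof.
case: u v => [a b] [c d]; rewrite /cx /cy /= => /intr_inj -> /(divIf (ratio_neq0 t)).
by move=> /intr_inj ->.
Qed.

Lemma cx_vsum n F : cx (vsum n F) = \sum_(j < n) cx (F j).
Proof. by rewrite vsumE /cx /= rmorph_sum. Qed.
Lemma cy_vsum t n F : cy t (vsum n F) = \sum_(j < n) cy t (F j).
Proof. by rewrite vsumE /cy /= rmorph_sum mulr_suml. Qed.

Definition sum_roots t (c : ldatum) (r : nat -> preal) (k : nat) : vec :=
  vsum k (fun j => vscale (coef c (r j))%:Z (root_vec t (r j))).

Lemma sum_lo t c k :
  cx (sum_roots t c Blo k) = wlo (fun j => scoef t c (Blo j)) k /\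
  cy t (sum_roots t c Blo k) = whi (fun j => scoef t c (Blo j)) k.
Proof.
rewrite /sum_roots cx_vsum cy_vsum /wlo /whi; split; apply: eq_bigr => -[j _] _ /=.
  by rewrite cxZ -pmulrn; have [-> _ _ _] := root_vecE t j; rewrite /scoef; ring.
by rewrite cyZ -pmulrn; have [_ -> _ _] := root_vecE t j; rewrite /scoef; ring.
Qed.

Lemma sum_up t c k :
  cx (sum_roots t c Bup k) = whi (fun j => scoef t c (Bup j)) k /\
  cy t (sum_roots t c Bup k) = wlo (fun j => scoef t c (Bup j)) k.
Proof.
rewrite /sum_roots cx_vsum cy_vsum /wlo /whi; split; apply: eq_bigr => -[j _] _ /=.
  by rewrite cxZ -pmulrn; have [_ _ -> _] := root_vecE t j; rewrite /scoef; ring.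
by rewrite cyZ -pmulrn; have [_ _ _ ->] := root_vecE t j; rewrite /scoef; ring.
Qed.

Definition sized (K : nat) (c : ldatum) : Prop :=
  (size (clo c) <= K)%N /\ (size (cup c) <= K)%N.

Lemma sup_lo t c : sup (size (clo c)) (fun j => scoef t c (Blo j)).
Proof. by move=> k hk; rewrite /scoef /= nth_default // mulr0. Qed.
Lemma sup_up t c : sup (size (cup c)) (fun j => scoef t c (Bup j)).
Proof. by move=> k hk; rewrite /scoef /= nth_default // mulr0. Qed.

Lemma cx_delta t : cx (delta t) = 1. Proof. by case: t. Qed.
Lemma cy_delta t : cy t (delta t) = 1. Proof. by case: t. Qed.

Lemma ld_wtE t c K : sized K c ->
  cx (ld_wt t c) = wlo (fun j => scoef t c (Blo j)) K + (sumn (cdel c))%:R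
     + whi (fun j => scoef t c (Bup j)) K /\
  cy t (ld_wt t c) = whi (fun j => scoef t c (Blo j)) K + (sumn (cdel c))%:R
     + wlo (fun j => scoef t c (Bup j)) K.
Proof.
case=> h1 h2; rewrite /ld_wt !cxD !cyD cxZ cyZ cx_delta cy_delta -!pmulrn.
rewrite -!/(sum_roots t c Blo _) -!/(sum_roots t c Bup _).
have [-> ->] := sum_lo t c (size (clo c)); have [-> ->] := sum_up t c (size (cup c)).
rewrite (wlo_stable (@sup_lo t c) h1) (whi_stable (@sup_lo t c) h1).
rewrite (wlo_stable (@sup_up t c) h2) (whi_stable (@sup_up t c) h2).
by split; ring.
Qed.

Lemma largest_part_max l k : k \in l -> (k <= largest_part l)%N.
Proof.
elim: l => //= a l IH; rewrite inE leq_max => /orP[/eqP->|/IH ->]; by rewrite ?leqnn ?orbT.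
Qed.

Lemma largest_part_mem l : l != [::] -> largest_part l \in l.
Proof.
elim: l => //= a l IH _; case: (eqVneq l [::]) => [->|/IH h]; first by rewrite /= maxn0 inE.
by rewrite inE /maxn; case: ltnP; rewrite ?h ?eqxx ?orbT.
Qed.

Lemma max0P (a b : int) : Num.max a b = 0 <-> [/\ a <= 0, b <= 0 & (a == 0) || (b == 0)].
Proof.
split=> [h|[ha hb /orP[/eqP e|/eqP e]]].
- have : Num.max a b <= 0 by rewrite h.
  rewrite ge_max => /andP[ha hb]; split => //.
  by move: h; rewrite /Num.max; case: ifP => _ ->; rewrite eqxx ?orbT.
- by rewrite e max_l.
- by rewrite e max_r.
Qed.

Lemma min0P (a b : int) : Num.min a b = 0 <-> [/\ 0 <= a, 0 <= b & (a == 0) || (b == 0)].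
Proof.
split=> [h|[ha hb /orP[/eqP e|/eqP e]]].
- have : 0 <= Num.min a b by rewrite h.
  rewrite le_min => /andP[ha hb]; split => //.
  by move: h; rewrite /Num.min; case: ifP => _ ->; rewrite eqxx ?orbT.
- by rewrite e min_l.
- by rewrite e min_r.
Qed.

(** * Translation of the MV conditions into rescaled coordinates *)

Section Bridge.
Variables (t : gtype) (K : nat) (P : dpwp).
Hypotheses (sl : sized K (cl P)) (sr : sized K (cr P)).
Let Q := quad_of t P.

Lemma cx_le0 (u : vec) : (u.1 <= 0) = (cx u <= 0).
Proof. by rewrite /cx lerz0. Qed.
Lemma cx_ge0 (u : vec) : (0 <= u.1) = (0 <= cx u).
Proof. by rewrite /cx ler0z. Qed.
Lemma cx_eq0 (u : vec) : (u.1 == 0) = (cx u == 0).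
Proof. by rewrite /cx intr_eq0. Qed.
Lemma ratio_gt0 : 0 < (norm_ratio t)%:R :> rat. Proof. by case: t. Qed.
Lemma cy_le0 (u : vec) : (u.2 <= 0) = (cy t u <= 0).
Proof. by rewrite /cy ler_pdivrMr ?ratio_gt0 // mul0r lerz0. Qed.
Lemma cy_ge0 (u : vec) : (0 <= u.2) = (0 <= cy t u).
Proof. by rewrite /cy ler_pdivlMr ?ratio_gt0 // mul0r ler0z. Qed.
Lemma cy_eq0 (u : vec) : (u.2 == 0) = (cy t u == 0).
Proof.
have := ratio_neq0 t; rewrite -invr_eq0 => /negbTE h.
by rewrite /cy mulf_eq0 h orbF intr_eq0.
Qed.

Lemma quad_of_sup : quad_sup K Q.
Proof.
case: sl sr => [h1 h2] [h3 h4]; split => k hk /=.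
- by apply: sup_lo; apply: leq_trans hk.
- by apply: sup_up; apply: leq_trans hk.
- by apply: sup_up; apply: leq_trans hk.
- by apply: sup_lo; apply: leq_trans hk.
Qed.

Lemma cond_bot k : (0 < k)%N ->
  (Num.max (pair_omega (vsub (mu_l t P k.+1) (mu_r t P k)) Node1)
           (pair_omega (vsub (mu_r t P k.+1) (mu_l t P k)) Node0) = 0) <->
  [/\ 0 <= cslack (lb Q) (rb Q) k, 0 <= cslack (rb Q) (lb Q) k &
      cslack (lb Q) (rb Q) k = 0 \/ cslack (rb Q) (lb Q) k = 0].
Proof.
move=> k0; rewrite max0P /pair_omega cx_le0 cy_le0 cx_eq0 cy_eq0 cxB cyB.
rewrite /mu_l /mu_r -!/(sum_roots t _ _ _).
have [-> _] := sum_lo t (cr P) k.+1; have [_ ->] := sum_lo t (cr P) k.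
have [_ ->] := sum_up t (cl P) k.+1; have [-> _] := sum_up t (cl P) k.
rewrite /cslack /=; split=> [[h1 h2 h3]|[h1 h2 h3]]; split; lra.
Qed.

Lemma cond_top k : (0 < k)%N ->
  (Num.min (pair_omega (vsub (mu_l' t P k.+1) (mu_r' t P k)) Node0)
           (pair_omega (vsub (mu_r' t P k.+1) (mu_l' t P k)) Node1) = 0) <->
  [/\ 0 <= cslack (lt Q) (rt Q) k, 0 <= cslack (rt Q) (lt Q) k &
      cslack (lt Q) (rt Q) k = 0 \/ cslack (rt Q) (lt Q) k = 0].
Proof.
move=> k0; rewrite min0P /pair_omega cx_ge0 cy_ge0 cx_eq0 cy_eq0.
rewrite /mu_l' /mu_r' !cxB !cyB -!/(sum_roots t _ _ _).
have [-> _] := sum_lo t (cl P) k.+1; have [_ ->] := sum_lo t (cl P) k.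
have [_ ->] := sum_up t (cr P) k.+1; have [-> _] := sum_up t (cr P) k.
rewrite /cslack /=; split=> [[h1 h2 h3]|[h1 h2 h3]]; split; lra.
Qed.

Let u := vsub (mu_r_inf t P) (mu_l_inf t P).
Let v := vsub (mu_r'_inf t P) (mu_l'_inf t P).

Lemma cu : cx u = wlo (rb Q) K - whi (lb Q) K /\ cy t u = whi (rb Q) K - wlo (lb Q) K.
Proof.
case: sl sr => [h1 h2] [h3 h4].
rewrite /u cxB cyB /mu_r_inf /mu_l_inf /mu_r /mu_l -!/(sum_roots t _ _ _).
have [-> ->] := sum_lo t (cr P) (size (clo (cr P))).
have [-> ->] := sum_up t (cl P) (size (cup (cl P))).
rewrite -(wlo_stable (@sup_lo t _) h3) -(whi_stable (@sup_lo t _) h3).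
by rewrite -(wlo_stable (@sup_up t _) h2) -(whi_stable (@sup_up t _) h2).
Qed.

Lemma cv : cx v = wlo (lt Q) K - whi (rt Q) K /\ cy t v = whi (lt Q) K - wlo (rt Q) K.
Proof.
case: sl sr => [h1 h2] [h3 h4].
rewrite /v /mu_r'_inf /mu_l'_inf /mu_r' /mu_l' !cxB !cyB -!/(sum_roots t _ _ _).
have [-> ->] := sum_lo t (cl P) (size (clo (cl P))).
have [-> ->] := sum_up t (cr P) (size (cup (cr P))).
rewrite -(wlo_stable (@sup_lo t _) h1) -(whi_stable (@sup_lo t _) h1).
rewrite -(wlo_stable (@sup_up t _) h4) -(whi_stable (@sup_up t _) h4) /=.
by split; ring.
Qed.

(** By [form_alpha1] this is the size prescribed in MV conditions 3 and 4. *)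
Definition gap_part : rat := \sum_(j < K) (rb Q j + lb Q j).

Lemma form_alpha1 : (Defs.form t u (alpha Node1))%:~R = (2 * norm_ratio t)%:R * gap_part.
Proof.
have -> : (Defs.form t u (alpha Node1))%:~R = (2 * norm_ratio t)%:R * (cy t u - cx u).
  rewrite /Defs.form /cx /cy; case: t; case: (u) => a b /=; rewrite !intrD !intrM.
    by field.
  by field.
have [-> ->] := cu; congr (_ * _).
have e1 := whi_wlo (rb Q) K; have e2 := whi_wlo (lb Q) K.
have -> : gap_part = \sum_(j < K) rb Q j + \sum_(j < K) lb Q j by rewrite -big_split.
by rewrite -e1 -e2; ring.
Qed.

End Bridge.

Section BridgeIff.
Variables (t : gtype) (K : nat) (P : dpwp).
Hypotheses (sl : sized K (cl P)) (sr : sized K (cr P)).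
Let Q := quad_of t P.
Let u := vsub (mu_r_inf t P) (mu_l_inf t P).
Let v := vsub (mu_r'_inf t P) (mu_l'_inf t P).
Let S := gap_part t K P.

Lemma parallelE : parallel u v <-> cx u * cy t v = cy t u * cx v.
Proof.
rewrite /parallel /cx /cy; have r0 := ratio_neq0 t; split=> h.
  have : (u.1 * v.2 - u.2 * v.1)%:~R = 0 :> rat by rewrite h.
  rewrite intrB !intrM => h2; have e : u.1%:~R * v.2%:~R = u.2%:~R * v.1%:~R :> rat by lra.
  by rewrite mulrA e; ring.
apply/eqP; rewrite -(intr_eq0 rat) intrB !intrM subr_eq0; apply/eqP.
apply: (divIf r0); rewrite -mulrA h; ring.
Qed.

Lemma part_bound (n : nat) : ((2 * norm_ratio t * n)%N%:Z <= Defs.form t u (alpha Node1))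
  = (n%:R <= S).
Proof.
rewrite -(ler_int rat) -pmulrn (form_alpha1 t sl sr) (natrM _ (2 * norm_ratio t)) ler_pM2l //.
by rewrite ltr0n; case: t.
Qed.

Lemma part_eq (n : nat) : (2 * norm_ratio t * n)%N%:Z = Defs.form t u (alpha Node1)
  <-> n%:R = S.
Proof.
have n0 : (2 * norm_ratio t)%:R != 0 :> rat by rewrite pnatr_eq0; case: t.
split=> [h|h].
  by apply: (mulfI n0); rewrite -(form_alpha1 t sl sr) -h -pmulrn (natrM _ (2 * norm_ratio t)).
have e : ((2 * norm_ratio t * n)%N%:Z)%:~R = (Defs.form t u (alpha Node1))%:~R :> rat.
  by rewrite -pmulrn (form_alpha1 t sl sr) (natrM _ (2 * norm_ratio t)) h.
by move/eqP: e; rewrite eqr_int => /eqP.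
Qed.

(** Since the left and right paths have the same end, the two segments differ by a multiple of
    delta. *)
Lemma sum_diff : ld_wt t (cl P) = ld_wt t (cr P) ->
  cx u - cx v = (sumn (cdel (cl P)))%:R - (sumn (cdel (cr P)))%:R /\
  cy t u - cy t v = (sumn (cdel (cl P)))%:R - (sumn (cdel (cr P)))%:R.
Proof.
move=> e; have [-> ->] := cu t sl sr; have [-> ->] := cv t sl sr.
have [xl yl] := ld_wtE t sl; have [xr yr] := ld_wtE t sr.
by rewrite e in xl yl; rewrite /=; split; lra.
Qed.

Lemma MV_quad : is_dpwp t P -> is_MV t P -> quad_MV K Q.
Proof.
move=> [pl [pr ew]] [c1 [c2 [c3 [c4 [c5 c6]]]]].
have [xl yl] := ld_wtE t sl; have [xr yr] := ld_wtE t sr.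
have [dx dy] := sum_diff ew.
split.
- by move=> k k0; apply/cond_bot => //; apply: c1.
- by move=> k k0; apply/cond_top => //; apply: c2.
- by rewrite /= -xr -ew xl; ring.
- by rewrite /= -yr -ew yl; ring.
have bnd l : (l != [::] -> ((2 * norm_ratio t * largest_part l)%N)%:Z <= Defs.form t u (alpha Node1)) ->
    forall k, k \in l -> k%:R <= S.
  move=> h k hk; have l0 : l != [::] by case: l hk {h}.
  have := h l0; rewrite part_bound; apply: le_trans; rewrite ler_nat.
  exact: largest_part_max.
split; [exact: bnd c5|exact: bnd c6| |].
  move=> /= es; apply: c3; apply/parallelE; rewrite es in dx dy.
  have -> : cx u = cx v by lra.
  have -> : cy t u = cy t v by lra.
  by ring.
move=> /= /eqP ne; case: c4 => [hp|k [/part_eq hk h]]; first by apply: ne; rewrite c3.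
by exists k.
Qed.

Lemma quad_MV_is_MV : is_partition (cdel (cl P)) -> is_partition (cdel (cr P)) ->
  quad_MV K Q -> is_dpwp t P /\ is_MV t P.
Proof.
move=> pl pr [c1 c2 ex ey [c3 c4 c5 c6]].
have [xl yl] := ld_wtE t sl; have [xr yr] := ld_wtE t sr.
have ew : ld_wt t (cl P) = ld_wt t (cr P).
  by apply: (@vec_eqP t); [rewrite xl xr; move: ex|rewrite yl yr; move: ey]; rewrite /=; lra.
have [dx dy] := sum_diff ew.
split; first by [].
split; first by move=> [|[|k]] // _; apply/(cond_bot t) => //; apply: c1.
split; first by move=> [|[|k]] // _; apply/(cond_top t) => //; apply: c2.
have Sxy : S = cy t u - cx u.
  have [-> ->] := cu t sl sr.
  rewrite /S /gap_part big_split /=.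
  have e1 := whi_wlo (rb Q) K; have e2 := whi_wlo (lb Q) K; rewrite /= in e1 e2 *.
  by rewrite -e1 -e2; ring.
split.
  move/parallelE => hp; apply: c5; apply/eqP/negPn/negP => ne.
  have [k hk hr] := c6 ne.
  (* [v] is [u] minus [D] times delta, so in rescaled coordinates the parallelism determinant is
     [D * S] up to sign. If the sizes differ then [S = 0], and removing a part of size 0 would not
     change the size. *)
  have D0 : ((sumn (cdel (cl P)))%:R - (sumn (cdel (cr P)))%:R) * S = 0 :> rat.
    rewrite Sxy; set D := _ - _.
    have eXv : cx v = cx u - D by rewrite /D; lra.
    have eYv : cy t v = cy t u - D by rewrite /D; lra.
    by move: hp; rewrite eXv eYv; lra.
  move/eqP: D0; rewrite mulf_eq0 subr_eq0 eqr_nat eq_sym (negbTE ne) /=.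
  rewrite -(hk : _ = S) pnatr_eq0 => /eqP k0; move/eqP: ne; apply; move: hr; rewrite /= k0.
  by case=> [[i e]|[i e]]; rewrite (sumn_rem i) -e.
split.
  move=> np; have ne : sumn (cdel (cr P)) != sumn (cdel (cl P)).
    apply/eqP => es; apply: np; apply/parallelE; rewrite es in dx dy.
    have -> : cx u = cx v by lra.
    have -> : cy t u = cy t v by lra.
    by ring.
  by have [k hk hr] := c6 ne; exists k; split => //; apply/part_eq.
by split=> h; rewrite part_bound; [apply: c3|apply: c4]; apply: largest_part_mem.
Qed.

End BridgeIff.

Section NodeBridge.
Variables (t : gtype) (i : node) (K : nat) (P : dpwp).
Hypotheses (sl : sized K (cl P)) (sr : sized K (cr P)).

Lemma nquad_sup : quad_sup K (nquad t i P).
Proof. by case: (quad_of_sup t sl sr) i => s1 s2 s3 s4 []. Qed.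

Lemma MV_nquad : is_dpwp t P -> is_MV t P -> quad_MV K (nquad t i P).
Proof.
move=> h1 h2; have h := MV_quad sl sr h1 h2.
by case: i; [exact: h|exact: mirror_MV h].
Qed.

Lemma nquad_MV : is_partition (cdel (cl P)) -> is_partition (cdel (cr P)) ->
  quad_MV K (nquad t i P) -> is_dpwp t P /\ is_MV t P.
Proof.
move=> h1 h2 h; apply: (quad_MV_is_MV sl sr) => //.
by case: i h => // h; exact: mirror_MV h.
Qed.

End NodeBridge.

(** * Dependence of the paths on the data *)

Section PathExt.
Variables (R : realFieldType) (A : nat).
Notation L := A.*2.+4.+1.

Lemma eq_wlo (a b : nat -> R) k : (forall j, (0 < j)%N -> a j = b j) -> wlo a k = wlo b k.
Proof. by move=> h; apply: eq_bigr => -[[|j] hj] _ /=; rewrite ?mulr0 // h. Qed.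

Lemma eq_whi (a b : nat -> R) k : a =1 b -> whi a k = whi b k.
Proof. by move=> h; apply: eq_bigr => j _; rewrite h. Qed.

Lemma eq_whi1 (a b : nat -> R) k : (forall j, (0 < j)%N -> a j = b j) ->
  whi a k.+1 - a 0%N = whi b k.+1 - b 0%N.
Proof.
move=> h; rewrite /whi !big_ord_recl /= !mulr1 [X in X - _]addrC [X in _ = X - _]addrC !addrK.
by apply: eq_bigr => j _; rewrite h.
Qed.

Lemma eq_glue bot bot' s top top' (c i : nat) : (i <= L)%N ->
  (forall k, (k <= A.+2)%N -> bot k = bot' k) ->
  (forall k, (c <= k + A.+2)%N -> top c - top k = top' c - top' k) -> (A.+2 <= c)%N ->
  glue A bot s top c i = glue A bot' s top' c i :> R.
Proof.
move=> hi hb ht hc; rewrite /glue; case: ifP => // h; first by rewrite hb.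
by rewrite hb // ht //; lia.
Qed.

(** [rpath] stops before the edge [rt Q 0], and [lpath_refl] starts after the edge [lb Q 0]. Raising
    these edges therefore leaves the paths unchanged. *)
Lemma rpath_ext (Q Q' : quad R) : rb Q =1 rb Q' ->
  (forall j, (0 < j)%N -> rt Q j = rt Q' j) -> pr Q = pr Q' ->
  same_path A (rpath A Q) (rpath A Q').
Proof.
move=> h1 h2 h3; split=> // i hi; split; rewrite /= h3; apply: eq_glue => //.
- by move=> k _; apply: eq_wlo.
- move=> [|k] hk; first by lia.
  have e1 := eq_whi1 A.+2 h2; have e2 := eq_whi1 k h2; lra.
- by move=> k _; apply: eq_whi.
- by move=> k _; rewrite !(eq_wlo _ h2).
Qed.

Lemma lpath_ext (Q Q' : quad R) : lt Q =1 lt Q' ->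
  (forall j, (0 < j)%N -> lb Q j = lb Q' j) -> pl Q = pl Q' ->
  same_path A (lpath_refl A Q) (lpath_refl A Q').
Proof.
move=> h1 h2 h3; split=> // i hi.
have ey : ly (lpath_refl A Q) i = ly (lpath_refl A Q') i.
  rewrite /= h3; apply: eq_glue => //; first by move=> k _; apply: eq_wlo.
  by move=> k _; rewrite !(eq_whi _ h1).
split => //; move: ey => /= ->; congr (_ - _); rewrite h3; apply: eq_glue => //.
  by move=> k _; apply: eq_whi1.
by move=> k _; rewrite !(@eq_wlo (lt Q) (lt Q')) // => j _; apply: h1.
Qed.

Lemma sym_path (Q : quad R) : (forall k, lb Q k.+1 = rb Q k) ->
  (forall k, rt Q k.+1 = lt Q k) -> pr Q = pl Q ->
  same_path A (rpath A Q) (lpath_refl A Q).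
Proof.
move=> h1 h2 h3.
have w1 (a b : nat -> R) k : (forall j, a j.+1 = b j) -> wlo a k.+1 = whi b k.
  move=> h; rewrite /wlo big_ord_recl mulr0 add0r.
  by apply: eq_bigr => j _; rewrite h.
have w2 (a b : nat -> R) k : (forall j, a j.+1 = b j) ->
    2 * whi b k - (whi a k.+1 - a 0%N) = wlo b k.
  move=> h; have -> : whi a k.+1 - a 0%N = \sum_(j < k) b j * j.+2%:R.
    rewrite /whi big_ord_recl /= mulr1 [X in X - _]addrC addrK.
    by apply: eq_bigr => j _; rewrite -h.
  rewrite mulr_sumr -sumrB; apply: eq_bigr => j _.
  by rewrite -(natr1 j.+1) -(natr1 j); ring.
split => // i hi; rewrite /= /glue; split; case: ifP => hA.
- by rewrite (w1 _ _ _ h1) w2.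
- have [k [-> ->]] : exists k, (A.+3 - (i - A.+3) = k.+1)%N /\ (A.+2 - (i - A.+3) = k)%N.
    by exists (A.+2 - (i - A.+3))%N; lia.
  rewrite !(w1 _ _ _ h1) -(w2 _ _ A.+2 h1) h3.
  by have := w2 _ _ k h2; have := w2 _ _ A.+2 h2; lra.
- by rewrite (w1 _ _ _ h1).
- have [k [-> ->]] : exists k, (A.+3 - (i - A.+3) = k.+1)%N /\ (A.+2 - (i - A.+3) = k)%N.
    by exists (A.+2 - (i - A.+3))%N; lia.
  by rewrite !(w1 _ _ _ h1) !(w1 _ _ _ h2) h3.
Qed.
End PathExt.

Definition ld_upd (r : preal) (n : nat) (c : ldatum) : ldatum :=
  match r with
  | Blo k => LD (set_nth 0%N (clo c) k n) (cup c) (cdel c)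
  | Bup k => LD (clo c) (set_nth 0%N (cup c) k n) (cdel c)
  end.

Lemma coef_upd r n c : coef (ld_upd r n c) r = n.
Proof. by case: r => k /=; rewrite nth_set_nth /= eqxx. Qed.

Lemma coef_upd_ne r n c r' : r' <> r -> coef (ld_upd r n c) r' = coef c r'.
Proof. by case: r r' => k [] k' //= h; rewrite nth_set_nth /=; case: eqP => // e; case: h; rewrite e. Qed.

Lemma cdel_upd r n c : cdel (ld_upd r n c) = cdel c.
Proof. by case: r. Qed.

(** s_i sends the root [Lo i k] to [Up i k.+1] (see [sref_Lo]), so reflecting a datum shifts its
    lists; [n] fills the entry of alpha_i. *)
Definition refl_ld (i : node) (n : nat) (c : ldatum) : ldatum :=
  match i with
  | Node0 => LD (behead (cup c)) (n :: clo c) (cdel c)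
  | Node1 => LD (n :: cup c) (behead (clo c)) (cdel c)
  end.

Lemma refl_ldE i n c :
  [/\ coef (refl_ld i n c) (Up i 0) = n,
      forall k, coef (refl_ld i n c) (Up i k.+1) = coef c (Lo i k),
      forall k, coef (refl_ld i n c) (Lo i k) = coef c (Up i k.+1) &
      cdel (refl_ld i n c) = cdel c].
Proof. by case: i; split => //= k; rewrite nth_behead. Qed.

Definition pair_of (i : node) (a b : ldatum) : dpwp :=
  match i with Node0 => DP b a | Node1 => DP a b end.

Lemma side_pair i a b : side i (pair_of i a b) = a /\ side (other i) (pair_of i a b) = b.
Proof. by case: i. Qed.

Lemma LoUp i k k' : Lo i k <> Up i k'. Proof. by case: i. Qed.
Lemma Up_inj i k k' : Up i k = Up i k' -> k = k'. Proof. by case: i => -[]. Qed.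
Lemma preal_case i (r : preal) : exists k, r = Lo i k \/ r = Up i k.
Proof. by case: i r => [] [] k; exists k; [left|right|right|left]. Qed.
Lemma Up0E i : Up i 0 = alpha_label i. Proof. by case: i. Qed.
Lemma Up_other i k : Up (other i) k = Lo i k. Proof. by case: i. Qed.
Lemma otherK i : other (other i) = i. Proof. by case: i. Qed.
Lemma side_swap i P : side i (swap P) = side (other i) P. Proof. by case: i. Qed.

Lemma root_scale_gt0 t r : 0 < root_scale t r.
Proof. by case: t r => [] [] k //=; case: ifP. Qed.

Lemma root_scaleS t i k : root_scale t (Up i k.+1) = root_scale t (Lo i k).
Proof. by case: t i => [] [] //=; case: odd. Qed.

Definition scale1 t i : rat := root_scale t (Up i 0).

Lemma scoef_inj t c c' r r' : root_scale t r = root_scale t r' ->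
  scoef t c r = scoef t c' r' -> coef c r = coef c' r'.
Proof.
rewrite /scoef => -> /mulfI h; apply/eqP; rewrite -(eqr_nat rat); apply/eqP/h.
by rewrite gt_eqF ?root_scale_gt0.
Qed.

(** [pcoef] and [ncoef] turn out to be phi_i and phi_i^star; see [phi_f] and [phi_fs]. *)
Definition pcoef (i : node) (P : dpwp) : nat := coef (side i P) (Up i 0).
Definition ncoef (i : node) (P : dpwp) : nat := coef (side (other i) P) (Up i 0).

Definition defi (t : gtype) (i : node) (P : dpwp) : int :=
  (pcoef i P)%:Z + (ncoef i P)%:Z - coroot_pair t i (pw_wt t P).

Definition ncx t i (w : vec) : rat := match i with Node0 => cx w | Node1 => cy t w end.
Definition ncy t i (w : vec) : rat := match i with Node0 => cy t w | Node1 => cx w end.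

Lemma corootE t i w :
  scale1 t i * (coroot_pair t i w)%:~R = 2 * (ncx t i w - ncy t i w).
Proof.
case: w => a b; rewrite /scale1 /ncx /ncy /cx /cy /coroot_pair.
have [e1 e2] : cartan t Node0 Node0 = 2 /\ cartan t Node1 Node1 = 2 by case: (t).
have e4 : cartan t Node0 Node1 = if t is Sl2hat then -2 else -1 by case: (t).
have e5 : cartan t Node1 Node0 = if t is Sl2hat then -2 else -4 by case: (t).
by case: i; rewrite ?e1 ?e2 ?e4 ?e5; move: e1 e2 e4 e5 => _ _ _ _; case: t => /=; rewrite intrD !intrM; field.
Qed.

(** The successor keeps the bound positive, as [lcp_commute] requires. *)
Definition ld_size (c : ldatum) : nat := (maxn (size (clo c)) (size (cup c))).+1.
Definition dp_size (P : dpwp) : nat := maxn (ld_size (cl P)) (ld_size (cr P)).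

Lemma ld_size_sized c K : (ld_size c <= K)%N -> sized K c.
Proof. by rewrite /ld_size /sized; lia. Qed.
Lemma dp_size_sized P K : (dp_size P <= K)%N -> [/\ (0 < K)%N, sized K (cl P) & sized K (cr P)].
Proof. by rewrite /dp_size /ld_size /sized; split; lia. Qed.

Lemma quad_totE t i P K : sized K (cl P) -> sized K (cr P) ->
  [/\ tot_x K (nquad t i P) = ncx t i (ld_wt t (side i P)),
      tot_y K (nquad t i P) = ncy t i (ld_wt t (side i P)),
      tot_x' K (nquad t i P) = ncx t i (ld_wt t (side (other i) P)) &
      tot_y' K (nquad t i P) = ncy t i (ld_wt t (side (other i) P))].
Proof.
move=> sl sr; have [a b] := ld_wtE t sl; have [c d] := ld_wtE t sr.
by case: i => /=; rewrite a b c d /tot_x /tot_y /tot_x' /tot_y' /=; split; ring.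
Qed.

Lemma pw_wtE t i P : is_dpwp t P ->
  ld_wt t (side i P) = pw_wt t P /\ ld_wt t (side (other i) P) = pw_wt t P.
Proof. by case=> _ [_ e]; case: i. Qed.

Lemma sorted_side t i P : is_dpwp t P -> sorted geq (cdel (side i P)).
Proof. by case=> /andP[h _] [/andP[h' _] _]; case: i. Qed.

(** * Complementarity and defect at a node *)

Section Node.
Variables (t : gtype) (i : node).
Notation sc := (quad_slope rat).
Let M A P := rpath A (nquad t i P).
Let V A P := lpath_refl A (nquad t i P).

Lemma node_paths A P : is_dpwp t P -> (dp_size P <= A)%N ->
  path_along A (sc A) (M A P) /\ path_along A (sc A) (V A P).
Proof.
move=> h /dp_size_sized [_ sl sr]; have s := nquad_sup t i sl sr.
by split; [apply: rpath_along => //|apply: lpath_refl_along => //]; apply: sorted_side h.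
Qed.

Lemma node_lcp A P : is_dpwp t P -> is_MV t P -> (dp_size P <= A)%N ->
  lcp A (scale1 t i * (ncoef i P)%:R) (M A P) (V A P).
Proof.
move=> h1 h2 /dp_size_sized [_ sl sr]; have s := nquad_sup t i sl sr.
exact: (quad_lcp s (MV_nquad i sl sr h1 h2)).
Qed.

Lemma node_defect A P : is_dpwp t P -> (dp_size P <= A)%N ->
  defect A (M A P) (V A P) = scale1 t i * (defi t i P)%:~R.
Proof.
move=> h /dp_size_sized [_ sl sr]; have s := nquad_sup t i sl sr.
have [ex ey ex' ey'] := quad_totE t i sl sr; have [e1 e2] := pw_wtE i h.
rewrite /M /V (quad_defect s); last 2 first.
- by rewrite ex ex' e1 e2.
- by rewrite ey ey' e1 e2.
rewrite ex ey e1 /defi intrB intrD -!pmulrn -corootE /=.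
by rewrite /scoef /scale1 /pcoef /ncoef; ring.
Qed.

Lemma lcp_node A P : is_partition (cdel (cl P)) -> is_partition (cdel (cr P)) ->
  (dp_size P <= A)%N ->
  ncx t i (ld_wt t (side i P)) = ncx t i (ld_wt t (side (other i) P)) ->
  lcp A (scale1 t i * (ncoef i P)%:R) (M A P) (V A P) -> is_dpwp t P /\ is_MV t P.
Proof.
move=> h1 h2 /dp_size_sized [_ sl sr] ex H; have s := nquad_sup t i sl sr.
have [ex1 _ ex2 _] := quad_totE t i sl sr.
apply: (nquad_MV (i := i) sl sr h1 h2); apply: (lcp_quad s) => //.
by rewrite ex1 ex2.
Qed.

Lemma scale1_gt0 : 0 < scale1 t i. Proof. exact: root_scale_gt0. Qed.

Lemma defi_ge0 P : is_dpwp t P -> is_MV t P -> 0 <= defi t i P.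
Proof.
move=> h1 h2; have [PM PV] := node_paths h1 (leqnn _).
have := defect_ge0 (quad_slopes rat _) PM PV (node_lcp h1 h2 (leqnn _)).
by rewrite node_defect // pmulr_rge0 ?scale1_gt0 // ler0z.
Qed.

Lemma defect_eq0_defi A P : is_dpwp t P -> (dp_size P <= A)%N ->
  defect A (M A P) (V A P) = 0 <-> defi t i P = 0.
Proof.
move=> h1 hA; rewrite node_defect //; split=> [/eqP|->]; last by rewrite mulr0.
by rewrite mulf_eq0 gt_eqF ?scale1_gt0 //= intr_eq0 => /eqP.
Qed.

Definition sym_data (c c' : ldatum) : Prop :=
  [/\ forall k, coef c' (Up i k.+1) = coef c (Lo i k),
      forall k, coef c' (Lo i k) = coef c (Up i k.+1) & cdel c' = cdel c].

(** With defect 0 the two paths coincide, and comparing consecutive vertices recovers the edges one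
    at a time. *)
Lemma defi0_sym P : is_dpwp t P -> is_MV t P -> defi t i P = 0 ->
  sym_data (side i P) (side (other i) P).
Proof.
move=> h1 h2 d0.
have key k A : (dp_size P <= A)%N -> (k <= A.+1)%N ->
  [/\ coef (side (other i) P) (Up i k.+1) = coef (side i P) (Lo i k),
      coef (side (other i) P) (Lo i k) = coef (side i P) (Up i k.+1) &
      cdel (side (other i) P) = cdel (side i P)].
  move=> hA hk; have [PM PV] := node_paths h1 hA.
  have H := node_lcp h1 h2 hA.
  have [ey ep] := defect_eq0 (quad_slopes rat _) PM PV H (proj2 (defect_eq0_defi h1 hA) d0).
  have [_ sl sr] := dp_size_sized hA; have s := nquad_sup t i sl sr.
  have [_ ty _ ty'] := quad_totE t i sl sr; have [w1 w2] := pw_wtE i h1.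
  split; last by rewrite -[RHS]/(lpart (M A P)) ep.
  - have := ey k ltac:(lia); have := ey k.+1 ltac:(lia); rewrite /M /V.
    have [_ ->] := @rpath_bot _ A (nquad t i P) k ltac:(lia).
    have [_ ->] := @rpath_bot _ A (nquad t i P) k.+1 ltac:(lia).
    have [_ ->] := @lpath_bot _ A (nquad t i P) k ltac:(lia).
    have [_ ->] := @lpath_bot _ A (nquad t i P) k.+1 ltac:(lia).
    rewrite whiS (wloS _ k.+1) => a b; apply: (@scoef_inj t); first exact: root_scaleS.
    by apply: (mulIf (natS_neq0 rat k)); move: a; rewrite b /= => /addrI.
  - have := ey (A.*2.+4.+1 - k)%N ltac:(lia); have := ey (A.*2.+4.+1 - k.+1)%N ltac:(lia); rewrite /M /V.
    have [_ ->] := @rpath_top _ _ _ s k ltac:(lia).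
    have [_ ->] := @rpath_top _ _ _ s k.+1 ltac:(lia).
    have [_ ->] := @lpath_top _ _ _ s k ltac:(lia).
    have [_ ->] := @lpath_top _ _ _ s k.+1 ltac:(lia).
    rewrite ty ty' w1 w2 (wloS _ k.+1) whiS => a b.
    apply: (@scoef_inj t); first by rewrite root_scaleS.
    apply: (mulIf (natS_neq0 rat k)); move: a b => /=; lra.
split=> [k|k|].
(* The bound grows with [k] so that every index lies on the path. *)
- by have [] := @key k (maxn (dp_size P) k) ltac:(lia) ltac:(lia).
- by have [] := @key k (maxn (dp_size P) k) ltac:(lia) ltac:(lia).
- by have [] := @key 0%N (dp_size P) ltac:(lia) ltac:(lia).
Qed.

End Node.

Lemma coroot_pairD t i u v : coroot_pair t i (vadd u v) = coroot_pair t i u + coroot_pair t i v.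
Proof. by rewrite /coroot_pair /=; ring. Qed.
Lemma coroot_pairZ t i n v : coroot_pair t i (vscale n v) = n * coroot_pair t i v.
Proof. by rewrite /coroot_pair /=; ring. Qed.
Lemma coroot_alpha t i : coroot_pair t i (alpha i) = 2.
Proof. by case: t i => [] []. Qed.

Definition ld_off (i : node) (c c' : ldatum) : Prop :=
  (forall r, r <> Up i 0 -> coef c' r = coef c r) /\ cdel c' = cdel c.

Lemma ld_off_sym i c c' : ld_off i c c' -> ld_off i c' c.
Proof. by case=> h e; split => // r hr; rewrite h. Qed.

Lemma ld_off_trans i c c' c'' : ld_off i c c' -> ld_off i c' c'' -> ld_off i c c''.
Proof. by case=> h e [h' e']; split => [r hr|]; [rewrite h' ?h|rewrite e']. Qed.

Lemma ld_incr_off i c c' : ld_incr c c' (alpha_label i) -> ld_off i c c'.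
Proof. by rewrite -Up0E => -[_ [h e]]. Qed.

Lemma ld_upd_off i n c : ld_off i c (ld_upd (Up i 0) n c).
Proof. by split=> [r hr|]; [rewrite coef_upd_ne|rewrite cdel_upd]. Qed.

Lemma ld_off_wt t i c c' : ld_off i c c' ->
  ld_wt t c' = vadd (ld_wt t c) (vscale ((coef c' (Up i 0))%:Z - (coef c (Up i 0))%:Z) (alpha i)).
Proof.
move=> [h e]; pose K := maxn (ld_size c) (ld_size c').
have s : sized K c by apply: ld_size_sized; rewrite /K; lia.
have s' : sized K c' by apply: ld_size_sized; rewrite /K; lia.
have K0 : (0 < K)%N by rewrite /K /ld_size; lia.
have upd (a a' : nat -> rat) : (forall j, (0 < j)%N -> a' j = a j) ->
    whi a' K = whi a K + (a' 0%N - a 0%N) /\ wlo a' K = wlo a K.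
  move=> ha; split; last by apply: eq_wlo.
  by rewrite -(prednK K0); have := @eq_whi1 _ _ _ K.-1 ha; lra.
have hLo k : scoef t c' (Lo i k) = scoef t c (Lo i k).
  by rewrite /scoef h //; apply: LoUp.
have hUp j : (0 < j)%N -> scoef t c' (Up i j) = scoef t c (Up i j).
  by move=> j0; rewrite /scoef h // => /Up_inj e0; rewrite e0 in j0.
have [x y] := ld_wtE t s; have [x' y'] := ld_wtE t s'.
have d0 : scoef t c' (Up i 0) - scoef t c (Up i 0) =
    scale1 t i * ((coef c' (Up i 0))%:Z - (coef c (Up i 0))%:Z)%:~R.
  by rewrite intrB -!pmulrn /scoef /scale1; ring.
apply: (@vec_eqP t).
- rewrite x' cxD cxZ x e; case: i hLo hUp d0 {h e} => /= hLo hUp d0.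
    have [-> _] := upd _ _ hUp; rewrite (@eq_wlo _ _ _ _ (fun j _ => hLo j)) d0.
    by rewrite /cx /scale1 /=; case: (t) => /=; lra.
  have [_ ->] := upd _ _ hUp; rewrite (@eq_whi _ _ _ _ hLo) /cx /=; lra.
- rewrite y' cyD cyZ y e; case: i hLo hUp d0 {h e} => /= hLo hUp d0.
    have [_ ->] := upd _ _ hUp; rewrite (@eq_whi _ _ _ _ hLo) /cy /=; lra.
  have [-> _] := upd _ _ hUp; rewrite (@eq_wlo _ _ _ _ (fun j _ => hLo j)) d0.
  by rewrite /cy /scale1 /=; case: (t) => /=; lra.
Qed.

Lemma ld_incr_wt t i c c' : ld_incr c c' (alpha_label i) ->
  ld_wt t c' = vadd (ld_wt t c) (alpha i).
Proof.
move=> h; rewrite (ld_off_wt t (ld_incr_off h)); case: h; rewrite Up0E => -> _.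
have -> : (coef c (Up i 0)).+1%:Z - (coef c (Up i 0))%:Z = 1 by lia.
by case: i.
Qed.

Lemma swap_MV t P : is_dpwp t P -> is_MV t P -> is_dpwp t (swap P) /\ is_MV t (swap P).
Proof.
move=> h1 h2; have [_ sl sr] := dp_size_sized (leqnn (dp_size P)).
have [/andP _ []] := h1 => /andP _ _.
apply: (@quad_MV_is_MV t (dp_size P) (swap P)) => //; try by case: h1 => ? [].
exact: flip_MV (MV_quad sl sr h1 h2).
Qed.

Lemma defi_swap t i P : is_dpwp t P -> defi t i (swap P) = defi t i P.
Proof.
move=> [_ [_ e]]; rewrite /defi /pcoef /ncoef !side_swap otherK.
by rewrite /pw_wt /= e [in LHS]addrC [in RHS]addrC; congr (_ + _); rewrite addrC.
Qed.

(** * Raising the edges along a simple root *)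

Section NodeMV.
Variables (t : gtype) (i : node).
Notation M A P := (rpath A (nquad t i P)).
Notation V A P := (lpath_refl A (nquad t i P)).

Lemma same_rpath A P P' : ld_off i (side i P) (side i P') ->
  same_path A (M A P) (M A P').
Proof.
move=> [h e]; apply: rpath_ext => /=; last by rewrite e.
- by move=> k; rewrite /scoef h //; apply: LoUp.
- by move=> k k0; rewrite /scoef h // => /Up_inj e0; rewrite e0 in k0.
Qed.

Lemma same_lpath A P P' : ld_off i (side (other i) P) (side (other i) P') ->
  same_path A (V A P) (V A P').
Proof.
move=> [h e]; apply: lpath_ext => /=; last by rewrite e.
- by move=> k; rewrite /scoef h //; apply: LoUp.
- by move=> k k0; rewrite /scoef h // => /Up_inj e0; rewrite e0 in k0.
Qed.

Lemma sym_same_path A P : sym_data i (side i P) (side (other i) P) ->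
  same_path A (M A P) (V A P).
Proof.
move=> [h1 h2 h3]; apply: sym_path => /=; last by rewrite h3.
- by move=> k; rewrite /scoef h1 root_scaleS.
- by move=> k; rewrite /scoef h2 root_scaleS.
Qed.

(** The polytopes share the path on side [i], so [lcp_n_le] compares their opposite edges. Used in
    both directions, it shows that this edge depends on the path alone unless a defect vanishes. *)
Lemma ncoef_le P P' : is_dpwp t P -> is_MV t P -> is_dpwp t P' -> is_MV t P' ->
  ld_off i (side i P) (side i P') ->
  (ncoef i P <= ncoef i P')%N \/ defi t i P = 0.
Proof.
move=> h1 h2 h1' h2' ho; pose A := maxn (dp_size P) (dp_size P').
have hA : (dp_size P <= A)%N by rewrite /A; lia.
have hA' : (dp_size P' <= A)%N by rewrite /A; lia.
have [PM PV] := node_paths i h1 hA; have [PM' PV'] := node_paths i h1' hA'.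
have H := node_lcp i h1 h2 hA.
have H' := lcp_ext (same_path_sym (same_rpath A ho)) (same_path_sym (same_path_sym (conj (fun _ _ => conj erefl erefl) erefl))) (node_lcp i h1' h2' hA').
case: (lcp_n_le (quad_slopes rat A) PM PV PV' H H') => h.
  by left; move: h; rewrite ler_pM2l ?scale1_gt0 // ler_nat.
by right; apply/(defect_eq0_defi i h1 hA).
Qed.

Lemma pcoef_le P P' : is_dpwp t P -> is_MV t P -> is_dpwp t P' -> is_MV t P' ->
  ld_off i (side (other i) P) (side (other i) P') ->
  (pcoef i P <= pcoef i P')%N \/ defi t i P = 0.
Proof.
move=> h1 h2 h1' h2' ho; have [a b] := swap_MV h1 h2; have [a' b'] := swap_MV h1' h2'.
have := ncoef_le a b a' b'; rewrite !side_swap => /(_ ho).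
by rewrite defi_swap // /ncoef /pcoef !side_swap otherK.
Qed.

Lemma defi_incr P P' : is_dpwp t P -> is_dpwp t P' ->
  ld_incr (side i P) (side i P') (alpha_label i) \/
  ld_incr (side (other i) P) (side (other i) P') (alpha_label i) ->
  defi t i P' = (pcoef i P')%:Z + (ncoef i P')%:Z - coroot_pair t i (pw_wt t P) - 2.
Proof.
move=> h h' hi; have [w1 w2] := pw_wtE i h; have [w1' w2'] := pw_wtE i h'.
have e : pw_wt t P' = vadd (pw_wt t P) (alpha i).
  by case: hi => /(ld_incr_wt t) hi; [rewrite -w1' hi w1|rewrite -w2' hi w2].
by rewrite /defi e coroot_pairD coroot_alpha; ring.
Qed.

(** [P1] and [P2] stand for e_i P and e_i^star P. [P] shares its right path (seen from [i]) with
    [P1] and its reflected left path with [P2], so [lcp_commute] applies with [h] one unit of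
    alpha_i. *)
Lemma commute_MV P P1 P2 Q :
  is_dpwp t P -> is_MV t P -> is_dpwp t P1 -> is_MV t P1 -> is_dpwp t P2 -> is_MV t P2 ->
  ld_incr (side i P) (side i P1) (alpha_label i) -> ncoef i P1 = ncoef i P ->
  ld_incr (side (other i) P) (side (other i) P2) (alpha_label i) -> pcoef i P2 = pcoef i P ->
  2 <= defi t i P ->
  ld_incr (side i P2) (side i Q) (alpha_label i) ->
  ld_incr (side (other i) P1) (side (other i) Q) (alpha_label i) ->
  is_dpwp t Q /\ is_MV t Q.
Proof.
move=> h h' h1 h1' h2 h2' i1 n1 i2 p2 d2 q2 q1.
pose A := maxn (maxn (dp_size P) (dp_size P1)) (maxn (dp_size P2) (dp_size Q)).
have [hA hA1 hA2 hAQ] : [/\ (dp_size P <= A)%N, (dp_size P1 <= A)%N, (dp_size P2 <= A)%N & (dp_size Q <= A)%N].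
  by rewrite /A; split; lia.
have A0 : (0 < A)%N by case: (dp_size_sized hA).
have refl (X : lpath rat) : same_path A X X by split.
have [PM PV] := node_paths i h hA; have [PM1 PV1] := node_paths i h1 hA1.
have [PM2 PV2] := node_paths i h2 hA2.
have oM1 := same_rpath A (ld_off_sym (ld_incr_off i1)).
have oV2 := same_lpath A (ld_off_sym (ld_incr_off i2)).
have H := node_lcp i h h' hA.
have H1 := lcp_ext oM1 (refl _) (node_lcp i h1 h1' hA1).
have H2 := lcp_ext (refl _) oV2 (node_lcp i h2 h2' hA2).
have s0 := scale1_gt0 t i.
have d1 := defi_incr h h1 (or_introl i1); have d3 := defi_incr h h2 (or_intror i2).
have ep1 : pcoef i P1 = (pcoef i P).+1 by case: i1; rewrite -Up0E.
have en2 : ncoef i P2 = (ncoef i P).+1 by case: i2; rewrite -Up0E.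
have enQ : ncoef i Q = (ncoef i P).+1 by case: q1; rewrite -Up0E /ncoef => -> _; rewrite -[coef _ _]/(ncoef i P1) n1.
have L1 : (A.*2.+4.+1 <= A.*2.+4.+1)%N by [].
have D := node_defect i h hA; have D1 := node_defect i h1 hA1; have D2 := node_defect i h2 hA2.
have D1' : defect A (M A P) (V A P1) = defect A (M A P1) (V A P1).
  by rewrite /defect; have [/(_ _ L1)[-> _] _] := oM1.
have D2' : defect A (M A P2) (V A P) = defect A (M A P2) (V A P2).
  by rewrite /defect; have [/(_ _ L1)[-> _] _] := oV2.
have H3 : lcp A (scale1 t i * (ncoef i P)%:R + scale1 t i) (M A P2) (V A P1).
  apply: (lcp_commute (quad_slopes rat A) A0 PM PV PV1 PM2 H) => //.
  - by rewrite -n1.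
  - by move: H2; rewrite en2 -natr1 mulrDr mulr1.
  - rewrite D1' D1 D d1 ep1 n1 /defi !intrB !intrD -!pmulrn -natr1; ring.
  - rewrite D2' D2 D d3 en2 p2 /defi !intrB !intrD -!pmulrn -natr1; ring.
  - by rewrite D mulrC ler_pM2l // -(ler_int rat) in d2 *.
have cq : cdel (side i Q) = cdel (side i P2) /\ cdel (side (other i) Q) = cdel (side (other i) P1).
  by case: q2 q1 => _ [_ ->] [_ [_ ->]].
apply: (@lcp_node t i A) => //.
- case: (i) cq => /= -[a b]; rewrite ?a ?b; [by case: h1|by case: h2].
- case: (i) cq => /= -[a b]; rewrite ?a ?b; [by case: h2 => _ []|by case: h1 => _ []].
- rewrite (ld_incr_wt t q2) (ld_incr_wt t q1); congr (ncx _ _ (vadd _ _)).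
  have [-> _] := pw_wtE i h2; have [_ ->] := pw_wtE i h1.
  have [_ <-] := pw_wtE i h2; have [<- _] := pw_wtE i h1.
  by rewrite (ld_incr_wt t i1) (ld_incr_wt t i2); have [-> ->] := pw_wtE i h.
rewrite enQ -natr1 mulrDr mulr1.
exact: lcp_ext (same_rpath A (ld_incr_off q2)) (same_lpath A (ld_incr_off q1)) H3.
Qed.

(** A path paired with itself remains a solution when the lower edge grows ([lcp_diag_mono]). *)
Lemma defi0_incr P Q : is_dpwp t P -> is_MV t P -> defi t i P = 0 ->
  ld_incr (side i P) (side i Q) (alpha_label i) ->
  ld_incr (side (other i) P) (side (other i) Q) (alpha_label i) ->
  is_dpwp t Q /\ is_MV t Q.
Proof.
move=> h h' d q q'; pose A := maxn (dp_size P) (dp_size Q).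
have [hA hAQ] : (dp_size P <= A)%N /\ (dp_size Q <= A)%N by rewrite /A; split; lia.
have refl (X : lpath rat) : same_path A X X by split.
have sp := sym_same_path A (defi0_sym h h' d).
have H := lcp_ext (refl _) (same_path_sym sp) (node_lcp i h h' hA).
have H2 : lcp A (scale1 t i * (ncoef i Q)%:R) (M A P) (M A P).
  apply: lcp_diag_mono H _; rewrite ler_pM2l ?scale1_gt0 // ler_nat.
  by case: q'; rewrite -Up0E /ncoef => -> _.
have cq : cdel (side i Q) = cdel (side i P) /\ cdel (side (other i) Q) = cdel (side (other i) P).
  by case: q q' => _ [_ ->] [_ [_ ->]].
apply: (@lcp_node t i A) => //.
- case: (i) cq => /= -[a b]; rewrite ?a ?b; by case: h.
- case: (i) cq => /= -[a b]; rewrite ?a ?b; by case: h => _ [].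
- rewrite (ld_incr_wt t q) (ld_incr_wt t q'); congr (ncx _ _ (vadd _ _)).
  by have [-> ->] := pw_wtE i h.
apply: lcp_ext H2; first exact: same_rpath (ld_incr_off q).
have [a b] := sp; have [a' b'] := same_lpath A (ld_incr_off q').
split; last by rewrite b b'.
by move=> j hj; have [-> ->] := a j hj; have [-> ->] := a' j hj.
Qed.

End NodeMV.

Lemma refl_ld_wt t i c : coef c (Up i 0) = 0%N ->
  ld_wt t (refl_ld i 0 c) = vsub (ld_wt t c) (vscale (coroot_pair t i (ld_wt t c)) (alpha i)).
Proof.
move=> c0; pose c' := refl_ld i 0 c; pose K := (maxn (ld_size c) (ld_size c')).
have [r1 r2 r3 r4] := refl_ldE i 0 c.
have s : sized K c by apply: ld_size_sized; rewrite /K; lia.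
have s' : sized K c' by apply: ld_size_sized; rewrite /K; lia.
have S : sized K.+1 c by case: s; split; lia.
have S' : sized K.+1 c' by case: s'; split; lia.
pose a k := scoef t c (Lo i k); pose b k := scoef t c (Up i k).
pose a' k := scoef t c' (Lo i k); pose b' k := scoef t c' (Up i k).
have b0 : b 0%N = 0 by rewrite /b /scoef c0 mulr0.
have b0' : b' 0%N = 0 by rewrite /b' /scoef r1 mulr0.
have e1 k : b' k.+1 = a k by rewrite /b' /a /scoef r2 root_scaleS.
have e2 k : b k.+1 = a' k by rewrite /a' /b /scoef r3 root_scaleS.
have [x y] := ld_wtE t s; have [X Y] := ld_wtE t S.
have [x' y'] := ld_wtE t s'; have [X' Y'] := ld_wtE t S'.
have w1 (f g : nat -> rat) k : (forall j, f j.+1 = g j) -> wlo f k.+1 = whi g k.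
  move=> h; rewrite /wlo big_ord_recl mulr0 add0r.
  by apply: eq_bigr => j _; rewrite h.
have w2 (f g : nat -> rat) k : (forall j, f j.+1 = g j) -> f 0%N = 0 ->
    whi f k.+1 = 2 * whi g k - wlo g k.
  move=> h f0; rewrite /whi /wlo big_ord_recl f0 mul0r add0r mulr_sumr -sumrB.
  by apply: eq_bigr => j _; rewrite h -(natr1 j.+1) -(natr1 j); ring.
have co := corootE t i (ld_wt t c).
have w3 : wlo b' K.+1 = whi a K by apply: w1.
have w4 : whi b' K.+1 = 2 * whi a K - wlo a K by apply: w2.
have w5 : wlo b K.+1 = whi a' K by apply: w1.
have w6 : whi b K.+1 = 2 * whi a' K - wlo a' K by apply: w2.
have al : ncx t i (alpha i) = scale1 t i /\ ncy t i (alpha i) = 0.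
  by case: (i); case: (t).
have nxE (v w : vec) : ncx t i v = ncx t i w -> ncy t i v = ncy t i w -> v = w.
  by case: (i) => /= h1 h2; apply: (@vec_eqP t).
have nxB (v w : vec) n : ncx t i (vsub v (vscale n w)) = ncx t i v - n%:~R * ncx t i w /\
    ncy t i (vsub v (vscale n w)) = ncy t i v - n%:~R * ncy t i w.
  by case: (i); rewrite /ncx /ncy cxB cyB cxZ cyZ.
have st (f : nat -> rat) : sup K f -> wlo f K.+1 = wlo f K /\ whi f K.+1 = whi f K.
  by move=> h; rewrite (wlo_stable h) ?(whi_stable h).
have [sa sa' sb sb'] : [/\ sup K a, sup K a', sup K b & sup K b'].
  have sz (d : ldatum) : sized K d -> sup K (fun k => scoef t d (Lo i k)) /\ sup K (fun k => scoef t d (Up i k)).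
    by move=> [h1 h2]; case: (i); split=> k hk; rewrite /scoef /= nth_default ?mulr0 //; lia.
  by have [u1 u2] := sz _ s; have [u3 u4] := sz _ s'.
have [E1 E2] : ncx t i (ld_wt t c) = wlo a K + (sumn (cdel c))%:R + whi b K /\
               ncy t i (ld_wt t c) = whi a K + (sumn (cdel c))%:R + wlo b K.
  by rewrite /a /b; case: (i) x y => x y; rewrite /ncx /ncy x y /=; split => //; ring.
have [E3 E4] : ncx t i (ld_wt t c') = wlo a' K + (sumn (cdel c))%:R + whi b' K /\
               ncy t i (ld_wt t c') = whi a' K + (sumn (cdel c))%:R + wlo b' K.
  rewrite -r4 -/c' /a' /b'; case: (i) x' y' => x' y'; rewrite /ncx /ncy x' y' /=; split => //; ring.
have [al1 al2] := al; have [n1 n2] := nxB (ld_wt t c) (alpha i) (coroot_pair t i (ld_wt t c)).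
have [t1 t2] := st _ sb; have [t3 t4] := st _ sb'.
apply: nxE; rewrite -/c'.
  by rewrite n1 al1 E3 E1; lra.
by rewrite n2 al2 E4 E2; lra.
Qed.

(** Pair the path of [c] with itself. By [lcp_diag] this is a solution once the lower edge is long
    enough, and the upper edge is then chosen to close the polytope. *)
Lemma sym_MV_exists t i c : is_partition (cdel c) ->
  exists2 Q, is_dpwp t Q /\ is_MV t Q & ld_off i c (side i Q).
Proof.
move=> pc; pose c0 := ld_upd (Up i 0) 0 c.
pose Qn p n := pair_of i (ld_upd (Up i 0) p c) (refl_ld i n c).
have off p n : ld_off i c (side i (Qn p n)).
  by rewrite /Qn; have [-> _] := side_pair i (ld_upd (Up i 0) p c) (refl_ld i n c); apply: ld_upd_off.
pose A := dp_size (Qn 0%N 0%N).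
have szQ p n : dp_size (Qn p n) = A.
  by rewrite /A /Qn /dp_size /ld_size; case: (i) => /=; rewrite !size_set_nth.
pose M0 := rpath A (nquad t i (Qn 0%N 0%N)).
have symQ p n : sym_data i (side i (Qn p n)) (side (other i) (Qn p n)).
  rewrite /Qn; have [-> ->] := side_pair i (ld_upd (Up i 0) p c) (refl_ld i n c).
  have [r1 r2 r3 r4] := refl_ldE i n c.
  split=> [k|k|]; last by rewrite r4 cdel_upd.
    by rewrite r2 coef_upd_ne //; apply: LoUp.
  by rewrite r3 coef_upd_ne // => /Up_inj.
have [_ sl sr] := dp_size_sized (eq_leq (szQ 0%N 0%N)).
have sup0 := nquad_sup t i sl sr.
have PM : path_along A (quad_slope rat A) M0.
  apply: rpath_along => //=; have [_ ->] := off 0%N 0%N; by case/andP: pc.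
have offR n : ld_off i (refl_ld i 0 c) (refl_ld i n c).
  have [r1 r2 r3 r4] := refl_ldE i n c; have [q1 q2 q3 q4] := refl_ldE i 0 c.
  split; last by rewrite r4 q4.
  move=> r hr; have [[|k] [e|e]] := preal_case i r; rewrite e in hr *.
  - by rewrite r3 q3.
  - by [].
  - by rewrite r3 q3.
  - by rewrite r2 q2.
pose z := coroot_pair t i (ld_wt t c0).
have s0 := scale1_gt0 t i.
have [N [hN1 hN2]] : exists N : nat, sym_bound A M0 <= scale1 t i * N%:R /\ (`|z| <= N)%N.
  pose x := `|sym_bound A M0 / scale1 t i|.
  exists (maxn (Num.bound x) `|z|%N); split; last exact: leq_maxr.
  rewrite mulrC -ler_pdivrMr //; apply: le_trans (ler_norm _) _; rewrite -/x.
  apply: le_trans (ltW (archi_boundP (normr_ge0 _))) _.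
  by rewrite ler_nat leq_maxl.
(* Without the edges along alpha_i the two weights are exchanged by s_i and differ by [z] times
   alpha_i; the lengths [p] and [N] have to compensate for this. *)
have [p hp] : exists p : nat, p%:Z = N%:Z - z.
  by exists (`|N%:Z - z|%N); rewrite gez0_abs //; lia.
exists (Qn p N); last exact: off.
apply: (@lcp_node t i A); rewrite ?szQ //.
- by rewrite /Qn; case: (i) => //=; rewrite ?cdel_upd.
- by rewrite /Qn; case: (i) => //=; rewrite ?cdel_upd.
- have [-> ->] := side_pair i (ld_upd (Up i 0) p c) (refl_ld i N c).
  rewrite (ld_off_wt t (offR N)).
  have oc : ld_off i c0 (ld_upd (Up i 0) p c).
    by apply: ld_off_trans (ld_upd_off i p c); apply: ld_off_sym; apply: ld_upd_off.
  rewrite (ld_off_wt t oc) !coef_upd.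
  have [-> _ _ _] := refl_ldE i N c; have [-> _ _ _] := refl_ldE i 0 c.
  have -> : ld_wt t (refl_ld i 0 c) = ld_wt t (refl_ld i 0 c0).
    have [r1 r2 r3 r4] := refl_ldE i 0 c; have [q1 q2 q3 q4] := refl_ldE i 0 c0.
    have o : ld_off i (refl_ld i 0 c0) (refl_ld i 0 c).
      split=> [r hr|]; last by rewrite r4 q4 cdel_upd.
      have [[|k] [e|e]] := preal_case i r; rewrite e in hr *.
      - by rewrite r3 q3 coef_upd_ne // => /Up_inj.
      - by [].
      - by rewrite r3 q3 coef_upd_ne // => /Up_inj.
      - by rewrite r2 q2 coef_upd_ne //; apply: LoUp.
    by rewrite (ld_off_wt t o) r1 q1 subrr; case: (ld_wt _ _) => ? ?; rewrite /vadd /= !mul0r !addr0.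
  rewrite (refl_ld_wt t (coef_upd _ _ _)) -/c0 -/z hp; congr ncx.
  by case: (ld_wt t c0) => a b; rewrite /vadd /vsub /vscale /=; congr pair; ring.
have en : ncoef i (Qn p N) = N.
  rewrite /ncoef; have [_ ->] := side_pair i (ld_upd (Up i 0) p c) (refl_ld i N c).
  by case: (refl_ldE i N c).
rewrite en; have H := lcp_diag PM hN1.
have oQ : ld_off i (side i (Qn 0%N 0%N)) (side i (Qn p N)).
  by apply: ld_off_trans (off p N); apply: ld_off_sym.
have s1 := same_rpath t A oQ; have s2 := sym_same_path t A (symQ p N).
apply: lcp_ext H => //; split.
  by move=> j hj; case: s1 s2 => [h1 _] [h2 _]; have [-> ->] := h1 j hj; exact: h2.
by case: s1 s2 => [_ h1] [_ h2]; rewrite -h2 -h1.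
Qed.

Lemma ld_eq_sym c c' : ld_eq c c' -> ld_eq c' c.
Proof. by case=> h e; split => // r. Qed.

Lemma ld_eq_off i c c' : ld_off i c c' -> coef c (Up i 0) = coef c' (Up i 0) -> ld_eq c c'.
Proof.
move=> [h e] h0; split => // r.
have [[|k] [er|er]] := preal_case i r; rewrite er //; rewrite h //; try exact: LoUp.
by move/Up_inj.
Qed.

Lemma ld_eq_is_off i c c' : ld_eq c c' -> ld_off i c c'.
Proof. by case=> h e; split => // r _. Qed.

Lemma ld_eq_wt t c c' : ld_eq c c' -> ld_wt t c = ld_wt t c'.
Proof.
move=> h; rewrite (ld_off_wt t (ld_eq_is_off Node0 h)); case: h => -> _.
by rewrite subrr; case: (ld_wt t c) => a b; rewrite /vadd /= !addr0.
Qed.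

Lemma ld_incr_eq c1 c2 c1' c2' r : ld_eq c1 c2 -> ld_eq c1' c2' ->
  ld_incr c1 c1' r -> ld_incr c2 c2' r.
Proof.
move=> [h e] [h' e'] [a [b c]]; split; first by rewrite -h -h'.
by split => [r' hr|]; [rewrite -h -h' b|rewrite -e -e'].
Qed.

Lemma ld_incr_det c c1 c2 r : ld_incr c c1 r -> ld_incr c c2 r -> ld_eq c1 c2.
Proof.
move=> [a [b d]] [a' [b' d']]; split; last by rewrite d d'.
move=> r'; have [->|ne] : r' = r \/ r' <> r.
  by case: r r' {a b d a' b' d'} => k [] k'; try (by right);
    case: (eqVneq k' k) => [->|/eqP ne]; [left|right => -[]|left|right => -[]].
by rewrite a a'. by rewrite b // b'.
Qed.

Lemma ld_upd_incr i c : ld_incr c (ld_upd (Up i 0) (coef c (Up i 0)).+1 c) (alpha_label i).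
Proof.
rewrite -Up0E; split; first by rewrite coef_upd.
by split => [r hr|]; [rewrite coef_upd_ne|rewrite cdel_upd].
Qed.

Lemma wlo_ge0 (a : nat -> rat) k : (forall j, 0 <= a j) -> 0 <= wlo a k.
Proof. by move=> h; apply: sumr_ge0 => j _; rewrite mulr_ge0. Qed.
Lemma whi_ge (a : nat -> rat) k j : (forall j, 0 <= a j) -> (j < k)%N -> a j <= whi a k.
Proof.
move=> h hj; rewrite /whi (bigD1 (Ordinal hj)) //= -[leLHS]addr0 lerD //.
  by rewrite ler_peMr // ler1n.
by apply: sumr_ge0 => l _; rewrite mulr_ge0.
Qed.

Lemma scoef_ge0 t c r : 0 <= scoef t c r.
Proof. by rewrite /scoef mulr_ge0 // ltW // root_scale_gt0. Qed.

Lemma ld_wt0 t c : ld_wt t c = vzero -> (forall r, coef c r = 0%N) /\ sumn (cdel c) = 0%N.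
Proof.
move=> w0; pose K := ld_size c.
have aux r K' : sized K' c -> (match r with Blo k => k < K' | Bup k => k < K' end)%N ->
    coef c r = 0%N /\ sumn (cdel c) = 0%N.
  move=> s hr; have [x y] := ld_wtE t s; rewrite w0 /cx /cy /= mul0r in x y.
  have n0 : 0 <= (sumn (cdel c))%:R :> rat by [].
  have l1 := @wlo_ge0 (fun j => scoef t c (Blo j)) K' (fun j => scoef_ge0 t c _).
  have l2 := @wlo_ge0 (fun j => scoef t c (Bup j)) K' (fun j => scoef_ge0 t c _).
  have l3 : 0 <= whi (fun j => scoef t c (Blo j)) K'.
    by apply: sumr_ge0 => j _; rewrite mulr_ge0 // scoef_ge0.
  have l4 : 0 <= whi (fun j => scoef t c (Bup j)) K'.
    by apply: sumr_ge0 => j _; rewrite mulr_ge0 // scoef_ge0.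
  have z0 : sumn (cdel c) = 0%N.
    by apply/eqP; rewrite -(eqr_nat rat); apply/eqP; lra.
  split => //; apply/eqP; rewrite -(eqr_nat rat); apply/eqP.
  have rs := root_scale_gt0 t r; have r0 := scoef_ge0 t c r.
  suff : scoef t c r = 0 by move/eqP; rewrite /scoef mulf_eq0 gt_eqF //= => /eqP.
  case: r hr rs r0 => k hk rs r0.
    have := @whi_ge (fun j => scoef t c (Blo j)) K' k (fun j => scoef_ge0 t c _) hk; lra.
  have := @whi_ge (fun j => scoef t c (Bup j)) K' k (fun j => scoef_ge0 t c _) hk; lra.
have sK K' : (K <= K')%N -> sized K' c by move=> hK; apply: ld_size_sized.
split=> [[] k|].
- by case: (aux (Blo k) _ (sK _ (leq_maxl K k.+1))) => //; lia.
- by case: (aux (Bup k) _ (sK _ (leq_maxl K k.+1))) => //; lia.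
by case: (aux (Blo 0) K (sK _ (leqnn _)) _).
Qed.

Lemma partition_side t i P : is_dpwp t P -> is_partition (cdel (side i P)).
Proof. by case=> h [h' _]; case: i. Qed.

(** * Crystal operators *)

Section Crystal.
Variables (t : gtype) (B : Type) (b0 : B) (wt : B -> vec)
  (e : node -> B -> B) (f : node -> B -> option B)
  (es : node -> B -> B) (fs : node -> B -> option B) (MV : B -> dpwp).
Hypotheses (HB : is_Binf t b0 wt e f es fs) (HMV : mv_crystal_iso t wt e MV).

Notation A i b := (side i (MV b)).
Notation d i b := (defi t i (MV b)).

Lemma MV_dp b : is_dpwp t (MV b). Proof. by case: HMV => h _; case: (h b). Qed.
Lemma MV_mv b : is_MV t (MV b). Proof. by case: HMV => h _; case: (h b). Qed.
Lemma MV_surj Q : is_dpwp t Q -> is_MV t Q -> exists b, forall i, ld_eq (A i b) (side i Q).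
Proof. by case: HMV => _ [h _] h1 h2; have [b [hl hr]] := h Q h1 h2; exists b; case. Qed.
Lemma MV_inj b b' : (forall i, ld_eq (A i b) (A i b')) -> b = b'.
Proof. by case: HMV => _ [_ [h _]] h1; apply: h; split; [exact: h1 Node1|exact: h1 Node0]. Qed.
Lemma MV_wt b : pw_wt t (MV b) = wt b. Proof. by case: HMV => _ [_ [_ [h _]]]. Qed.
Lemma MV_e i b : ld_incr (A i b) (A i (e i b)) (alpha_label i).
Proof. by case: HMV => _ [_ [_ [_ [h h']]]]; case: i; [exact: h|exact: h']. Qed.
Lemma A_wt i b : ld_wt t (A i b) = wt b.
Proof. by have [-> _] := pw_wtE i (MV_dp b); rewrite MV_wt. Qed.

Lemma feP i b b' : f i b = Some b' <-> e i b' = b. Proof. by case: HB => -[h _] _. Qed.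
Lemma fesP i b b' : fs i b = Some b' <-> es i b' = b. Proof. by case: HB => _ [[h _] _]. Qed.
Lemma wt_e i b : wt (e i b) = vadd (wt b) (alpha i). Proof. by case: HB => -[_ [h _]] _. Qed.
Lemma wt_es i b : wt (es i b) = vadd (wt b) (alpha i). Proof. by case: HB => _ [[_ [h _]] _]. Qed.
Lemma wt_b0 : wt b0 = vzero. Proof. by case: HB => _ [_ []]. Qed.
Lemma gen_e b : b = b0 \/ exists i b', b = e i b'.
Proof.
case: HB => -[_ [_ h]] _; have [[|i s] ->] := h b; first by left.
by right; exists i, (foldr e b0 s).
Qed.

Lemma e_inj i : injective (e i).
Proof. by move=> b b' h; have /feP := h; rewrite (proj2 (feP i _ b') erefl) => -[]. Qed.

Lemma iter_e_inj i N : injective (iter N (e i)).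
Proof. by elim: N => [//|N IH] b b' /= /e_inj /IH. Qed.

Lemma wt_iter_e i N b : wt (iter N (e i) b) = vadd (wt b) (vscale N%:Z (alpha i)).
Proof.
elim: N => [|N IH] /=; first by case: (wt b) => x y; rewrite /vadd /= !mul0r !addr0.
by rewrite wt_e IH intS; case: (wt b) => x y; case: (i); rewrite /vadd /vscale /=; congr pair; ring.
Qed.

Lemma A_iter_e i N b : ld_off i (A i b) (A i (iter N (e i) b)) /\
  pcoef i (MV (iter N (e i) b)) = (pcoef i (MV b) + N)%N.
Proof.
elim: N => [|N [IH1 IH2]] /=; first by rewrite addn0.
have h := MV_e i (iter N (e i) b); split.
  exact: ld_off_trans IH1 (ld_incr_off h).
by rewrite addnS -IH2; case: h; rewrite -Up0E.
Qed.

Lemma p_e i b : pcoef i (MV (e i b)) = (pcoef i (MV b)).+1.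
Proof. by case: (MV_e i b); rewrite -Up0E. Qed.

Lemma d_ge0 i b : 0 <= d i b. Proof. exact: defi_ge0 (MV_dp b) (MV_mv b). Qed.

Lemma dE i b : d i b = (pcoef i (MV b))%:Z + (ncoef i (MV b))%:Z - coroot_pair t i (wt b).
Proof. by rewrite /defi MV_wt. Qed.

Lemma d_e i b : d i (e i b) = d i b - 1 + ((ncoef i (MV (e i b)))%:Z - (ncoef i (MV b))%:Z).
Proof. by rewrite !dE wt_e p_e coroot_pairD coroot_alpha; lia. Qed.

(** As long as the defect of e_i^N b is nonzero, the symmetric polytope over the same path bounds
    its opposite edge. With that edge bounded, the defect would become negative for large [N]. *)
Lemma d_iter_large i b : exists N0, forall N, (N0 <= N)%N -> d i (iter N (e i) b) = 0.
Proof.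
have [Q [Q1 Q2] hQ] := @sym_MV_exists t i (A i b) (partition_side i (MV_dp b)).
exists (`|((ncoef i Q)%:Z - coroot_pair t i (wt b) + (pcoef i (MV b))%:Z)%R|%N.+1) => N hN.
set x := iter N (e i) b; have [o ep] := A_iter_e i N b.
have oQ : ld_off i (A i x) (side i Q) by apply: ld_off_trans hQ; apply: ld_off_sym.
case: (ncoef_le (MV_dp x) (MV_mv x) Q1 Q2 oQ) => // hn.
have := d_ge0 i x; rewrite dE ep wt_iter_e coroot_pairD coroot_pairZ coroot_alpha.
lia.
Qed.

(** Symmetry transfers the datum to the other side except for its alpha_i-entry, which is determined
    by the weight and the vanishing of the defect. *)
Lemma d0_inj i b b' : d i b = 0 -> d i b' = 0 -> ld_eq (A i b) (A i b') -> b = b'.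
Proof.
move=> h h' hA.
have [s1 s2 s3] := defi0_sym (MV_dp b) (MV_mv b) h.
have [s1' s2' s3'] := defi0_sym (MV_dp b') (MV_mv b') h'.
have ew : wt b = wt b' by rewrite -(A_wt i b) -(A_wt i b') (ld_eq_wt t hA).
have ep : pcoef i (MV b) = pcoef i (MV b') by case: hA => a _; apply: a.
have en : ncoef i (MV b) = ncoef i (MV b').
  by move: h h'; rewrite !dE ep ew; lia.
have ho : ld_eq (A (other i) b) (A (other i) b').
  case: hA => a a'; apply: (@ld_eq_off i) => //; split; last by rewrite s3 s3' a'.
  move=> r hr; have [[|k] [er|er]] := preal_case i r; rewrite er in hr *.
  - by rewrite s2 s2' a.
  - by [].
  - by rewrite s2 s2' a.
  - by rewrite s1 s1' a.
by apply: MV_inj; case: (i) hA ho => hA ho [].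
Qed.

(** Apply e_i often enough to make both elements symmetric, then use that e_i is injective. *)
Lemma A_inj i b b' : ld_eq (A i b) (A i b') -> b = b'.
Proof.
move=> hA; have [N0 h0] := d_iter_large i b; have [N1 h1] := d_iter_large i b'.
pose N := maxn N0 N1; apply: (@iter_e_inj i N).
apply: (@d0_inj i); [by apply: h0; rewrite /N; lia|by apply: h1; rewrite /N; lia|].
have [o ep] := A_iter_e i N b; have [o' ep'] := A_iter_e i N b'.
apply: (@ld_eq_off i); last first.
  rewrite -!/(pcoef i _) ep ep'; congr (_ + _)%N; by case: hA => a _; apply: a.
exact: ld_off_trans (ld_off_sym o) (ld_off_trans (ld_eq_is_off i hA) o').
Qed.

(* The polytope description that [y = es i b] turns out to have. *)
Definition estar (i : node) (b y : B) : Prop :=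
  ld_incr (A (other i) b) (A (other i) y) (alpha_label i).

Lemma estar_fun i b y y' : estar i b y -> estar i b y' -> y = y'.
Proof. by move=> h h'; apply: (@A_inj (other i)); apply: ld_incr_det h h'. Qed.

(** The half-turn plays the part of Kashiwara's involution: conjugating e_i by it yields
    [estar i]. *)
Lemma swap_ex b : exists b', forall i, ld_eq (A i b') (A (other i) b).
Proof.
have [h1 h2] := swap_MV (MV_dp b) (MV_mv b); have [b' h] := MV_surj h1 h2.
by exists b' => i; rewrite -side_swap.
Qed.

Lemma estar_total i b : exists y, estar i b y.
Proof.
have [b' hb] := swap_ex b; have [y hy] := swap_ex (e i b').
exists y; apply: ld_incr_eq (MV_e i b'); first exact: hb.
by apply: ld_eq_sym; have := hy (other i); rewrite otherK.
Qed.

Lemma estar_wt i b y : estar i b y -> wt y = vadd (wt b) (alpha i).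
Proof. by move=> /(ld_incr_wt t); rewrite !A_wt. Qed.

Lemma estar_n i b y : estar i b y -> ncoef i (MV y) = (ncoef i (MV b)).+1.
Proof. by case; rewrite -Up0E. Qed.

Lemma estar_d i b y : estar i b y ->
  d i y = d i b - 1 + ((pcoef i (MV y))%:Z - (pcoef i (MV b))%:Z).
Proof. by move=> h; rewrite !dE (estar_wt h) (estar_n h) coroot_pairD coroot_alpha; lia. Qed.

Lemma gen_estar b : b = b0 \/ exists i y, estar i y b.
Proof.
have [b' hb] := swap_ex b; case: (gen_e b') => [eb|[i [c ec]]].
  left; have w : wt b = vzero.
    by rewrite -(A_wt (other Node0) b) -(ld_eq_wt t (hb Node0)) A_wt eb wt_b0.
  by case: HB => _ [_ [_ [h _]]]; apply: h.
right; have [y hy] := swap_ex c; exists i, y.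
apply: ld_incr_eq (MV_e i c); first by apply: ld_eq_sym; have := hy (other i); rewrite otherK.
by rewrite -ec; apply: hb.
Qed.

(** Both operators raise an entry of the same datum, at different simple roots. *)
Lemma estar_comm i j b y : i <> j -> estar i b y -> estar i (e j b) (e j y).
Proof.
move=> ne h; have ej : other i = j by case: (i) (j) ne => -[].
have a := MV_e j b; have a' := MV_e j y.
rewrite /estar ej in h *.
have [c1 [c2 c3]] := a; have [c1' [c2' c3']] := a'; have [c4 [c5 c6]] := h.
have nl : alpha_label i <> alpha_label j by case: (i) (j) ne => -[].
split; first by rewrite c2' // c4 c2.
split; last by rewrite c3' c6 c3.
move=> r hr; have [er|nr] : r = alpha_label j \/ r <> alpha_label j.
  case: r {hr} => k; case: (j) => /=; try (by right);
  by case: (eqVneq k 0%N) => [->|/eqP hk]; [left|right => -[]].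
  by rewrite er c1' c1 c5 //; exact: nesym.
by rewrite c2' // c5 // c2.
Qed.

(** Raising both alpha_i-entries gives an MV polytope by [defi0_incr], and [A_inj] identifies it as
    that of e_i b. *)
Lemma estar_d0 i b : d i b = 0 -> estar i b (e i b).
Proof.
move=> h; set c := ld_upd (Up i 0) (ncoef i (MV b)).+1 (A (other i) b).
have [q1 q2] := side_pair i (A i (e i b)) c.
have i1 : ld_incr (A i b) (side i (pair_of i (A i (e i b)) c)) (alpha_label i).
  by rewrite q1; apply: MV_e.
have i2 : ld_incr (A (other i) b) (side (other i) (pair_of i (A i (e i b)) c)) (alpha_label i).
  by rewrite q2; apply: ld_upd_incr.
have [m1 m2] := defi0_incr (MV_dp b) (MV_mv b) h i1 i2.
have [x hx] := MV_surj m1 m2.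
have ex : x = e i b by apply: (@A_inj i); rewrite -[X in ld_eq _ X]q1; apply: hx.
by rewrite -ex; apply: ld_incr_eq i2 => //; apply: ld_eq_sym.
Qed.

(** [ncoef_le] in both directions; should the defect of e_i b vanish, [d_e] supplies the missing
    inequality. *)
Lemma n_e i b : 1 <= d i b -> ncoef i (MV (e i b)) = ncoef i (MV b).
Proof.
move=> h; have o := ld_incr_off (MV_e i b).
have := ncoef_le (MV_dp b) (MV_mv b) (MV_dp (e i b)) (MV_mv (e i b)) o.
have := ncoef_le (MV_dp (e i b)) (MV_mv (e i b)) (MV_dp b) (MV_mv b) (ld_off_sym o).
by rewrite d_e; lia.
Qed.

Lemma p_estar i b y : estar i b y -> 1 <= d i b -> pcoef i (MV y) = pcoef i (MV b).
Proof.
move=> hy h; have o := ld_incr_off hy.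
have := pcoef_le (MV_dp b) (MV_mv b) (MV_dp y) (MV_mv y) o.
have := pcoef_le (MV_dp y) (MV_mv y) (MV_dp b) (MV_mv b) (ld_off_sym o).
by rewrite (estar_d hy); lia.
Qed.

Lemma estar_e i b y : estar i b y -> 2 <= d i b -> estar i (e i b) (e i y).
Proof.
move=> hy h; set c := ld_upd (Up i 0) (ncoef i (MV (e i b))).+1 (A (other i) (e i b)).
have [q1 q2] := side_pair i (A i (e i y)) c.
have i1 : ld_incr (A i y) (side i (pair_of i (A i (e i y)) c)) (alpha_label i).
  by rewrite q1; apply: MV_e.
have i2 : ld_incr (A (other i) (e i b)) (side (other i) (pair_of i (A i (e i y)) c)) (alpha_label i).
  by rewrite q2; apply: ld_upd_incr.
have n1 : 1 <= d i b by lia.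
have [m1 m2] := commute_MV (MV_dp b) (MV_mv b) (MV_dp (e i b)) (MV_mv (e i b))
  (MV_dp y) (MV_mv y) (MV_e i b) (n_e n1) hy (p_estar hy n1) h i1 i2.
have [x hx] := MV_surj m1 m2.
have ex : x = e i y by apply: (@A_inj i); rewrite -[X in ld_eq _ X]q1; apply: hx.
by rewrite -ex; apply: ld_incr_eq i2 => //; apply: ld_eq_sym.
Qed.

Lemma wt_ge0 b : 0 <= (wt b).1 /\ 0 <= (wt b).2.
Proof.
case: HB => -[_ [_ h]] _; have [s ->] := h b; elim: s => [|i s [h1 h2]] /=.
  by rewrite wt_b0.
by rewrite wt_e; case: i; rewrite /= ?addr0; split; lia.
Qed.

Definition height b : nat := `|((wt b).1 + (wt b).2)%R|%N.

Lemma heightS i b c : wt c = vadd (wt b) (alpha i) -> height c = (height b).+1.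
Proof. by move=> h; rewrite /height h; have := wt_ge0 b; case: (i) => /=; lia. Qed.

Lemma height_ind (P : B -> Prop) :
  (forall b, (forall c, (height c < height b)%N -> P c) -> P b) -> forall b, P b.
Proof.
move=> H b; have [n] := ubnP (height b); elim: n b => // n IH b hb.
by apply: H => c hc; apply: IH; lia.
Qed.

(** Write [b] as [estar j] of some [y]. A positive entry of [b] either comes from [y], where
    induction provides a factor e_i that can be moved in front, or is created by [estar i] at defect
    0, where [estar i] is e_i itself. Either way f_i would lower [b]. *)
Lemma f_none i b : f i b = None -> pcoef i (MV b) = 0%N.
Proof.
elim/height_ind: b i => b IH i hf.
have fe c : b <> e i c by move=> /esym /feP; rewrite hf.
case: (gen_estar b) => [eb|[j [y hy]]].
  by have [h _] := ld_wt0 (etrans (A_wt i b0) wt_b0); rewrite eb /pcoef h.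
have hh := heightS (estar_wt hy).
case: (posnP (pcoef i (MV y))) => [p0|pp].
  have [eji|ji] : j = i \/ j <> i by case: (i) (j) => -[]; (by left) || (by right).
    subst j; case: (ltP (d i y) 1) => h.
      have d0 : d i y = 0 by have := d_ge0 i y; lia.
      by case: (fe y); apply: estar_fun hy (estar_d0 d0).
    by rewrite (p_estar hy h).
  have ej : other j = i by case: (i) (j) ji => -[].
  rewrite /estar ej in hy; case: hy => _ [h _]; rewrite /pcoef h //.
  by rewrite Up0E; case: (i) (j) ji => -[].
case ey: (f i y) => [y'|]; last by rewrite (IH y _ i ey) ?hh in pp; [|lia].
move/feP: ey => ey; subst y.
have [x hx] := estar_total j y'.
have [eji|ji] : j = i \/ j <> i by case: (i) (j) => -[]; (by left) || (by right).
  subst j; case: (ltP (d i y') 2) => h; last first.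
    by case: (fe x); apply: estar_fun hy (estar_e hx h).
  (* For a defect of at most 1, e_i leads to defect 0, where [estar i] agrees with e_i. *)
  have d1 : d i (e i y') = 0.
    have := d_ge0 i y'; case: (ltP (d i y') 1) => h1 h2.
      have d0 : d i y' = 0 by lia.
      by have := estar_n (estar_d0 d0); rewrite d_e; lia.
    by rewrite d_e (n_e h1); lia.
  by case: (fe (e i y')); apply: estar_fun hy (estar_d0 d1).
by case: (fe x); apply: estar_fun hy (estar_comm ji hx).
Qed.

(** [f_none] seen through the half-turn. *)
Lemma estar_n0 i b : (0 < ncoef i (MV b))%N -> exists y, estar i y b.
Proof.
move=> n0; have [b' hb] := swap_ex b.
have pb : pcoef i (MV b') = ncoef i (MV b) by case: (hb i) => h _; apply: h.
case ef: (f i b') => [c|]; last by rewrite -pb (f_none ef) in n0.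
move/feP: ef => ef; have [y hy] := swap_ex c; exists y.
apply: ld_incr_eq (MV_e i c); first by apply: ld_eq_sym; have := hy (other i); rewrite otherK.
by rewrite ef; apply: hb.
Qed.

Lemma iter_opt_Sr (T : Type) (g : T -> option T) n x :
  iter_opt g n.+1 x = obind (iter_opt g n) (g x).
Proof. by elim: n => [|n IH] /=; [case: (g x)|rewrite -/(iter_opt g n.+1 x) IH /=; case: (g x)]. Qed.

(** The domain [D] is there for the induction in [estar_es], where the counting is known only up to
    a given height. *)
Lemma phi_count (T : Type) (g : T -> option T) (D : T -> Prop) (cnt : T -> nat) :
  (forall x y, D x -> g x = Some y -> D y /\ cnt x = (cnt y).+1) ->
  (forall x, D x -> g x = None -> cnt x = 0%N) ->
  forall x, D x -> phi_is g x (cnt x).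
Proof.
move=> h1 h0 x; move En : (cnt x) => n; elim: n x En => [|n IH] x en Dx.
  by split => //=; case eg : (g x) => [y|] //; have [_] := h1 x y Dx eg; rewrite en.
case eg : (g x) => [y|]; last by rewrite (h0 x Dx eg) in en.
have [Dy cy] := h1 x y Dx eg; have [a b] := IH y (succn_inj (etrans (esym cy) en)) Dy.
by split; rewrite iter_opt_Sr eg.
Qed.

Lemma phi_unique (T : Type) (g : T -> option T) x n m : phi_is g x n -> phi_is g x m -> n = m.
Proof.
have stop k l : iter_opt g k x = None -> (k <= l)%N -> iter_opt g l x = None.
  move=> h; elim: l => [|l IH]; first by rewrite leqn0 => /eqP e0; rewrite -e0.
  by rewrite leq_eqVlt => /orP[/eqP<- //|/IH /= ->].
move=> [a b] [a' b']; case: (ltngtP n m) => // h.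
- by case: a'; apply: stop b h.
- by case: a; apply: stop b' h.
Qed.

Lemma phi_f i b : phi_is (f i) b (pcoef i (MV b)).
Proof.
apply: (@phi_count _ _ (fun=> True) (fun x => pcoef i (MV x))) => // [x y _ /feP <-|x _ /f_none //].
by rewrite p_e.
Qed.

(* Both starred operators obey the same recursion along the generators [e]. *)
Lemma estar_es i b : estar i b (es i b).
Proof.
elim/height_ind: b i => b IH i.
(* An element of height at most that of [b] is lowered to one of smaller height, where the induction
   hypothesis holds; so phi_i^star is already known to be [ncoef] wherever the axioms are invoked
   below. *)
have ph c : (height c <= height b)%N -> phi_is (fs i) c (ncoef i (MV c)).
  move=> hc; apply: (@phi_count _ _ (fun x => (height x <= height b)%N) (fun x => ncoef i (MV x))) => // [x y hx|x hx hf].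
    move=> /fesP ex; have hy := heightS (wt_es i y); rewrite ex in hy.
    split; first by lia.
    by have := IH y ltac:(lia) i; rewrite ex => /estar_n.
  case: (posnP (ncoef i (MV x))) => // /estar_n0 [y hy].
  have hh := heightS (estar_wt hy).
  have /fesP := estar_fun (IH y ltac:(lia) i) hy; by rewrite hf.
have ax c : (height c <= height b)%N ->
    (d i c = 0 -> e i c = es i c) /\ (2 <= d i c -> e i (es i c) = es i (e i c)).
  move=> hc; case: HB => _ [_ [_ [_ [_ h]]]].
  by have /= := h i c _ _ (phi_f i c) (ph c hc); rewrite -dE => -[_ [a [_ b1]]].
case: (ltP (d i b) 1) => hd.
  have d0 : d i b = 0 by have := d_ge0 i b; lia.
  by have [<- // _] := ax b (leqnn _); apply: estar_d0.
case: (gen_e b) => [eb|[j [c eb]]].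
  have [h _] := ld_wt0 (etrans (A_wt i b0) wt_b0).
  have [h' _] := ld_wt0 (etrans (A_wt (other i) b0) wt_b0).
  by move: hd; rewrite dE /pcoef /ncoef eb h h' wt_b0 /coroot_pair /= !mulr0.
subst b; have hh := heightS (wt_e j c).
have [eji|ji] : j = i \/ i <> j by case: (i) (j) => -[]; (by left) || (by right).
  (* e_i lowers a positive defect by one and preserves defect 0. *)
  subst j; have d2 : 2 <= d i c.
    case: (ltP (d i c) 1) => h1; last by move: hd; rewrite d_e (n_e h1); lia.
    have d0 : d i c = 0 by have := d_ge0 i c; lia.
    by move: hd; rewrite d_e (estar_n (estar_d0 d0)); lia.
  have [_ <- //] := ax c ltac:(lia).
  by apply: estar_e => //; apply: IH; lia.
have -> : es i (e j c) = e j (es i c) by case: HB => _ [_ [_ [_ [h _]]]]; apply: h.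
by apply: estar_comm => //; apply: IH; lia.
Qed.

Lemma fs_none i b : fs i b = None -> ncoef i (MV b) = 0%N.
Proof.
move=> hf; case: (posnP (ncoef i (MV b))) => // /estar_n0 [y hy].
by have /fesP := estar_fun (estar_es i y) hy; rewrite hf.
Qed.

Lemma phi_fs i b : phi_is (fs i) b (ncoef i (MV b)).
Proof.
apply: (@phi_count _ _ (fun=> True) (fun x => ncoef i (MV x))) => // [x y _ /fesP <-|x _ /fs_none //].
by rewrite (estar_n (estar_es i y)).
Qed.

(** * Defects along strings, and Saito reflections *)

Lemma d_e_pred i b : d i (e i b) = if d i b == 0 then 0 else d i b - 1.
Proof.
case: eqP => h; first by rewrite d_e (estar_n (estar_d0 h)); lia.
by rewrite d_e n_e; have := d_ge0 i b; lia.
Qed.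

Lemma d_es_pred i b : d i (es i b) = if d i b == 0 then 0 else d i b - 1.
Proof.
case: eqP => h; last by rewrite (estar_d (estar_es i b)) (p_estar (estar_es i b)); have := d_ge0 i b; lia.
have -> : es i b = e i b by apply: estar_fun (estar_es i b) (estar_d0 h).
by rewrite d_e_pred h eqxx.
Qed.

Lemma d_iter0 i (g : B -> B) N b :
  (forall c, d i (g c) = if d i c == 0 then 0 else d i c - 1) ->
  d i b <= N%:Z -> d i (iter N g b) = 0.
Proof.
move=> h hN; suff : d i (iter N g b) <= 0 by have := d_ge0 i (iter N g b); lia.
have : d i (iter N g b) = 0 \/ d i (iter N g b) = d i b - N%:Z; last by lia.
elim: N {hN} => [|N IH]; first by right; rewrite /= subr0.
by rewrite /= h; case: eqP => h0; [left|right]; lia.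
Qed.

Lemma es_iter_off i N b : ld_off i (A (other i) b) (A (other i) (iter N (es i) b)).
Proof.
elim: N => [|N IH] //=; apply: ld_off_trans IH _.
exact: ld_incr_off (estar_es i _).
Qed.

Lemma f_iter_off i m x s : iter_opt (f i) m x = Some s -> ld_off i (A i x) (A i s).
Proof.
elim: m s => [|m IH] s /=; first by case=> ->.
case h : (iter_opt (f i) m x) => [y|] //= /feP ey.
by apply: ld_off_trans (IH _ h) _; apply: ld_off_sym; rewrite -ey; apply: ld_incr_off (MV_e i s).
Qed.

Lemma fs_iter_off i m x s : iter_opt (fs i) m x = Some s ->
  ld_off i (A (other i) x) (A (other i) s).
Proof.
elim: m s => [|m IH] s /=; first by case=> ->.
case h : (iter_opt (fs i) m x) => [y|] //= /fesP ey.
by apply: ld_off_trans (IH _ h) _; apply: ld_off_sym; rewrite -ey; apply: ld_incr_off (estar_es i s).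
Qed.

(** When phi_i(b) = 0, the defect of [b] is eps_i^star(b), so e_i^N b is symmetric. Lowering by
    f_i^star afterwards changes only the alpha_i-entry of the opposite datum. *)
Lemma sigma_sym i b s : f i b = None -> is_sigma t wt e fs i b s ->
  sym_data i (A i b) (A (other i) s) /\ ncoef i (MV s) = 0%N.
Proof.
move=> hf [ns [N [h1 [h2 [m [h3 h4]]]]]].
have ens := phi_unique h1 (phi_fs i b); subst ns.
set x := iter N (e i) b in h3.
have d0 : d i x = 0 by apply: d_iter0 (d_e_pred i) _; rewrite dE (f_none hf); lia.
have [s1 s2 s3] := defi0_sym (MV_dp x) (MV_mv x) d0.
have [[o1 o2] _] := A_iter_e i N b; have [q1 q2] := fs_iter_off h3.
split; last exact: fs_none.
split=> [k|k|].
- by rewrite q1 ?s1 ?o1 //; [apply: LoUp|move/Up_inj].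
- by rewrite q1 ?s2 ?o1 //; [move/Up_inj|apply: LoUp].
- by rewrite q2 s3 o2.
Qed.

Lemma sigma_star_sym i b s : fs i b = None -> is_sigma_star t wt es f i b s ->
  sym_data i (A (other i) b) (A i s) /\ pcoef i (MV s) = 0%N.
Proof.
move=> hf [ns [N [h1 [h2 [m [h3 h4]]]]]].
have ens := phi_unique h1 (phi_f i b); subst ns.
set x := iter N (es i) b in h3.
have d0 : d i x = 0 by apply: d_iter0 (d_es_pred i) _; rewrite dE (fs_none hf); lia.
have [s1 s2 s3] := defi0_sym (MV_dp x) (MV_mv x) d0.
have [o1 o2] := es_iter_off i N b; have [q1 q2] := f_iter_off h3.
split; last exact: f_none.
split=> [k|k|].
- by rewrite q1 -?s2 ?o1 //; [apply: LoUp|move/Up_inj].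
- by rewrite q1 -?s1 ?o1 //; [move/Up_inj|apply: LoUp].
- by rewrite q2 -s3 o2.
Qed.

End Crystal.

(** * Simple reflections on the labelled roots *)

Lemma root_vec_node t i k :
  [/\ ncx t i (root_vec t (Lo i k)) = root_scale t (Lo i k) * k%:R,
      ncy t i (root_vec t (Lo i k)) = root_scale t (Lo i k) * k.+1%:R,
      ncx t i (root_vec t (Up i k)) = root_scale t (Up i k) * k.+1%:R &
      ncy t i (root_vec t (Up i k)) = root_scale t (Up i k) * k%:R].
Proof. by have [a b c d] := root_vecE t k; case: i; split. Qed.

Lemma ncxy_inj t i u v : ncx t i u = ncx t i v -> ncy t i u = ncy t i v -> u = v.
Proof. by case: i => h1 h2; apply: (@vec_eqP t). Qed.

(** The rescaled coordinates of a root differ by its scale, with a sign that tells [Blo] from [Bup];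
    the smaller coordinate divided by the scale is the index. *)
Lemma root_vec_inj t : injective (root_vec t).
Proof.
move=> r r' h; have hx : cx (root_vec t r) = cx (root_vec t r') by rewrite h.
have hy : cy t (root_vec t r) = cy t (root_vec t r') by rewrite h.
have p := root_scale_gt0 t r; have p' := root_scale_gt0 t r'.
have [[x1 y1 _ _] [_ _ x2 y2]] := (root_vecE t (match r with Blo k => k | Bup k => k end),
  root_vecE t (match r with Blo k => k | Bup k => k end)).
have [[x1' y1' _ _] [_ _ x2' y2']] := (root_vecE t (match r' with Blo k => k | Bup k => k end),
  root_vecE t (match r' with Blo k => k | Bup k => k end)).
have inj (k k' : nat) (s : rat) : 0 < s -> s * k%:R = s * k'%:R -> k = k'.
  move=> s0 /(mulfI (lt0r_neq0 s0)) => e; apply/eqP; by rewrite -(eqr_nat rat) e.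
have dif (s s' a b : rat) : s * a = s' * b -> s * (a + 1) = s' * (b + 1) -> s = s'.
  by lra.
have abs (s s' a b : rat) : 0 < s -> 0 < s' -> s * a = s' * (b + 1) -> s * (a + 1) = s' * b -> False.
  by lra.
case: r r' hx hy p p' x1 y1 x2 y2 x1' y1' x2' y2' {h} => k [] k' /= hx hy p p' x1 y1 x2 y2 x1' y1' x2' y2'.
- rewrite x1 x1' in hx; rewrite y1 y1' -!natr1 in hy.
  have es := dif _ _ _ _ hx hy.
  by congr Blo; apply: (inj _ _ _ p); rewrite hx es.
- by rewrite x1 x2' -!natr1 in hx; rewrite y1 y2' -!natr1 in hy; case: (abs _ _ _ _ p p' hx hy).
- by rewrite x2 x1' -!natr1 in hx; rewrite y2 y1' -!natr1 in hy; case: (abs _ _ _ _ p p' hy hx).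
- rewrite x2 x2' -!natr1 in hx; rewrite y2 y2' in hy.
  have es := dif _ _ _ _ hy hx.
  by congr Bup; apply: (inj _ _ _ p); rewrite hy es.
Qed.

Lemma ncx_sref t i v : ncx t i (sref t i v) = 2 * ncy t i v - ncx t i v /\
  ncy t i (sref t i v) = ncy t i v.
Proof.
have co := corootE t i v.
have al : ncx t i (alpha i) = scale1 t i /\ ncy t i (alpha i) = 0.
  by case: (i); case: (t).
case: al => al1 al2; rewrite /sref; case: (i) al1 al2 co; rewrite /ncx /ncy => al1 al2 co;
by rewrite cxB cyB cxZ cyZ al1 al2; split; lra.
Qed.

Lemma sref_Lo t i k : sref t i (root_vec t (Lo i k)) = root_vec t (Up i k.+1).
Proof.
have [a b _ _] := root_vec_node t i k; have [_ _ c d] := root_vec_node t i k.+1.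
have [h1 h2] := ncx_sref t i (root_vec t (Lo i k)).
apply: (@ncxy_inj t i); rewrite ?h1 ?h2 ?a ?b ?c ?d root_scaleS //.
by rewrite -(natr1 k.+1) -(natr1 k); ring.
Qed.

Lemma sref_Up t i k : sref t i (root_vec t (Up i k.+1)) = root_vec t (Lo i k).
Proof.
have [a b _ _] := root_vec_node t i k; have [_ _ c d] := root_vec_node t i k.+1.
have [h1 h2] := ncx_sref t i (root_vec t (Up i k.+1)).
apply: (@ncxy_inj t i); rewrite ?h1 ?h2 ?c ?d ?a ?b root_scaleS //.
by rewrite -(natr1 k.+1) -(natr1 k); ring.
Qed.

Lemma reflectedP t i c c' : reflected t i c c' <->
  [/\ coef c (Up i 0) = 0%N, coef c' (Up i 0) = 0%N & sym_data i c c'].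
Proof.
rewrite /reflected -Up0E; split=> [[h1 [h2 [h3 h4]]]|[h1 h2 [s1 s2 s3]]].
  split => //; split => // k; apply: h3; rewrite ?sref_Lo ?sref_Up //; try exact: LoUp.
  by move/Up_inj.
split => //; split => //; split => // r r' hr.
have [[|k] [er|er]] := preal_case i r; rewrite er in hr *.
- by rewrite sref_Lo => /root_vec_inj ->.
- by [].
- by rewrite sref_Lo => /root_vec_inj ->.
- by rewrite sref_Up => /root_vec_inj ->.
Qed.

(** * The MV polytopes satisfy the conditions *)

Section Conditions.
Variables (t : gtype) (B : Type) (b0 : B) (wt : B -> vec)
  (e : node -> B -> B) (f : node -> B -> option B)
  (es : node -> B -> B) (fs : node -> B -> option B) (MV : B -> dpwp).
Hypotheses (HB : is_Binf t b0 wt e f es fs) (HMV : mv_crystal_iso t wt e MV).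

(** The given left datum and the prescribed right datum form an MV polytope; by [A_inj] it is the
    one of [b]. *)
Lemma MV_cond_I : cond_I t MV.
Proof.
move=> b c0 lne lam l1.
have l1in : l1 \in lam by apply: largest_part_mem.
have part : is_partition lam by exact: (partition_side Node1 (MV_dp HMV b)).
have l1pos : (0 < l1)%N by case/andP: part => _ /allP; apply.
pose c := LD [:: (norm_ratio t * l1)%N] [:: l1] (rem l1 lam).
pose P := DP (cl (MV b)) c.
pose K := maxn (ld_size (cl (MV b))) 2.
have sl : sized K (cl P) by apply: ld_size_sized; rewrite /K leq_maxl.
have sr : sized K (cr P) by apply: ld_size_sized; rewrite /K leq_maxr.
have part' : is_partition (rem l1 lam).
  case/andP: part => o a; apply/andP; split.
    apply: subseq_sorted (rem_subseq _ _) o => x y z h1 h2; exact: leq_trans h2 h1.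
  by apply/allP => x /mem_rem; apply: (allP a).
have z r : scoef t (cl (MV b)) r = 0 by rewrite /scoef c0 mulr0.
have zl k : wlo (lb (quad_of t P)) k = 0 /\ whi (lb (quad_of t P)) k = 0.
  by split; apply: big1 => j _; rewrite /= z mul0r.
have zt k : wlo (lt (quad_of t P)) k = 0 /\ whi (lt (quad_of t P)) k = 0.
  by split; apply: big1 => j _; rewrite /= z mul0r.
(* In type A_2^(2) the factor [norm_ratio] cancels the scale 1/2 of alpha_1. *)
have rb0 : rb (quad_of t P) 0%N = l1%:R.
  by rewrite /= /scoef /=; case: (t) => /=; rewrite ?mul1n ?mul1r // natrM; field.
have rt0 : rt (quad_of t P) 0%N = l1%:R.
  by rewrite /= /scoef /=; case: (t) => /=; rewrite mul1r.
have rbS k : rb (quad_of t P) k.+1 = 0 by rewrite /= /scoef /= nth_nil mulr0.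
have rtS k : rt (quad_of t P) k.+1 = 0 by rewrite /= /scoef /= nth_nil mulr0.
have w (a : nat -> rat) x k : a 0%N = x -> (forall k, a k.+1 = 0) ->
    wlo a k.+1 = 0 /\ whi a k.+1 = x.
  move=> a0 aS; rewrite /wlo /whi !big_ord_recl mulr0 a0 mulr1.
  by rewrite !big1 ?addr0 // => j _; rewrite aS mul0r.
have l0 : 0 <= l1%:R :> rat by [].
have q : quad_MV K (quad_of t P).
  have [K' eK] : exists K', K = K'.+1 by exists K.-1; rewrite /K; lia.
  split.
  - move=> [|k] // _; rewrite /cslack; have [_ ->] := w _ _ k rb0 rbS.
    have [-> _] := w _ _ k.+1 rb0 rbS; have [_ ->] := zl k.+1; have [-> _] := zl k.+2.
    by split; rewrite ?subr0 //; right.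
  - move=> [|k] // _; rewrite /cslack; have [_ ->] := w _ _ k rt0 rtS.
    have [-> _] := w _ _ k.+1 rt0 rtS; have [_ ->] := zt k.+1; have [-> _] := zt k.+2.
    by split; rewrite ?subr0 //; right.
  - rewrite eK; have [-> _] := w _ _ K' rb0 rbS; have [_ ->] := w _ _ K' rt0 rtS.
    have [_ ->] := zl K'.+1; have [-> _] := zt K'.+1.
    by rewrite /= -/lam (sumn_rem l1in) natrD; ring.
  - rewrite eK; have [_ ->] := w _ _ K' rb0 rbS; have [-> _] := w _ _ K' rt0 rtS.
    have [-> _] := zl K'.+1; have [_ ->] := zt K'.+1.
    by rewrite /= -/lam (sumn_rem l1in) natrD; ring.
  have -> : \sum_(j < K) (rb (quad_of t P) j + lb (quad_of t P) j) = l1%:R.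
    rewrite eK big_ord_recl rb0 big1 ?addr0 => [|j _]; first by rewrite /= z addr0.
    by rewrite rbS /= z addr0.
  split => /=.
  - by move=> k /mem_rem hk; rewrite ler_nat; apply: largest_part_max.
  - by move=> k hk; rewrite ler_nat; apply: largest_part_max.
  - by rewrite -/lam (sumn_rem l1in); lia.
  - by move=> _; exists l1 => //; right.
have [m1 m2] := quad_MV_is_MV sl sr part part' q.
have [x hx] := MV_surj HMV m1 m2.
have ex : x = b by apply: (A_inj HB HMV (i := Node1)); exact: (hx Node1).
have [h1 h2] := hx Node0; rewrite ex in h1 h2.
split; first exact: h1.
split; first exact: h1.
split; first exact: h2.
move=> [[|k]|[|k]] n0 n1; rewrite h1 //=; rewrite nth_nil //.
Qed.

Lemma MV_conditions : conditions t wt e es f fs MV.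
Proof.
have C i b : ld_incr (side (other i) (MV b)) (side (other i) (MV (es i b))) (alpha_label i).
  exact: (estar_es HB HMV).
have S i b s : f i b = None -> is_sigma t wt e fs i b s ->
    reflected t i (side i (MV b)) (side (other i) (MV s)).
  move=> hf hs; have [h1 h2] := sigma_sym HB HMV hf hs.
  by apply/reflectedP; split => //; exact: (f_none HB HMV hf).
have S' i b s : fs i b = None -> is_sigma_star t wt es f i b s ->
    reflected t i (side (other i) (MV b)) (side i (MV s)).
  move=> hf hs; have [h1 h2] := sigma_star_sym HB HMV hf hs.
  by apply/reflectedP; split => //; exact: (fs_none HB HMV hf).
split; first exact: (MV_dp HMV).
split; first by move=> b; rewrite (MV_wt HMV).
split; first exact: (MV_e HMV Node0).
split; first exact: (MV_e HMV Node1).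
split; first exact: (C Node0).
split; first exact: (C Node1).
split; first exact: (S Node0).
split; first exact: (S Node1).
split; first exact: (S' Node0).
split; first exact: (S' Node1).
exact: MV_cond_I.
Qed.

End Conditions.

Lemma sym_data_wt t i c c' : coef c (Up i 0) = 0%N -> coef c' (Up i 0) = 0%N ->
  sym_data i c c' ->
  ld_wt t c' = vsub (ld_wt t c) (vscale (coroot_pair t i (ld_wt t c)) (alpha i)).
Proof.
move=> c0 c0' [s1 s2 s3]; rewrite -refl_ld_wt //; apply: ld_eq_wt.
have [r1 r2 r3 r4] := refl_ldE i 0 c; split; last by rewrite s3 r4.
move=> r; have [[|k] [er|er]] := preal_case i r; rewrite er.
- by rewrite s2 r3.
- by rewrite c0' r1.
- by rewrite s2 r3.
- by rewrite s1 r2.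
Qed.

(** The alpha_i-entry is known to be 0, so reflection loses nothing. This carries agreement at a
    Saito reflection of [b] back to [b]. *)
Lemma reflected_inj t i c1 c2 d1 d2 : reflected t i c1 d1 -> reflected t i c2 d2 ->
  ld_eq d1 d2 -> ld_eq c1 c2.
Proof.
move=> /reflectedP [a1 _ [s1 s2 s3]] /reflectedP [a2 _ [u1 u2 u3]] [h e].
split; last by rewrite -s3 -u3.
move=> r; have [[|k] [er|er]] := preal_case i r; rewrite er.
- by rewrite -s1 -u1.
- by rewrite a1 a2.
- by rewrite -s1 -u1.
- by rewrite -s2 -u2.
Qed.

Lemma coef_zero_or_pos c : (forall r, coef c r = 0%N) \/ exists r, (0 < coef c r)%N.
Proof.
have z (l : seq nat) : (forall k, nth 0%N l k = 0%N) \/ exists k, (0 < nth 0%N l k)%N.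
  case: (hasP (a := fun x : nat => (0 < x)%N) (s := l)) => [[x /(nthP 0%N) [k _ <-] hx]|h].
    by right; exists k.
  left=> k; case: (ltnP k (size l)) => hk; last by rewrite nth_default.
  by case: (posnP (nth 0%N l k)) => // hx; case: h; exists (nth 0%N l k); rewrite ?mem_nth.
case: (z (clo c)) => [h1|[k hk]]; last by right; exists (Blo k).
case: (z (cup c)) => [h2|[k hk]]; last by right; exists (Bup k).
by left => -[] k; [exact: h1|exact: h2].
Qed.

Lemma partition_sumn0 l : is_partition l -> sumn l = 0%N -> l = [::].
Proof. by case: l => // a l /andP[_ /= /andP[a0 _]]; lia. Qed.

Lemma pure_wt t c : (forall r, coef c r = 0%N) -> cx (ld_wt t c) = (sumn (cdel c))%:R.
Proof.
move=> h; have [-> _] := ld_wtE t (ld_size_sized (leqnn (ld_size c))).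
by rewrite /wlo /whi !big1 ?addr0 ?add0r // => j _; rewrite /scoef h mulr0 mul0r.
Qed.

(** A positive combination of the two simple coroots, the canonical central element, vanishes on the
    root lattice. *)
Lemma null_weight t (v : vec) i : coroot_pair t i v <= 0 ->
  coroot_pair t (other i) v <= 0 -> coroot_pair t i v = 0 /\ coroot_pair t (other i) v = 0.
Proof.
have [e1 e2] : cartan t Node0 Node0 = 2 /\ cartan t Node1 Node1 = 2 by case: (t).
have e4 : cartan t Node0 Node1 = if t is Sl2hat then -2 else -1 by case: (t).
have e5 : cartan t Node1 Node0 = if t is Sl2hat then -2 else -4 by case: (t).
by case: i; rewrite /coroot_pair /= ?e1 ?e2 ?e4 ?e5; case: (t) => /=; lia.
Qed.

(** * Uniqueness *)

Section Uniqueness.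
Variables (t : gtype) (B : Type) (b0 : B) (wt : B -> vec)
  (e : node -> B -> B) (f : node -> B -> option B)
  (es : node -> B -> B) (fs : node -> B -> option B) (MV : B -> dpwp).
Hypotheses (HB : is_Binf t b0 wt e f es fs) (HMV : mv_crystal_iso t wt e MV).

(** The conditions regrouped by node, so that one argument serves both nodes. *)
Record node_conditions (X : B -> dpwp) : Prop := NodeConditions {
  nc_dp : forall b, is_dpwp t (X b);
  nc_wt : forall i b, ld_wt t (side i (X b)) = wt b;
  nc_e : forall i b, ld_incr (side i (X b)) (side i (X (e i b))) (alpha_label i);
  nc_es : forall i b,
    ld_incr (side (other i) (X b)) (side (other i) (X (es i b))) (alpha_label i);
  nc_sigma : forall i b s, f i b = None -> is_sigma t wt e fs i b s ->
    reflected t i (side i (X b)) (side (other i) (X s));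
  nc_sigma_star : forall i b s, fs i b = None -> is_sigma_star t wt es f i b s ->
    reflected t i (side (other i) (X b)) (side i (X s));
  nc_imag : cond_I t X }.

Lemma node_conditionsP X : conditions t wt e es f fs X -> node_conditions X.
Proof.
case=> [dp [W [C1 [C2 [C3 [C4 [S1 [S2 [S3 [S4 I]]]]]]]]]]; split => //.
- by move=> i b; rewrite W; case: (pw_wtE i (dp b)).
- by case; [exact: C1|exact: C2].
- by case; [exact: C3|exact: C4].
- by case; [exact: S1|exact: S2].
- by case; [exact: S3|exact: S4].
Qed.

Lemma phi_gmax (g : B -> option B) x n : phi_is g x n -> exists s, gmax_is g x s.
Proof.
move=> [a b]; case h : (iter_opt g n x) a b => [s|] // _ /= hs.
by exists s, n; split => //; move: hs; rewrite h.
Qed.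

Lemma sigma_exists i b : exists s, is_sigma t wt e fs i b s.
Proof.
pose N := `|((ncoef i (MV b))%:Z - coroot_pair t i (wt b))%R|%N.
have [s hs] := phi_gmax (phi_fs HB HMV i (iter N (e i) b)).
by exists s, (ncoef i (MV b)), N; split; [exact: (phi_fs HB HMV)|split => //; rewrite /N; lia].
Qed.

Lemma sigma_star_exists i b : exists s, is_sigma_star t wt es f i b s.
Proof.
pose N := `|((pcoef i (MV b))%:Z - coroot_pair t i (wt b))%R|%N.
have [s hs] := phi_gmax (phi_f HB HMV i (iter N (es i) b)).
by exists s, (pcoef i (MV b)), N; split; [exact: (phi_f HB HMV)|split => //; rewrite /N; lia].
Qed.

Notation ht := (height wt).

Lemma reflected_wt X i j j' b s : node_conditions X ->
  reflected t i (side j (X b)) (side j' (X s)) ->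
  wt s = vsub (wt b) (vscale (coroot_pair t i (wt b)) (alpha i)).
Proof.
move=> H /reflectedP [h1 h2 h3]; rewrite -(nc_wt H j b) -(nc_wt H j' s).
exact: sym_data_wt.
Qed.

Lemma reflected_height i b s :
  wt s = vsub (wt b) (vscale (coroot_pair t i (wt b)) (alpha i)) ->
  0 < coroot_pair t i (wt b) -> (ht s < ht b)%N.
Proof.
move=> h; rewrite /height; have := wt_ge0 HB s; have := wt_ge0 HB b; rewrite h.
by case: (i) => /=; lia.
Qed.

Variable P : B -> dpwp.
Hypothesis HP : node_conditions P.
Let HM : node_conditions MV := node_conditionsP (MV_conditions HB HMV).

Section Height.
Variable w : nat.
Hypothesis IH : forall c, (ht c < w)%N -> forall i, ld_eq (side i (P c)) (side i (MV c)).

Lemma agree_f i b c : (ht b <= w)%N -> f i b = Some c ->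
  ld_eq (side i (P b)) (side i (MV b)).
Proof.
move=> hw /(feP HB) eb; subst b; have hh := heightS HB (wt_e HB i c).
apply: ld_incr_det (nc_e HM i c); apply: ld_incr_eq (nc_e HP i c) => //.
by apply: IH; lia.
Qed.

Lemma agree_fs i b c : (ht b <= w)%N -> fs i b = Some c ->
  ld_eq (side (other i) (P b)) (side (other i) (MV b)).
Proof.
move=> hw /(fesP HB) eb; subst b; have hh := heightS HB (wt_es HB i c).
apply: ld_incr_det (nc_es HM i c); apply: ld_incr_eq (nc_es HP i c) => //.
by apply: IH; lia.
Qed.

(** Either an operator lowers [b], or the Saito reflection has weight s_i(wt b), hence smaller
    height. The unstarred operators handle side [i], the starred ones the other side. *)
Lemma agree_pos i b : (ht b <= w)%N -> 0 < coroot_pair t i (wt b) ->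
  ld_eq (side i (P b)) (side i (MV b)) /\
  ld_eq (side (other i) (P b)) (side (other i) (MV b)).
Proof.
move=> hw hc; split.
  case hf : (f i b) => [c|]; first exact: agree_f hw hf.
  have [s hs] := sigma_exists i b.
  have r1 := nc_sigma HP hf hs; have r2 := nc_sigma HM hf hs.
  apply: (reflected_inj r1 r2); apply: IH.
  by have := reflected_height (reflected_wt HM r2) hc; lia.
case hf : (fs i b) => [c|]; first exact: agree_fs hw hf.
have [s hs] := sigma_star_exists i b.
have r1 := nc_sigma_star HP hf hs; have r2 := nc_sigma_star HM hf hs.
apply: (reflected_inj r1 r2); apply: IH.
by have := reflected_height (reflected_wt HM r2) hc; lia.
Qed.

(** From here on both simple reflections fix the weight, so Saito reflections keep the height.
    Another measure replaces it: the index of a root with nonzero coefficient. *)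
Variable v : vec.
Hypothesis v0 : forall i, coroot_pair t i v = 0.
Hypothesis hv : forall b, wt b = v -> (ht b <= w)%N.

Lemma null_reflected X i j j' b s : node_conditions X ->
  reflected t i (side j (X b)) (side j' (X s)) -> wt b = v -> wt s = v.
Proof.
move=> H /(reflected_wt H) -> ->; rewrite v0; case: (v) => x y.
by rewrite /vsub /vscale /= !mul0r !subr0.
Qed.

(** The starred reflection at the other node moves the entry [Lo i m.+1] to [Lo (other i) m] on the
    other side. At index 0 the entry belongs to a simple root and vanishes if the operator does not
    apply. *)
Lemma agree_lo m i b : wt b = v ->
  (0 < coef (side i (P b)) (Lo i m))%N \/ (0 < coef (side i (MV b)) (Lo i m))%N ->
  ld_eq (side i (P b)) (side i (MV b)).
Proof.
elim: m i b => [|m IHm] i b hb hpos;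
case hf : (fs (other i) b) => [c|];
  try (by have := agree_fs (hv hb) hf; rewrite otherK);
have [s hs] := sigma_star_exists (other i) b;
have r1 := nc_sigma_star HP hf hs; have r2 := nc_sigma_star HM hf hs;
rewrite otherK in r1 r2; rewrite -Up_other in hpos.
  move/reflectedP: r1 => [z1 _ _]; move/reflectedP: r2 => [z2 _ _].
  by rewrite z1 z2 in hpos; case: hpos.
apply: (reflected_inj r1 r2); apply: IHm; first exact: null_reflected r2 hb.
move/reflectedP: r1 => [_ _ [_ z1 _]]; move/reflectedP: r2 => [_ _ [_ z2 _]].
by rewrite z1 z2.
Qed.

(** The same descent with the unstarred reflection at [i], which moves [Up i m.+1] to
    [Up (other i) m] on the other side. *)
Lemma agree_up m i b : wt b = v ->
  (0 < coef (side i (P b)) (Up i m))%N \/ (0 < coef (side i (MV b)) (Up i m))%N ->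
  ld_eq (side i (P b)) (side i (MV b)).
Proof.
elim: m i b => [|m IHm] i b hb hpos;
case hf : (f i b) => [c|]; try exact: agree_f (hv hb) hf;
have [s hs] := sigma_exists i b;
have r1 := nc_sigma HP hf hs; have r2 := nc_sigma HM hf hs.
  move/reflectedP: r1 => [z1 _ _]; move/reflectedP: r2 => [z2 _ _].
  by rewrite z1 z2 in hpos; case: hpos.
apply: (reflected_inj r1 r2); apply: IHm; first exact: null_reflected r2 hb.
move/reflectedP: r1 => [_ _ [_ z1 _]]; move/reflectedP: r2 => [_ _ [_ z2 _]].
by rewrite !Up_other z1 z2.
Qed.

(** By (I) the right datum of the MV polytope has a positive alpha_0-entry, so f_0 lowers [b] and
    the right data agree by induction. Then (I), applied to both maps, recovers the partition: its
    largest part from the alpha_0-entry, the others from the right imaginary part. *)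
Lemma agree_pure b : wt b = v ->
  (forall r, coef (cl (P b)) r = 0%N) -> (forall r, coef (cl (MV b)) r = 0%N) ->
  ld_eq (cl (P b)) (cl (MV b)).
Proof.
move=> hb p0 m0; split; first by move=> r; rewrite p0 m0.
have pp := partition_side Node1 (nc_dp HP b); have pm := partition_side Node1 (nc_dp HM b).
rewrite /= in pp pm.
have es1 : sumn (cdel (cl (P b))) = sumn (cdel (cl (MV b))).
  apply/eqP; rewrite -(eqr_nat rat) -(pure_wt t p0) -(pure_wt t m0).
  by have /= -> := nc_wt HP Node1 b; have /= -> := nc_wt HM Node1 b.
have [lm|nm] := eqVneq (cdel (cl (MV b))) [::].
  by rewrite lm; apply: partition_sumn0 => //; rewrite es1 lm.
have np : cdel (cl (P b)) != [::].
  apply/eqP => lp; move/eqP: nm; apply; apply: partition_sumn0 => //.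
  by rewrite -es1 lp.
have [_ [mp1 [md _]]] := nc_imag HM m0 nm; have [_ [pp1 [pd _]]] := nc_imag HP p0 np.
have inm := largest_part_mem nm; have inp := largest_part_mem np.
have mpos : (0 < largest_part (cdel (cl (MV b))))%N.
  by case/andP: pm => _ /allP; apply.
have ag : ld_eq (cr (P b)) (cr (MV b)).
  case hf : (f Node0 b) => [c|]; first exact: (agree_f (i := Node0) (hv hb) hf).
  have [s hs] := sigma_exists Node0 b.
  case/reflectedP: (nc_sigma HM hf hs) => z _ _.
  by move: mpos; rewrite -mp1 -[coef _ _]/(coef (side Node0 (MV b)) (Up Node0 0)) z.
case: ag => ag1 ag2.
have el : largest_part (cdel (cl (P b))) = largest_part (cdel (cl (MV b))).
  by rewrite -mp1 -pp1 ag1.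
rewrite pd md el in ag2; apply: geq_sorted_eq.
- by case/andP: pp.
- by case/andP: pm.
rewrite el in inp; rewrite (perm_trans (perm_to_rem inp)) // ag2 perm_sym.
exact: perm_to_rem.
Qed.

Lemma agree_null i b : wt b = v -> ld_eq (side i (P b)) (side i (MV b)).
Proof.
move=> hb.
have pos (r : preal) : (0 < coef (side i (P b)) r)%N \/ (0 < coef (side i (MV b)) r)%N ->
    ld_eq (side i (P b)) (side i (MV b)).
  by have [k [->|->]] := preal_case i r; [apply: agree_lo|apply: agree_up].
case: (coef_zero_or_pos (side i (P b))) => [p0|[r hr]]; last by apply: (pos r); left.
case: (coef_zero_or_pos (side i (MV b))) => [m0|[r hr]]; last by apply: (pos r); right.
(* (I) speaks about left data. A purely imaginary right datum is treated by f_0 or else carried to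
   the left by sigma_0. *)
case: (i) p0 m0 {pos} => p0 m0; last exact: agree_pure.
case hf : (f Node0 b) => [c|]; first exact: agree_f (hv hb) hf.
have [s hs] := sigma_exists Node0 b.
have r1 := nc_sigma HP hf hs; have r2 := nc_sigma HM hf hs.
apply: (reflected_inj r1 r2); apply: agree_pure; first exact: null_reflected r2 hb.
  move/reflectedP: r1 => [_ z [z1 z2 _]] r.
  have [[|k] [->|->]] := preal_case Node0 r;
  [exact: etrans (z2 _) (p0 _)|exact: z|exact: etrans (z2 _) (p0 _)|exact: etrans (z1 _) (p0 _)].
move/reflectedP: r2 => [_ z [z1 z2 _]] r.
have [[|k] [->|->]] := preal_case Node0 r;
[exact: etrans (z2 _) (m0 _)|exact: z|exact: etrans (z2 _) (m0 _)|exact: etrans (z1 _) (m0 _)].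
Qed.

End Height.

Lemma conditions_unique b i : ld_eq (side i (P b)) (side i (MV b)).
Proof.
elim/(height_ind (wt := wt)): b i => b IH i.
case: (ltP 0 (coroot_pair t i (wt b))) => h; first by case: (agree_pos IH (leqnn _) h).
case: (ltP 0 (coroot_pair t (other i) (wt b))) => h'.
  by case: (agree_pos IH (leqnn _) h'); rewrite otherK.
have [c1 c2] := null_weight h h'.
apply: (agree_null IH (v := wt b)) => // [j|c hc].
  by case: (i) (j) c1 c2 => -[].
by rewrite /height hc.
Qed.

End Uniqueness.

Theorem mainTheorem3 (t : gtype) (B : Type) (b0 : B) (wt : B -> vec)
  (e : node -> B -> B) (f : node -> B -> option B)
  (es : node -> B -> B) (fs : node -> B -> option B)
  (HB : is_Binf t b0 wt e f es fs)
  (MV : B -> dpwp) (HMV : mv_crystal_iso t wt e MV) :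
  conditions t wt e es f fs MV /\
  (forall P : B -> dpwp, conditions t wt e es f fs P ->
     forall b, pw_eq (P b) (MV b)).
Proof.
split; first exact: MV_conditions HB HMV.
move=> P HP b; have h := conditions_unique HB HMV (node_conditionsP HP) b.
by split; [exact: h Node1|exact: h Node0].
Qed.
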